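(* For any $$\alpha_1\alpha_2\cdots\alpha_6\in\mathfrak A_L=\{011111,\ 011110,\ 101100,\ 011100,\ 101111,\ 101110,\ 101011,\ 100100,\ 110100\}$$ there is a differential dynamical system $(M,f)$ such that $\mathscr C(\alpha_1\alpha_2\cdots\alpha_6)$ has positive Lebesgue measure.
   Context: A differential dynamical system $(M,f)$ means: $M$ is a compact smooth Riemannian manifold of positive dimension (possibly with boundary) and $f:M\to M$ is a differentiable ($C^1$) map; Lebesgue measure is the Riemannian volume. For $x\in M$: $\operatorname{orb}(x,f)=\{f^n(x)\}_{n\ge0}$, $\omega_f(x)=\bigcap_{n\ge1}\overline{\bigcup_{k\ge n}\{f^k(x)\}}$, $B(y,\varepsilon)$ is the open ball, $N(x,U)=\{n\ge0:f^n(x)\in U\}$. Densities of a set $S$ of nonnegative integers: $\overline d(S)=\limsup_{n\to\infty}\frac{|S\cap\{0,\dots,n-1\}|}{n}$, $\underline d(S)=\liminf_{n\to\infty}\frac{|S\cap\{0,\dots,n-1\}|}{n}$, $\overline B(S)=\limsup_{|I|\to\infty}\frac{|S\cap I|}{|I|}$, $\underline B(S)=\liminf_{|I|\to\infty}\frac{|S\cap I|}{|I|}$, with $I$ ranging over finite intervals of consecutive integers. For $\xi\in\{\overline d,\underline d,\overline B,\underline B\}$, $\omega_\xi(x)=\{y\in M:\xi(N(x,B(y,\varepsilon)))>0\text{ for every }\varepsilon>0\}$. For $\alpha_1\cdots\alpha_6\in\{0,1\}^6$, $\mathscr C(\alpha_1\cdots\alpha_6)$ is the set of $x\in M$ with $$\emptyset\star_1\omega_{\underline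 B}(x)\star_2\omega_{\underline d}(x)\star_3\omega_{\overline d}(x)\star_4\omega_{\overline B}(x)\star_5\omega_f(x)\star_6\overline{\operatorname{orb}(x,f)},$$ where $\star_i$ is $\subsetneq$ if $\alpha_i=0$ and $=$ if $\alpha_i=1$. *)

(* Defs.v *)
From HB Require Import structures.
From mathcomp Require Import all_boot all_order all_algebra.
From mathcomp Require Import all_classical all_reals all_analysis.

Set Implicit Arguments.
Unset Strict Implicit.
Unset Printing Implicit Defensive.

Import Order.TTheory GRing.Theory Num.Theory.
Import numFieldNormedType.Exports.

Local Open Scope classical_set_scope.
Local Open Scope ring_scope.

Section differentiability.
Context {R : realType} {n : nat}.
Implicit Types (U S : set 'rV[R]_n).

(* f is C^k at the points of the open set U *)
Fixpoint Ck_open {W : normedModType R} (k : nat) U (f : 'rV[R]_n -> W) : Prop :=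
  (forall x, U x -> {for x, continuous f}) /\
  if k is k'.+1 then
    forall i : 'I_n, (forall x, U x -> derivable f x (delta_mx 0 i)) /\
      Ck_open k' U (fun x => 'D_(delta_mx 0 i) f x)
  else True.

(* On an arbitrary S, as usual for manifolds with boundary: every point of S has
   an open neighbourhood to which f extends with the required regularity. *)
Definition Ck_on {W : normedModType R} (k : nat) S (f : 'rV[R]_n -> W) :=
  forall x, S x -> exists (U : set 'rV[R]_n) (g : 'rV[R]_n -> W),
    [/\ open U, U x, Ck_open k U g & {in U `&` S, g =1 f}].

Definition smooth_on {W : normedModType R} S (f : 'rV[R]_n -> W) :=
  forall x, S x -> exists (U : set 'rV[R]_n) (g : 'rV[R]_n -> W),
    [/\ open U, U x, forall k, Ck_open k U g & {in U `&` S, g =1 f}].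

(* A is the matrix of the differential of f at x, acting on row vectors by
   v |-> v *m A. One-sided at boundary points, where S is relatively open in a
   half-space, so that A is still unique. *)
Definition has_jacobian_within S (f : 'rV[R]_n -> 'rV[R]_n) (x : 'rV[R]_n)
    (A : 'M[R]_n) :=
  forall e : R, 0 < e -> \forall y \near within S (nbhs x),
    `|f y - f x - (y - x) *m A| <= e * `|y - x|.

Definition half_space : set 'rV[R]_n :=
  [set x | forall i : 'I_n, i = 0%N :> nat -> 0 <= x 0 i].

End differentiability.

Section lebesgue.
Context {R : realType}.
Local Open Scope ereal_scope.

(* n-dimensional Lebesgue measure, on n-tuples because these carry the product
   sigma-algebra *)
Fixpoint lebesgue_tuple (n : nat) : set (n.-tuple (measurableTypeR R)) -> \bar R :=
  if n is n'.+1 then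
    pushforward (@lebesgue_measure R \x @lebesgue_tuple n')
      (fun p : measurableTypeR R * n'.-tuple (measurableTypeR R) =>
        [tuple of p.1 :: p.2])
  else \d_[tuple].

Definition rV_of_tuple n (t : n.-tuple R) : 'rV[R]_n := \row_i tnth t i.

Definition integral_rV n (A : set 'rV[R]_n) (h : 'rV[R]_n -> \bar R) : \bar R :=
  \int[@lebesgue_tuple n]_(t in (@rV_of_tuple n) @^-1` A) h (rV_of_tuple t).

End lebesgue.

Record chart (R : realType) (n : nat) (M : ptopologicalType) := Chart {
  chart_dom : set M;
  chart_map :> M -> 'rV[R]_n;
  chart_inv : 'rV[R]_n -> M }.

Section charts.
Context {R : realType} {n : nat} {M : ptopologicalType}.
Implicit Types c d : chart R n M.

Definition chart_im c : set 'rV[R]_n := c @` chart_dom c.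

(* homeomorphism from an open set of M onto a relatively open set of the
   half-space *)
Definition is_chart c :=
  [/\ open (chart_dom c),
      exists2 U : set 'rV[R]_n, open U & chart_im c = U `&` half_space,
      {in chart_dom c, cancel c (chart_inv c)},
      {within chart_dom c, continuous c} &
      {within chart_im c, continuous (chart_inv c)}].

Definition transition_dom c d := c @` (chart_dom c `&` chart_dom d).

Definition transition c d : 'rV[R]_n -> 'rV[R]_n := d \o chart_inv c.

End charts.

(* Compact smooth Riemannian manifold of dimension n, possibly with boundary.
   [metric c p] is the Gram matrix of the metric at p in the coordinates c. *)
Record riemannianManifold (R : realType) (n : nat) := RiemannianManifold {
  carrier :> ptopologicalType;
  carrier_hausdorff : hausdorff_space carrier;
  carrier_second_countable : @second_countable carrier;
  carrier_compact : compact [set: carrier];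
  atlas : set (chart R n carrier);
  atlas_chart : forall c, atlas c -> is_chart c;
  atlas_cover : \bigcup_(c in atlas) chart_dom c = [set: carrier];
  atlas_smooth : forall c d, atlas c -> atlas d ->
    smooth_on (transition_dom c d) (transition c d);
  metric : chart R n carrier -> carrier -> 'M[R]_n;
  metric_sym : forall c p, atlas c -> chart_dom c p ->
    (metric c p)^T = metric c p;
  metric_pos : forall c p, atlas c -> chart_dom c p ->
    forall v : 'rV[R]_n, v != 0 -> 0 < (v *m metric c p *m v^T) 0 0;
  metric_smooth : forall c, atlas c -> forall i j : 'I_n,
    smooth_on (chart_im c) (fun x => metric c (chart_inv c x) i j);
  metric_compat : forall c d p, atlas c -> atlas d ->
    chart_dom c p -> chart_dom d p -> forall A : 'M[R]_n,
    has_jacobian_within (transition_dom c d) (transition c d) (c p) A ->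
    metric c p = A *m metric d p *m A^T }.

Section riemannian.
Context {R : realType} {n : nat} (M : riemannianManifold R n).
Implicit Types (c d : chart R n M) (p q x y : M).
Local Open Scope ereal_scope.

(* Only the values on [0, 1] matter below; a C^1 curve on [0, 1] extends to one
   on R. *)
Definition C1_curve (g : R -> 'rV[R]_n) :=
  (forall t, derivable g t 1) /\ continuous (derive1 g).

Definition curve_length c (g : R -> 'rV[R]_n) : \bar R :=
  \int[@lebesgue_measure R]_(t in `[0%R, 1%R])
    (Num.sqrt ((derive1 g t *m metric c (chart_inv c (g t)) *m (derive1 g t)^T) 0 0))%:E.

(* [piecewise_path p q l]: a piecewise C^1 path of length l leads from p to q.
   Each piece lies in one chart, which is no restriction, by subdivision. *)
Inductive piecewise_path p : M -> \bar R -> Prop :=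
| piecewise_path_nil : piecewise_path p p 0
| piecewise_path_cons q l c g :
    piecewise_path p q l -> atlas c -> C1_curve g ->
    (forall t, t \in `[0%R, 1%R] -> chart_im c (g t)) ->
    chart_inv c (g 0%R) = q ->
    piecewise_path p (chart_inv c (g 1%R)) (l + curve_length c g).

(* +oo between distinct components *)
Definition riemannian_dist p q : \bar R := ereal_inf [set l | piecewise_path p q l].

Definition riemannian_ball y (e : R) : set M := [set q | riemannian_dist y q < e%:E].

Definition borelM := g_sigma_algebraType (@open M).

Definition volume_density c (v : 'rV[R]_n) : \bar R :=
  (Num.sqrt (\det (metric c (chart_inv c v))))%:E.

(* As the chart domains cover M, this determines mu. *)
Definition is_riemannian_volume (mu : {measure set borelM -> \bar R}) :=
  forall c, atlas c -> forall A : set borelM, measurable A -> A `<=` chart_dom c ->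
    mu A = integral_rV (c @` A) (volume_density c).

(* A belongs to the completion of the Borel sets for the Riemannian volume, and
   its completed volume is positive. *)
Definition has_positive_volume (A : set M) :=
  exists2 mu : {measure set borelM -> \bar R}, is_riemannian_volume mu &
    exists B : set borelM, [/\ measurable B, B `<=` A,
      mu.-negligible (A `\` B) & 0 < mu B].

Definition C1_map (f : M -> M) :=
  continuous f /\ forall c d, atlas c -> atlas d ->
    Ck_on 1 (c @` (chart_dom c `&` f @^-1` chart_dom d)) (d \o f \o chart_inv c).

End riemannian.

Section densities.
Context {R : realType}.
Implicit Types S : set nat.
Local Open Scope ereal_scope.

(* |S `&` I| / |I| for the interval I = {a, ..., a + k - 1} *)
Definition proportion S (a k : nat) : \bar R :=
  (#|[pred i : 'I_k | `[< S (a + i)%N >]]|%:R / k%:R)%:E.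

Definition upper_density S : \bar R := limn_esup (proportion S 0).
Definition lower_density S : \bar R := limn_einf (proportion S 0).

(* |I| --> oo, where (a, k) stands for the interval {a, ..., a + k - 1} of
   nonnegative integers *)
Definition long_intervals : set_system (nat * nat) :=
  [set V | exists N, forall a k, (N <= k)%N -> V (a, k)].

Definition upper_banach_density S : \bar R :=
  limf_esup (fun I => proportion S I.1 I.2) long_intervals.
Definition lower_banach_density S : \bar R :=
  limf_einf (fun I => proportion S I.1 I.2) long_intervals.

End densities.

Section dynamics.
Context {R : realType} {n : nat} {M : riemannianManifold R n}.
Variable f : M -> M.
Implicit Types x y : M.

Definition orb x : set M := [set iter k f x | k in [set: nat]].

Definition omega x : set M :=
  \bigcap_(m in [set m | (1 <= m)%N])
    closure (\bigcup_(k in [set k | (m <= k)%N]) [set iter k f x]).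

Definition visits x (U : set M) : set nat := [set k | U (iter k f x)].

Definition omega_density (xi : set nat -> \bar R) x : set M :=
  [set y | forall e : R, 0 < e -> (0 < xi (visits x (riemannian_ball y e)))%E].

Definition omega_chain x : seq (set M) :=
  [:: set0;
      omega_density lower_banach_density x;
      omega_density lower_density x;
      omega_density upper_density x;
      omega_density upper_banach_density x;
      omega x;
      closure (orb x)].

Definition statistical_class (alpha : 6.-tuple bool) : set M :=
  [set x | forall i : 'I_6,
    let A := nth set0 (omega_chain x) i in
    let B := nth set0 (omega_chain x) i.+1 in
    if tnth alpha i then A = B else A `<` B].

End dynamics.

Definition frakA_L : seq (6.-tuple bool) :=
  let o := false in let i := true in
  [:: [tuple o; i; i; i; i; i];
      [tuple o; i; i; i; i; o];
      [tuple i; o; i; i; o; o];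
      [tuple o; i; i; i; o; o];
      [tuple i; o; i; i; i; i];
      [tuple i; o; i; i; i; o];
      [tuple i; o; i; o; i; i];
      [tuple i; o; o; i; o; o];
      [tuple i; i; o; i; o; o]].

(* Main.v *)
From HB Require Import structures.
Require Import Defs.
From mathcomp Require Import all_boot all_order all_algebra.
From mathcomp Require Import all_classical all_reals all_analysis.
From mathcomp Require Import measurable_realfun.
From mathcomp Require Import ring lra zify.

(**
Take for M the disjoint union of the segments [0, 1] and [2, 3], and let f be
some C^1 map F on [0, 1] and a constant p of [0, 1] on [2, 3].
If almost every orbit of F has pattern beta, then C(beta) contains almost all of
[0, 1]; and if the orbit of the single point p has pattern alpha, then C(alpha)
contains [2, 3] as soon as alpha_6 = 0, because a point of [2, 3] never returns.

- F = id gives 011111, and 011110 with p = 0.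
- F = second iterate of 4x(1-x), which is the multiplication of angles by 4.
  Almost every point has normal base 4 digits, so every point of [0, 1] has
  positive lower density, whereas two fixed points in the orbit closure exclude
  syndetic visits: 101111. A point p with normal digits gives 101110. The
  other patterns come from points p coded by digits 0 and 1 in long constant
  blocks: the orbit is nearly always close to one of the two corresponding fixed
  points, and the growth of the blocks decides which of them has positive
  lower density.
- F = the Boole map x - 1/x in the coordinate 1/(1+x^2). It maps the Cauchy
  law of scale y to the one of scale y + 1/y, so the scale after n steps is of
  order sqrt n: almost every orbit spends a proportion 1 of the time near
  infinity (the point 0), hence the upper density only sees 0. As the sum of the
  inverse scales diverges, there is no wandering set of positive measure, and with
  the eventual surjectivity on intervals almost every orbit is dense. Shadowing
  periodic points then shows that all of [0, 1] has positive upper Banach density: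
  101011.
*)

Set Implicit Arguments.
Unset Strict Implicit.
Unset Printing Implicit Defensive.

Import Order.TTheory GRing.Theory Num.Theory.
Import numFieldNormedType.Exports.

Local Open Scope classical_set_scope.
Local Open Scope ring_scope.

(** * Frequencies of visits *)

Section frequency.
Implicit Types S T : set nat.
Local Open Scope nat_scope.

(** Exceptional orbits are easy to prescribe but start from null sets; collapsing [2, 3] onto such a
    point p gives the orbit of p positive volume, at the cost of the last bit. Volume is taken in
    the completed sense, so a class must also be controlled on [0, 1]: almost every point there has
    one pattern beta with last bit 1, hence [0, 1] contributes a null set to any class with last bit
    0. Densities matter only through their positivity, which is an inequality between integers. The
    pattern 101011 asks for dense orbits with zero frequency away from one point, the behaviour of a
    conservative map with an infinite invariant measure: x - 1/x preserves Lebesgue measure on the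
    line. The coordinate 1 / (1 + x ^ 2) identifies x with -x and turns infinity into the neutral
    fixed point 0, which yields a smooth map of [0, 1]. Zero frequency and conservativity then both
    come from finite sums of inverse scales. Null sets are carried from angles to points by
    Lipschitz maps. *)

Definition cnt S a k := #|[pred i : 'I_k | `[< S (a + i) >]]|.

(** Positivity of each density means a proportion at least 1/q, written without division so that the
    combinatorics stays in [nat]. The witness q is uniform over all the windows concerned. *)
Definition lower_banach_pos S := exists q N, forall a k, N <= k -> k <= q * cnt S a k.
Definition lower_pos S := exists q N, forall k, N <= k -> k <= q * cnt S 0 k.
Definition upper_pos S := exists q, forall N, exists k, [/\ N <= k, 0 < k & k <= q * cnt S 0 k].
Definition upper_banach_pos S :=
  exists q, forall N, exists a k, [/\ N <= k, 0 < k & k <= q * cnt S a k].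
Definition infinitely_often S := forall N, exists2 k, N <= k & S k.
Definition some_time S := exists k, S k.

Lemma cntE S a k : cnt S a k = \sum_(i < k) `[< S (a + i) >].
Proof.
by rewrite /cnt -sum1_card big_mkcond /=; apply: eq_bigr => i _; rewrite inE; case: asboolP.
Qed.

Lemma cnt_le S a k : cnt S a k <= k.
Proof. by rewrite /cnt -[leqRHS](card_ord k) max_card. Qed.

Lemma cnt0 S a : cnt S a 0 = 0.
Proof. by rewrite cntE big_ord0. Qed.

Lemma cnt_mono S T a k : S `<=` T -> cnt S a k <= cnt T a k.
Proof.
move=> ST; rewrite !cntE; apply: leq_sum => i _.
by case: (asboolP (S (a + i))) => // /ST h; rewrite asboolT.
Qed.

Lemma cntD S a k l : cnt S a (k + l) = cnt S a k + cnt S (a + k) l.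
Proof.
by rewrite !cntE big_split_ord /=; congr (_ + _); apply: eq_bigr => i _; rewrite addnA.
Qed.

Lemma cnt_incr S a k l : k <= l -> cnt S a k <= cnt S a l.
Proof. by move=> /subnKC <-; rewrite cntD leq_addr. Qed.

Lemma cntC S a k : cnt S a k + cnt (~` S) a k = k.
Proof.
rewrite !cntE -big_split /= -[RHS](card_ord k) -sum1_card; apply: eq_bigr => i _.
by rewrite asbool_neg; case: asboolP.
Qed.

Lemma cnt_full S a k : (forall i, i < k -> S (a + i)) -> cnt S a k = k.
Proof.
move=> h; rewrite cntE -[RHS](card_ord k) -sum1_card; apply: eq_bigr => i _.
by rewrite asboolT//; apply: h.
Qed.

Lemma cnt_none S a k : (forall i, i < k -> ~ S (a + i)) -> cnt S a k = 0.
Proof.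
by move=> h; rewrite cntE big1// => i _; rewrite asboolF//; apply: h.
Qed.

Lemma cntS_ge S a k i : i < k -> S (a + i) -> 0 < cnt S a k.
Proof. by move=> ik Si; rewrite cntE (bigD1 (Ordinal ik))//= asboolT. Qed.

Lemma cnt_gt0 S a k : 0 < cnt S a k -> exists2 i, i < k & S (a + i).
Proof.
rewrite cntE lt0n sum_nat_eq0 negb_forall => /existsP[i] /=.
by case: asboolP => // Si _; exists i.
Qed.

Lemma cntU S T a k : cnt (S `|` T) a k <= cnt S a k + cnt T a k.
Proof.
rewrite !cntE -big_split /=; apply: leq_sum => i _.
have [[?|?]|h] := asboolP ((S `|` T) (a + i)) => //.
  by rewrite (asboolT (P := S _)).
by rewrite (asboolT (P := T _))// addnC.
Qed.

Lemma lower_banach_pos_lower S : lower_banach_pos S -> lower_pos S.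
Proof. by move=> [q [N h]]; exists q, N => k; exact: h. Qed.

Lemma lower_pos_upper S : lower_pos S -> upper_pos S.
Proof.
move=> [q [N h]]; exists q => M; exists (maxn 1 (maxn M N)).
by split; [lia|lia|apply: h; lia].
Qed.

Lemma upper_pos_banach S : upper_pos S -> upper_banach_pos S.
Proof. by move=> [q h]; exists q => N; have [k ?] := h N; exists 0, k. Qed.

(** A window longer than q * N contains more than N visits, and at most N of them fit in its first N
    places; another one happens at a time at least N. *)
Lemma upper_banach_pos_io S : upper_banach_pos S -> infinitely_often S.
Proof.
move=> [q h] N; have [a [k [Nk k0 kq]]] := h (q * N).+1.
have : cnt S a k <= N + cnt S (a + N) (k - N).
  have [kN|Nk'] := leqP k N; first by rewrite (leq_trans (cnt_le _ _ _))// (leq_trans kN)// leq_addr.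
  by rewrite -{1}(subnKC (ltnW Nk')) cntD leq_add2r cnt_le.
have qlt : N < cnt S a k by nia.
move=> le; have : 0 < cnt S (a + N) (k - N) by lia.
move=> /cnt_gt0[i _ Si]; exists (a + N + i) => //; lia.
Qed.

Lemma infinitely_often_some S : infinitely_often S -> some_time S.
Proof. by move=> /(_ 0)[k _ Sk]; exists k. Qed.

Lemma lower_banach_posS S T : S `<=` T -> lower_banach_pos S -> lower_banach_pos T.
Proof.
by move=> ST [q [N h]]; exists q, N => a k /(h a)/leq_trans; apply; rewrite leq_mul2l cnt_mono ?orbT.
Qed.

Lemma lower_posS S T : S `<=` T -> lower_pos S -> lower_pos T.
Proof.
by move=> ST [q [N h]]; exists q, N => k /h/leq_trans; apply; rewrite leq_mul2l cnt_mono ?orbT.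
Qed.

Lemma upper_posS S T : S `<=` T -> upper_pos S -> upper_pos T.
Proof.
move=> ST [q h]; exists q => N; have [k [? ? kq]] := h N; exists k; split => //.
by apply: leq_trans kq _; rewrite leq_mul2l cnt_mono ?orbT.
Qed.

Lemma upper_banach_posS S T : S `<=` T -> upper_banach_pos S -> upper_banach_pos T.
Proof.
move=> ST [q h]; exists q => N; have [a [k [? ? kq]]] := h N; exists a, k; split => //.
by apply: leq_trans kq _; rewrite leq_mul2l cnt_mono ?orbT.
Qed.

End frequency.

Section density.
Context {R : realType}.
Implicit Types S : set nat.
Local Open Scope ereal_scope.

Lemma limf_esup_gt0 (T : choiceType) (X : filteredType T) (f : X -> \bar R) (F : set_system X) : F setT ->
  0 < limf_esup f F <-> exists2 c : R, (0 < c)%R & forall A, F A -> exists2 x, A x & c%:E < f x.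
Proof.
move=> FT; rewrite limf_esupE; split.
  move=> h; have [c c0 ch] : exists2 c : R, (0 < c)%R & c%:E < ereal_inf [set ereal_sup (f @` V) | V in F].
    case: (ereal_inf _) h => [r r0|_|//]; last by exists 1%R => //; rewrite ltry.
    by exists (r / 2)%R; rewrite ?divr_gt0// lte_fin; move: r0; rewrite lte_fin => r0; lra.
  exists c => // A FA.
  have : c%:E < ereal_sup (f @` A) by apply: lt_le_trans ch _; apply: ereal_inf_lbound; exists A.
  by move=> /ereal_sup_gt[_ [x Ax <-] cx]; exists x.
move=> [c c0 h]; apply: (@lt_le_trans _ _ c%:E); first by rewrite lte_fin.
apply: le_ereal_inf_tmp => _ [A FA <-]; have [x Ax cx] := h A FA.
by apply: (le_trans (ltW cx)); apply: ereal_sup_ubound; exists x.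
Qed.

Lemma limf_einf_gt0 (T : choiceType) (X : filteredType T) (f : X -> \bar R) (F : set_system X) :
  0 < limf_einf f F <-> exists2 c : R, (0 < c)%R & exists2 A, F A & forall x, A x -> c%:E <= f x.
Proof.
rewrite limf_einfE; split.
  move=> /ereal_sup_gt[_ [A FA <-]] h.
  have [c c0 ch] : exists2 c : R, (0 < c)%R & c%:E <= ereal_inf (f @` A).
    case: (ereal_inf _) h => [r r0|_|//]; last by exists 1%R => //; rewrite leey.
    by exists r.
  by exists c => //; exists A => // x Ax; apply: (le_trans ch); apply: ereal_inf_lbound; exists x.
move=> [c c0 [A FA h]]; apply: (@lt_le_trans _ _ c%:E); first by rewrite lte_fin.
apply: (@le_trans _ _ (ereal_inf (f @` A))); last by apply: ereal_sup_ubound; exists A.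
by apply: le_ereal_inf_tmp => _ [x Ax <-]; exact: h.
Qed.

(** The constant is 1/(q + 1) rather than 1/q in order to get a strict inequality. *)
Lemma proportion_ge S a k q : (0 < k)%N -> (k <= q * cnt S a k)%N ->
  (q.+1%:R^-1)%:E < @proportion R S a k.
Proof.
move=> k0 kq; rewrite /proportion lte_fin -/(cnt S a k) ltr_pdivlMr ?ltr0n//.
rewrite mulrC ltr_pdivrMr ?ltr0n// -natrM ltr_nat.
have : (0 < cnt S a k)%N by nia.
nia.
Qed.

Lemma le_proportion S a k (c : R) : (0 < k)%N -> (0 < c)%R -> c%:E <= proportion S a k ->
  (k <= (Num.trunc c^-1).+1 * cnt S a k)%N.
Proof.
move=> k0 c0; rewrite /proportion lee_fin -/(cnt S a k) ler_pdivlMr ?ltr0n// => h.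
rewrite -(ler_nat R) natrM.
have hc : (c^-1 <= (Num.trunc c^-1).+1%:R)%R.
  by apply/ltW; rewrite truncnS_gt.
apply: le_trans (ler_wpM2r (ler0n _ _) hc).
by rewrite mulrC ler_pdivlMr// mulrC.
Qed.

Lemma proportion_gt0 S a k (c : R) : (0 < c)%R -> c%:E < proportion S a k -> (0 < k)%N.
Proof.
move=> c0; rewrite /proportion lte_fin; case: k => // h.
by move: h; rewrite invr0 mulr0 ltNge ltW.
Qed.

Lemma upper_density_gt0 S : 0 < @upper_density R S <-> upper_pos S.
Proof.
rewrite /upper_density /limn_esup limf_esup_gt0; last exact: filterT.
split=> [[c c0 h]|[q h]].
  exists (Num.trunc c^-1).+1 => N.
  have [|k Nk ck] := h [set k | (N <= k)%N]; first by exists N.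
  have k0 := proportion_gt0 c0 ck.
  by exists k; split => //; apply: le_proportion c0 (ltW ck).
exists (q.+1%:R^-1)%R; first by rewrite invr_gt0 ltr0n.
move=> A [N _ NA]; have [k [Nk k0 kq]] := h N.
by exists k; [exact: NA|exact: proportion_ge].
Qed.

Lemma upper_banach_density_gt0 S : 0 < @upper_banach_density R S <-> upper_banach_pos S.
Proof.
rewrite /upper_banach_density limf_esup_gt0; last by exists 0%N.
split=> [[c c0 h]|[q h]].
  exists (Num.trunc c^-1).+1 => N.
  have [|[a k] /= Nk ck] := h [set I | (N <= I.2)%N]; first by exists N.
  have k0 := proportion_gt0 c0 ck.
  by exists a, k; split => //; apply: le_proportion c0 (ltW ck).
exists (q.+1%:R^-1)%R; first by rewrite invr_gt0 ltr0n.
move=> A [N NA]; have [a [k [Nk k0 kq]]] := h N.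
by exists (a, k); [exact: NA|exact: proportion_ge].
Qed.

Lemma lower_density_gt0 S : 0 < @lower_density R S <-> lower_pos S.
Proof.
rewrite /lower_density (_ : limn_einf _ = limf_einf (@proportion R S 0) \oo)//.
rewrite limf_einf_gt0; split=> [[c c0 [A [N _ NA] h]]|[q [N h]]].
  exists (Num.trunc c^-1).+1, (maxn 1 N) => k Nk.
  by apply: le_proportion c0 _; [lia|apply: h; apply: NA => /=; lia].
exists (q.+1%:R^-1)%R; first by rewrite invr_gt0 ltr0n.
exists [set k | (maxn 1 N <= k)%N]; first by exists (maxn 1 N).
by move=> k /= Nk; apply/ltW/proportion_ge; [lia|apply: h; lia].
Qed.

Lemma lower_banach_density_gt0 S : 0 < @lower_banach_density R S <-> lower_banach_pos S.
Proof.
rewrite /lower_banach_density limf_einf_gt0; split=> [[c c0 [A [N NA] h]]|[q [N h]]].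
  exists (Num.trunc c^-1).+1, (maxn 1 N) => a k Nk.
  by apply: le_proportion c0 _; [lia|apply: (h (a, k)); apply: NA => /=; lia].
exists (q.+1%:R^-1)%R; first by rewrite invr_gt0 ltr0n.
exists [set I | (maxn 1 N <= I.2)%N]; first by exists (maxn 1 N).
by move=> [a k] /= Nk; apply/ltW/proportion_ge; [lia|apply: h; lia].
Qed.

End density.

(** * The manifold: the disjoint union of two intervals *)

Section carrier.
Context {R : realType}.

Definition in_K (x : R) : bool := (0 <= x <= 1) || (2 <= x <= 3).

Definition pre_carrier := {x : R | in_K x}.

Lemma in_K0 : in_K 0. Proof. by rewrite /in_K lexx ler01. Qed.

HB.instance Definition _ := Choice.on pre_carrier.
HB.instance Definition _ := SubType.on pre_carrier.
HB.instance Definition _ := isPointed.Build pre_carrier (exist _ 0 in_K0).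

Definition Kval : pre_carrier -> R := val.

Definition K := initial_topology Kval.
HB.instance Definition _ := PseudoMetric.on K.
HB.instance Definition _ := Pointed.on K.

(** Total inverse of [coord]: a real outside the two segments is sent to the point 0, which
    [measurable_pt] and [Kvol] have to take into account. *)
Definition pt (x : R) : K := insubd (exist _ 0 in_K0 : pre_carrier) x.
Definition coord (x : K) : R := Kval x.

Lemma coordP (x : K) : in_K (coord x).
Proof. exact: valP. Qed.

Lemma ptK (x : R) : in_K x -> coord (pt x) = x.
Proof. by move=> h; rewrite /coord /pt /Kval insubdK. Qed.

Lemma coord_inj : injective coord.
Proof. exact: val_inj. Qed.

Lemma coordK (x : K) : pt (coord x) = x.
Proof. by apply: coord_inj; rewrite ptK// coordP. Qed.

Lemma continuous_coord : continuous coord.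
Proof. exact: initial_continuous. Qed.

Lemma K_ballE (x y : K) e : ball x e y <-> `|coord x - coord y| < e.
Proof. by []. Qed.

Lemma K_hausdorff : hausdorff_space K.
Proof.
rewrite ball_hausdorff => x y xy.
have d0 : 0 < `|coord x - coord y|.
  by rewrite normr_gt0 subr_eq0; apply: contraNneq xy => /coord_inj ->.
have h2 : 0 < `|coord x - coord y| / 2 by rewrite divr_gt0.
exists (PosNum h2, PosNum h2) => /=.
apply/eqP/seteqP; split => // z [] /K_ballE zx /K_ballE zy.
have := ler_distD (coord z) (coord x) (coord y).
rewrite leNgt => /negP; apply.
rewrite [ltRHS](splitr) ltrD//.
by rewrite distrC.
Qed.

Lemma K_compact : compact [set: K].
Proof.
have cK : compact [set x : R | in_K x].
  have -> : [set x : R | in_K x] = `[0, 1] `|` `[2, 3].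
    apply/seteqP; split => x /=; rewrite /in_K !in_itv /=.
      by move=> /orP[]; [left|right].
    by move=> [] ->//; rewrite orbT.
  apply: compactU; exact: segment_compact.
move=> F PF _.
have [|x [Kx Fx]] := cK (coord @ F) _.
  by apply: (@filterE _ F _ (coord @^-1` _)) => x; exact: coordP.
exists (pt x); split => // A B FA [_ [[C oC <-] Cx CB]].
have nC : nbhs x C by apply: open_nbhs_nbhs; split => //; move: Cx; rewrite /preimage /= -/(coord _) ptK.
have FcA : (coord @ F) (coord @` A).
  by apply: (@filterS _ F _ A (coord @^-1` _) _ FA) => z Az; exists z.
have [_ [[z Az <-] Cz]] := Fx _ _ FcA nC.
by exists z; split => //; exact: CB.
Qed.

Lemma K_second_countable : @second_countable K.
Proof. exact: compact_second_countable K_compact. Qed.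

End carrier.

Section lift.
Context {R : realType}.
Implicit Types (G : R -> R) (v : 'rV[R]_1) (x : R).

Definition rv1 x : 'rV[R]_1 := const_mx x.

Definition lift1 G v := rv1 (G (v 0 0)).

Lemma rv1E x : rv1 x 0 0 = x.
Proof. by rewrite mxE. Qed.

Lemma addrv1E v x : (v + rv1 x) 0 0 = v 0 0 + x.
Proof. by rewrite !mxE. Qed.

Lemma rv1K v : rv1 (v 0 0) = v.
Proof. by apply/rowP => i; rewrite mxE ord1. Qed.

Lemma rv1B x y : rv1 (x - y) = rv1 x - rv1 y.
Proof. by apply/rowP => i; rewrite !mxE. Qed.

Lemma rv1Z c x : rv1 (c * x) = c *: rv1 x.
Proof. by apply/rowP => i; rewrite !mxE. Qed.

Lemma norm_rV1 v : `|v| = `|v 0 0|.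
Proof.
rewrite (_ : `|v| = mx_norm v) // mx_normrE.
rewrite (bigmax_eq_arg _ (ord0, ord0)) //=.
by case: ([arg max_(i > _) _]%O) => i j /=; rewrite (ord1 i) (ord1 j).
Qed.

Lemma norm_rv1 x : `|rv1 x| = `|x|.
Proof. by rewrite norm_rV1 rv1E. Qed.

Lemma continuous_rv1 : continuous rv1.
Proof.
move=> x; apply/cvgrPdist_lt => e e0; near=> y.
rewrite -rv1B norm_rV1 rv1E; near: y.
exact: cvgr_dist_lt.
Unshelve. all: by end_near. Qed.

Lemma continuous_coord_rV : continuous (fun v => v 0 0).
Proof. exact: coord_continuous. Qed.

Lemma continuous_lift1 G : continuous G -> continuous (lift1 G).
Proof.
move=> cG v; apply: (@continuous_comp _ _ _ (fun v : 'rV[R]_1 => v 0 0) (rv1 \o G)).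
  exact: continuous_coord_rV.
by apply: continuous_comp; [exact: cG|exact: continuous_rv1].
Qed.

Lemma is_derive_lift1 G v i (df : R) : is_derive (v 0 0) 1 G df ->
  is_derive v (delta_mx 0 i) (lift1 G) (rv1 df).
Proof.
move=> dG.
have h : h^-1 *: ((lift1 G \o shift v) (h *: (delta_mx 0 i : 'rV[R]_1)) - lift1 G v) @[h --> 0^'] --> rv1 df.
  have -> : (fun h : R => h^-1 *: ((lift1 G \o shift v) (h *: (delta_mx 0 i : 'rV[R]_1)) - lift1 G v)) =
     rv1 \o (fun h : R => h^-1 *: ((G \o shift (v 0 0)) (h *: 1) - G (v 0 0))).
    apply/funext => h /=; rewrite /lift1 -rv1B -[_ *: _]rv1Z; congr (rv1 (_ * _)).
    by rewrite !mxE !ord1 eqxx /= /GRing.scale /=.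
  apply: (@cvg_comp _ _ _ _ rv1 _ (nbhs df)); last exact: continuous_rv1.
  have [dG1 dG2] := dG.
  by rewrite -dG2; exact: dG1.
by apply: DeriveDef; [apply: cvgP h|exact: cvg_lim h].
Qed.

Lemma Ck_open_cst k (U : set 'rV[R]_1) x : Ck_open k U (lift1 (cst x)).
Proof.
elim: k x => [|k ih] x /=; (split; first by move=> v _; apply: continuous_lift1; exact: cst_continuous) => // i.
split; first by move=> v _; have [] := @is_derive_lift1 (cst x) v i 0 _.
suff -> : (fun y => 'D_(delta_mx 0 i) (lift1 (cst x)) y) = lift1 (cst 0) by exact: ih.
by apply/funext => v; have [] := @is_derive_lift1 (cst x) v i 0 _.
Qed.

Lemma Ck_open_affine k (U : set 'rV[R]_1) a b : Ck_open k U (lift1 (fun x => a + b * x)).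
Proof.
have dE v : is_derive (v 0 0) 1 (fun x => a + b * x) b.
  by apply: is_derive_eq; rewrite /GRing.scale /= ; ring.
have cE : continuous (fun x => a + b * x).
  by move=> x; apply: cvgD; [exact: cvg_cst|apply: cvgM; [exact: cvg_cst|exact: cvg_id]].
case: k => [|k] /=; (split; first by move=> v _; exact: continuous_lift1) => // i.
split; first by move=> v _; have [] := is_derive_lift1 i (dE v).
suff -> : (fun y => 'D_(delta_mx 0 i) (lift1 (fun x => a + b * x)) y) = lift1 (cst b) by exact: Ck_open_cst.
by apply/funext => v; have [] := is_derive_lift1 i (dE v).
Qed.

Lemma C1_open_lift1 (U : set 'rV[R]_1) G G' :
  (forall x, is_derive x 1 G (G' x)) -> continuous G' -> Ck_open 1 U (lift1 G).
Proof.
move=> dG cG'.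
have cG : continuous G.
  by move=> x; apply: differentiable_continuous; apply/derivable1_diffP; have [] := dG x.
split; first by move=> v _; exact: continuous_lift1.
move=> i; split; first by move=> v _; have [] := is_derive_lift1 i (dG (v 0 0)).
suff -> : (fun y => 'D_(delta_mx 0 i) (lift1 G) y) = lift1 G'.
  by split => // v _; exact: continuous_lift1.
by apply/funext => v; have [] := is_derive_lift1 i (dG (v 0 0)).
Qed.

End lift.

Section charts.
Context {R : realType}.
Local Notation K := (@K R).

(* oe = (o, e) stands for the chart x |-> e * (x - o). *)
Definition chart_par : set (R * R) := [set (0, 1); (1, -1)] `|` [set (2, 1); (3, -1)].

(** One chart per endpoint, because the endpoint has to sit on the boundary of the half-space. Each
    chart misses the opposite end of its segment and has image [unit_ho]. *)
Definition Kchart (oe : R * R) : chart R 1 K := Chart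
  [set x : K | `|coord x - oe.1| < 1]
  (fun x => rv1 (oe.2 * (coord x - oe.1)))
  (fun v => pt (oe.1 + oe.2 * v 0 0)).

Definition Katlas : set (chart R 1 K) := Kchart @` chart_par.

Definition unit_ho : set 'rV[R]_1 := [set v | 0 <= v 0 0 < 1].

Lemma chart_par_sqr oe : chart_par oe -> oe.2 * oe.2 = 1.
Proof. by case=> -[->|->] /=; lra. Qed.

Lemma Kchart_domP oe (x : R) : chart_par oe -> in_K x -> `|x - oe.1| < 1 ->
  0 <= oe.2 * (x - oe.1) < 1.
Proof.
rewrite /in_K => -[[->|->]|[->|->]] /= /orP[] /andP[? ?];
  rewrite ltr_norml => /andP[? ?]; lra.
Qed.

Lemma Kchart_invP oe (v : R) : chart_par oe -> 0 <= v < 1 ->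
  in_K (oe.1 + oe.2 * v) /\ `|oe.1 + oe.2 * v - oe.1| < 1.
Proof.
rewrite /in_K ltr_norml => -[[->|->]|[->|->]] /= /andP[? ?]; split; lra.
Qed.

Lemma coord_chart_inv oe v : chart_par oe -> unit_ho v ->
  coord (chart_inv (Kchart oe) v) = oe.1 + oe.2 * v 0 0.
Proof. by move=> h /(Kchart_invP h)[hK _]; rewrite /= ptK. Qed.

Lemma Kchart_im oe : chart_par oe -> chart_im (Kchart oe) = unit_ho.
Proof.
move=> h; apply/seteqP; split => [_ [x /= xo <-]|v hv] /=.
  by rewrite /unit_ho /= rv1E; apply: Kchart_domP => //; exact: coordP.
have [hK hd] := Kchart_invP h hv.
exists (pt (oe.1 + oe.2 * v 0 0)); rewrite /= ptK//.
by rewrite addrC addKr mulrA chart_par_sqr// mul1r rv1K.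
Qed.

Lemma KchartK oe : chart_par oe -> cancel (Kchart oe) (chart_inv (Kchart oe)).
Proof.
move=> h x /=.
by rewrite rv1E mulrA chart_par_sqr// mul1r addrC subrK coordK.
Qed.

Lemma unit_hoE : unit_ho = [set v : 'rV[R]_1 | `|v 0 0| < 1] `&` half_space.
Proof.
apply/seteqP; split => [v /andP[h1 h2]|v /= [h1 h2]].
  by split => [|i _]; [rewrite /= ger0_norm|rewrite (ord1 i)].
by rewrite /unit_ho /= h2//= (le_lt_trans _ h1)// ler_norm.
Qed.

(** The margin 1/2 leaves room: every point at distance less than 1/2 from x is in the domain of the
    same chart, as [riemannian_ball_sup] requires. *)
Lemma Kchart_cover (x : K) : exists2 oe, chart_par oe & `|coord x - oe.1| <= 2^-1.
Proof.
have := coordP x; set r := coord x; rewrite /in_K => /orP[] /andP[h1 h2].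
  have [h|h] := leP r (2^-1).
    by exists (0, 1); [left; left|rewrite /= ler_norml; lra].
  by exists (1, -1); [left; right|rewrite /= ler_norml; lra].
have [h|h] := leP r (2 + 2^-1).
  by exists (2, 1); [right; left|rewrite /= ler_norml; lra].
by exists (3, -1); [right; right|rewrite /= ler_norml; lra].
Qed.

Lemma open_Kchart_dom oe : open (chart_dom (Kchart oe)).
Proof.
exists (ball oe.1 1); first exact: ball_open.
by apply/seteqP; split => x /=; rewrite /ball /= distrC.
Qed.

Lemma continuous_Kchart oe : continuous (Kchart oe).
Proof.
move=> x; apply: continuous_comp; last exact: continuous_rv1.
apply: (@continuous_comp _ _ _ coord (fun y => oe.2 * (y - oe.1))).
  exact: continuous_coord.
by apply: cvgM; [exact: cvg_cst|apply: cvgB; [exact: cvg_id|exact: cvg_cst]].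
Qed.

Lemma continuous_Kchart_inv oe : chart_par oe ->
  {within unit_ho, continuous (chart_inv (Kchart oe))}.
Proof.
move=> h.
apply: (@continuous_comp_initial (pre_carrier : choiceType) (subspace unit_ho) R (@Kval R) (chart_inv (Kchart oe))).
apply: (@subspace_eq_continuous _ _ _ (fun v : 'rV[R]_1 => oe.1 + oe.2 * v 0 0)).
  by move=> v; rewrite inE => hv; rewrite -coord_chart_inv.
apply: continuous_subspaceT => v.
apply: (@continuous_comp _ _ _ (fun v : 'rV[R]_1 => v 0 0) (fun y => oe.1 + oe.2 * y)).
  exact: continuous_coord_rV.
by apply: cvgD; [exact: cvg_cst|apply: cvgM; [exact: cvg_cst|exact: cvg_id]].
Qed.

Lemma Katlas_chart c : Katlas c -> is_chart c.
Proof.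
move=> [oe h <-]; split.
- exact: open_Kchart_dom.
- exists [set v : 'rV[R]_1 | `|v 0 0| < 1]; last by rewrite Kchart_im// unit_hoE.
  have -> : [set v : 'rV[R]_1 | `|v 0 0| < 1] = (fun v => v 0 0) @^-1` (ball 0 1).
    by apply/seteqP; split => x /=; rewrite /ball /= sub0r normrN.
  apply: open_comp; last exact: ball_open.
  by move=> v _; exact: continuous_coord_rV.
- by move=> x _; exact: KchartK.
- by apply: continuous_subspaceT; exact: continuous_Kchart.
- by rewrite Kchart_im//; exact: continuous_Kchart_inv.
Qed.

Lemma Katlas_cover : \bigcup_(c in Katlas) chart_dom c = [set: K].
Proof.
apply/seteqP; split => // x _; have [oe h hx] := Kchart_cover x.
by exists (Kchart oe) => //=; [exists oe|rewrite (le_lt_trans hx)//; lra].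
Qed.

Lemma transition_affine oe oe' v : chart_par oe -> unit_ho v ->
  transition (Kchart oe) (Kchart oe') v =
  lift1 (fun x => oe'.2 * (oe.1 - oe'.1) + (oe'.2 * oe.2) * x) v.
Proof.
move=> h hv; rewrite /transition /= /lift1; congr (rv1 _).
have [hK _] := Kchart_invP h hv.
by rewrite ptK//; ring.
Qed.

Lemma transition_dom_sub oe oe' : chart_par oe ->
  transition_dom (Kchart oe) (Kchart oe') `<=` unit_ho.
Proof. by move=> h _ [x [hx _] <-]; rewrite -(Kchart_im h); exists x. Qed.

Lemma Katlas_smooth c d : Katlas c -> Katlas d ->
    smooth_on (transition_dom c d) (transition c d).
Proof.
move=> [oe h <-] [oe' h' <-] v hv.
exists setT, (lift1 (fun x => oe'.2 * (oe.1 - oe'.1) + (oe'.2 * oe.2) * x)).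
split => //; first exact: openT.
  by move=> k; exact: Ck_open_affine.
move=> w; rewrite inE => -[_ hw]; rewrite transition_affine//.
exact: transition_dom_sub hw.
Qed.

Definition Kmetric (c : chart R 1 K) (p : K) : 'M[R]_1 := 1%:M.

Lemma Kmetric_pos c p : Katlas c -> chart_dom c p ->
    forall v : 'rV[R]_1, v != 0 -> 0 < (v *m Kmetric c p *m v^T) 0 0.
Proof.
move=> _ _ v v0; rewrite mulmx1 mxE big_ord1 mxE -expr2 exprn_even_gt0//=.
by apply: contra v0 => /eqP v0; rewrite -(rv1K v) v0; apply/eqP/rowP => i; rewrite !mxE.
Qed.

Lemma Kmetric_smooth c : Katlas c -> forall i j : 'I_1,
    smooth_on (chart_im c) (fun x => Kmetric c (chart_inv c x) i j).
Proof.
move=> _ i j v _; exists setT, (cst 1).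
split => //; first exact: openT.
  move=> k; elim: k 1 => [|k ih] x /=; (split; first by move=> w _; exact: cst_continuous) => // l.
  split; first by move=> w _; apply: derivable_cst.
  suff -> : (fun y => 'D_(delta_mx 0 l) (cst x : 'rV[R]_1 -> R) y) = cst 0 by exact: ih.
  by apply/funext => w; rewrite derive_cst.
by move=> w _; rewrite /Kmetric mxE !ord1.
Qed.

(** A transition is affine of slope s = 1 or -1, and its Jacobian is unique even where only
    increments t > 0 are allowed; so A is s, and s * s = 1. *)
Lemma Kmetric_compat c d p : Katlas c -> Katlas d ->
    chart_dom c p -> chart_dom d p -> forall A : 'M[R]_1,
    has_jacobian_within (transition_dom c d) (transition c d) (c p) A ->
    Kmetric c p = A *m Kmetric d p *m A^T.
Proof.
move=> [oe h <-] [oe' h' <-] hc hd A hA.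
pose s := oe'.2 * oe.2.
have s2 : s * s = 1.
  by rewrite /s mulrACA !chart_par_sqr// mulr1.
suff As : A 0 0 = s.
  rewrite mulmx1; apply/matrixP => i j; rewrite !ord1 !mxE big_ord1 !mxE.
  by rewrite As s2.
apply/eqP; rewrite -subr_eq0 -normr_le0; apply/ler_addgt0Pr => e e0; rewrite add0r.
have cv : unit_ho (Kchart oe p) by rewrite -(Kchart_im h); exists p.
set v := Kchart oe p in cv hA *.
have /nbhs_ballP[r r0 hball] : nbhs v [set y |
    transition_dom (Kchart oe) (Kchart oe') y ->
    `|transition (Kchart oe) (Kchart oe') y - transition (Kchart oe) (Kchart oe') v
      - (y - v) *m A| <= e * `|y - v|] := hA _ e0.
have {}r0 : 0 < r by exact: r0.
(* Half the minimum of the radius r and of the room left in the two charts. The increment is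
   positive because p may be a boundary point. *)
have [t [t0 tr ht]] : exists t, [/\ 0 < t, t < r & transition_dom (Kchart oe) (Kchart oe') (v + rv1 t)].
  have m1 : 0 < 1 - v 0 0 by move: cv => /andP[]; lra.
  have m2 : 0 < 1 - `|coord p - oe'.1| by rewrite subr_gt0.
  pose t := Num.min r (Num.min (1 - v 0 0) (1 - `|coord p - oe'.1|)) / 2.
  have m0 : 0 < Num.min r (Num.min (1 - v 0 0) (1 - `|coord p - oe'.1|)).
    by rewrite !lt_min r0 m1.
  have t0 : 0 < t by rewrite divr_gt0.
  have tm : t < Num.min r (Num.min (1 - v 0 0) (1 - `|coord p - oe'.1|)).
    by rewrite /t ltr_pdivrMr// ltr_pMr// ltr1n.
  move: tm; rewrite !lt_min => /and3P[tr t1 t2].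
  exists t; split => //.
  have hvt : unit_ho (v + rv1 t).
    by rewrite /unit_ho /= addrv1E; case/andP: cv => v0 v1; lra.
  have := hvt; rewrite -(Kchart_im h) => -[q hq hqe].
  exists q => //; split => //=.
  have := congr1 (fun v : 'rV[R]_1 => v 0 0) hqe; rewrite addrv1E.
  rewrite /v /= !rv1E => E.
  have -> : coord q = coord p + oe.2 * t.
    have ee := chart_par_sqr h.
    by rewrite -[coord q](subrK oe.1) -[_ - _]mul1r -ee -mulrA E mulrDr mulrA ee mul1r; ring.
  rewrite addrAC (le_lt_trans (ler_normD _ _))// normrM (ger0_norm (ltW t0)).
  have -> : `|oe.2| = 1.
    by case: h => -[->|->] /=; rewrite ?normrN normr1.
  by rewrite mul1r; lra.
have hv : unit_ho (v + rv1 t) by exact: transition_dom_sub ht.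
have hb : ball v r (v + rv1 t).
  by rewrite -ball_normE /ball_ /= opprD addNKr normrN norm_rV1 rv1E (gtr0_norm t0).
have := hball _ hb ht.
rewrite !transition_affine//.
have -> : v + rv1 t - v = rv1 t by rewrite addrAC subrr add0r.
have -> : rv1 t *m A = rv1 (t * A 0 0).
  by apply/rowP => i; rewrite !mxE big_ord1 !mxE (ord1 i).
rewrite /lift1 -!rv1B !norm_rv1 (gtr0_norm t0) addrv1E -/s.
rewrite (_ : _ - _ - _ = - (t * (A 0 0 - s))); last by ring.
by rewrite normrN normrM (gtr0_norm t0) mulrC ler_pM2r.
Qed.

Definition KM : riemannianManifold R 1 := @RiemannianManifold R 1 K
  K_hausdorff K_second_countable K_compact Katlas Katlas_chart Katlas_cover
  Katlas_smooth Kmetric (fun c p _ _ => trmx1 _ _) Kmetric_pos Kmetric_smooth Kmetric_compat.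

End charts.

Section distance.
Context {R : realType}.
Local Notation K := (@K R).
Local Notation KM := (@KM R).
Local Open Scope ereal_scope.

Lemma Kmetric_speed (v : 'rV[R]_1) c p :
  (Num.sqrt ((v *m @metric R 1 KM c p *m v^T) 0 0) = `|v 0 0|)%R.
Proof. by rewrite mulmx1 mxE big_ord1 mxE -expr2 sqrtr_sqr. Qed.

Lemma is_derive_coord (g : R -> 'rV[R]_1) t : derivable g t 1 ->
  is_derive t (1 : R)%R (fun s => g s 0 0)%R (derive1 g t 0 0)%R.
Proof.
move=> dg.
have h : (h^-1 *: (((fun s => g s 0 0) \o shift t) (h *: 1) - g t 0 0))%R
    @[h --> 0%R^'] --> (derive1 g t 0 0)%R.
  have -> : (fun h : R => h^-1 *: (((fun s => g s 0 0) \o shift t) (h *: 1) - g t 0 0))%R =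
     (fun v : 'rV[R]_1 => v 0 0)%R \o (fun h : R => h^-1 *: ((g \o shift t) (h *: 1) - g t))%R.
    by apply/funext => h /=; rewrite !mxE.
  apply: (@cvg_comp _ _ _ _ (fun v : 'rV[R]_1 => v 0 0)%R _ (nbhs (derive1 g t))); last exact: continuous_coord_rV.
  by rewrite derive1E; exact: dg.
by apply: DeriveDef; [exact: cvgP h|exact: cvg_lim h].
Qed.

(** The metric is 1, so the speed is the absolute value of a derivative whose integral is the
    displacement. *)
Lemma curve_length_ge c (g : R -> 'rV[R]_1) : C1_curve g ->
  `|g 1 0 0 - g 0 0 0|%R%:E <= @curve_length R 1 KM c g.
Proof.
move=> [dg cg].
pose G' t : R := (derive1 g t 0 0)%R.
have cG' : continuous G'.
  move=> t; apply: (@continuous_comp _ _ _ (derive1 g) (fun v : 'rV[R]_1 => v 0 0)%R).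
    exact: cg.
  exact: continuous_coord_rV.
have dG t : is_derive t (1 : R)%R (fun s => g s 0 0)%R (G' t).
  exact: is_derive_coord.
have cG : continuous (fun s => g s 0 0)%R.
  by move=> t; apply: differentiable_continuous; apply/derivable1_diffP; have [] := dG t.
have := @continuous_FTC2 R G' (fun s => g s 0 0)%R 0%R 1%R ltr01.
move=> /(_ (continuous_subspaceT cG')).
have dLR : derivable_oo_LRcontinuous (fun s => g s 0 0)%R 0%R 1%R.
  split=> [x _||]; first by have [] := dG x.
    by apply: cvg_at_right_filter; exact: cG.
  by apply: cvg_at_left_filter; exact: cG.
have dGE : {in `]0%R, 1%R[, derive1 (fun s => g s 0 0)%R =1 G'}.
  by move=> x _; rewrite derive1E; have [] := dG x.
move=> /(_ dLR dGE); rewrite -EFinB => E.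
rewrite -abse_EFin -E.
have mG : measurable_fun [set: measurableTypeR R] (fun x => (G' x)%:E).
  apply: (@measurableT_comp _ _ _ _ _ _ EFin); first exact: EFin_measurable.
  exact: continuous_measurable_fun.
apply: le_trans (le_abse_integral _ _ (measurable_funTS mG)) _ => //.
rewrite /curve_length; under [leRHS]eq_integral do rewrite Kmetric_speed.
by [].
Qed.

(** In each chart [coord] changes by a sign and a translation only, so the bounds for the pieces add
    up by the triangle inequality. *)
Lemma piecewise_path_ge (p q : KM) l : piecewise_path p q l ->
  `|coord q - coord p|%R%:E <= l.
Proof.
elim=> [|{}q {}l c g _ ih [oe h <-] Cg gim gq]; first by rewrite subrr normr0.
have g01 t : (0 <= t <= 1)%R -> unit_ho (g t).
  by move=> ht; rewrite -(Kchart_im h); apply: gim; rewrite in_itv.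
have := curve_length_ge (Kchart oe) Cg.
move: ih; rewrite -gq !coord_chart_inv//; [|by apply: g01; rewrite lexx ler01..].
move=> ih hl; apply: le_trans (leeD ih hl).
rewrite -EFinD lee_fin.
set a := (g 1%R 0 0)%R; set b := (g 0%R 0 0)%R.
have -> : (oe.1 + oe.2 * a - coord p = (oe.1 + oe.2 * b - coord p) + oe.2 * (a - b))%R.
  by ring.
rewrite (le_trans (ler_normD _ _))// lerD2l normrM.
have -> : (`|oe.2| = 1)%R.
  by case: h => -[->|->] /=; rewrite ?normrN normr1.
by rewrite mul1r.
Qed.

Lemma riemannian_ball_sub (y q : KM) e : riemannian_ball y e q ->
  (`|coord q - coord y| < e)%R.
Proof.
rewrite /riemannian_ball /= /riemannian_dist => /ereal_inf_lt[l /= hl le].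
by rewrite -lte_fin (le_lt_trans _ le)// piecewise_path_ge.
Qed.

Lemma is_derive_line (a b t : R) : is_derive t (1 : R)%R (fun t : R => rv1 (a + t * b)) (rv1 b).
Proof.
have h : (h^-1 *: (((fun t : R => rv1 (a + t * b)) \o shift t) (h *: 1) - rv1 (a + t * b)))%R
    @[h --> 0%R^'] --> rv1 b.
  apply: (@cvg_trans _ (rv1 b @[h --> 0%R^'])); last exact: cvg_cst.
  apply: near_eq_cvg; near=> h.
  have h0 : (h != 0)%R by near: h; exact: nbhs_dnbhs_neq.
  rewrite /= -rv1B -rv1Z; congr rv1.
  rewrite (_ : _ - _ = h * b)%R; last by rewrite /GRing.scale /=; ring.
  by rewrite mulKf.
by apply: DeriveDef; [exact: cvgP h|exact: cvg_lim h].
Unshelve. all: by end_near. Qed.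

Lemma curve_length_line c (a b : R) :
  @curve_length R 1 KM c (fun t : R => rv1 (a + t * b)) = `|b|%:E.
Proof.
rewrite /curve_length.
under eq_integral => t _.
  rewrite Kmetric_speed derive1E.
  have [_ ->] := is_derive_line a b t.
  rewrite rv1E.
  over.
by rewrite integral_cst//= lebesgue_measure_itv/= lte_fin ltr01 oppr0 adde0 mule1.
Qed.

(** The two segments are at infinite Riemannian distance, so the comparison with coordinates is
    local: below 1/2 both points lie in one chart and are joined there by a line of length |b|. *)
Lemma riemannian_ball_sup (y q : KM) e : (`|coord q - coord y| < e)%R ->
  (`|coord q - coord y| < 2^-1)%R -> riemannian_ball y e q.
Proof.
move=> qe q2; have [oe h hy] := Kchart_cover y.
have yd : chart_dom (Kchart oe) y by rewrite /= (le_lt_trans hy)//; lra.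
have qd : chart_dom (Kchart oe) q.
  rewrite /= -(subrK (coord y) (coord q)) -addrA (le_lt_trans (ler_normD _ _))//.
  by lra.
pose a := (Kchart oe y 0 0)%R; pose b := (Kchart oe q 0 0 - a)%R.
have ha : unit_ho (rv1 a) by rewrite rv1K -(Kchart_im h); exists y.
have hb : unit_ho (rv1 (a + b)) by rewrite addrC subrK rv1K -(Kchart_im h); exists q.
have bE : (`|b| = `|coord q - coord y|)%R.
  rewrite /b /a /= !rv1E -mulrBr opprB addrA subrK normrM.
  by case: h => -[->|->] /=; rewrite ?normrN normr1 mul1r.
rewrite /riemannian_ball /= /riemannian_dist.
apply: (@le_lt_trans _ _ `|b|%:E); last by rewrite bE lte_fin.
apply: ereal_inf_lbound => /=.
have qE : q = chart_inv (Kchart oe) (rv1 (a + 1 * b)%R).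
  by rewrite mul1r /b addrC subrK rv1K KchartK.
rewrite {1}qE -(curve_length_line (Kchart oe) a b) -[X in piecewise_path _ _ X]add0e.
apply: (@piecewise_path_cons R 1 KM y y 0 (Kchart oe) (fun t : R => rv1 (a + t * b))).
- exact: piecewise_path_nil.
- by exists oe.
- split.
    by move=> t; have [] := is_derive_line a b t.
  have -> : derive1 (fun t : R => rv1 (a + t * b)) = cst (rv1 b).
    by apply/funext => t; rewrite derive1E; have [] := is_derive_line a b t.
  exact: cst_continuous.
- move=> t; rewrite in_itv /= => /andP[t0 t1].
  rewrite Kchart_im//; move: ha hb; rewrite /unit_ho /= !rv1E.
  move: a b {bE qE} => a b /andP[a0 a1] /andP[b0 b1]; apply/andP; split; first by nra.
  by have [t12|t12] := leP t (2^-1)%R; nra.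
- by rewrite mul0r addr0 rv1K KchartK.
Qed.

End distance.

(** * Lebesgue null sets *)

Section lipschitz_image.
Context {R : realType}.
Local Open Scope ereal_scope.
Implicit Types D S : set R.

(** For arbitrary sets: [lebesgue_measure] is the outer measure induced by [wlength], so subsets and
    images can be handled without proving them measurable. *)
Lemma lebesgue_le D S : D `<=` S -> @lebesgue_measure R D <= @lebesgue_measure R S.
Proof. exact: (@le_outer_measure _ _ ((@wlength R idfun)^*)%mu). Qed.

Lemma lebesgue_ge0 D : 0 <= @lebesgue_measure R D.
Proof. exact: (@outer_measure_ge0 _ _ ((@wlength R idfun)^*)%mu). Qed.

Lemma lebesgue_sigma_subadditive (F : (set R)^nat) :
  @lebesgue_measure R (\bigcup_k F k) <= \sum_(0 <= k <oo) @lebesgue_measure R (F k).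
Proof. exact: (@outer_measure_sigma_subadditive _ _ ((@wlength R idfun)^*)%mu). Qed.

Lemma lebesgue_diam S (d : R) : (0 <= d)%R ->
  (forall x y, S x -> S y -> (x - y <= d)%R) -> @lebesgue_measure R S <= d%:E.
Proof.
move=> d0 hd; have [->|/set0P S0] := eqVneq S set0; first by rewrite measure0 lee_fin.
have [s Ss] := S0.
have hub : has_ubound S by exists (s + d)%R => x Sx; rewrite -lerBlDl hd.
have hlb : has_lbound S by exists (s - d)%R => x Sx; rewrite lerBlDl -lerBlDr hd.
have SI : S `<=` `[inf S, sup S]%classic.
  by move=> x Sx /=; rewrite in_itv /= ge_inf// ub_le_sup.
apply: (le_trans (lebesgue_le SI)); rewrite lebesgue_measure_itv /= lte_fin.
case: ifPn => _; last by rewrite lee_fin.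
rewrite -EFinB lee_fin lerBlDr; apply: ge_sup => // x Sx.
by rewrite -lerBlDl; apply: lb_le_inf => // y Sy; rewrite lerBlDr -lerBlDl hd.
Qed.

(** Each interval of an open cover of D meets D in a set whose image has diameter at most C times
    the length of the interval. *)
Lemma lebesgue_lipschitz_image (C : R) (phi : R -> R) D : (0 < C)%R ->
  (forall x y, D x -> D y -> (`|phi x - phi y| <= C * `|x - y|)%R) ->
  @lebesgue_measure R (phi @` D) <= C%:E * @lebesgue_measure R D.
Proof.
move=> C0 hphi.
have [|Doo] := leP +oo (@lebesgue_measure R D).
  by rewrite leye_eq => /eqP ->; rewrite gt0_muley ?lte_fin// leey.
apply/lee_addgt0Pr => e e0.
have eC0 : (0 < e / C)%R by rewrite divr_gt0.
have [F AF Fe] : exists2 F, open_itv_cover D F &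
    \sum_(0 <= k <oo) (@wlength R idfun) (F k) <= @lebesgue_measure R D + (e / C)%:E.
  have : @lebesgue_measure R D \is a fin_num by rewrite ge0_fin_numE ?lebesgue_ge0.
  rewrite [lebesgue_measure D](outer_measure_open_itv_cover D).
  move=> /lb_ereal_inf_adherent-/(_ _ eC0)[_/= [F]] AF <- Fe.
  by exists F => //; exact/ltW.
have CE : C%:E * @lebesgue_measure R D + e%:E = C%:E * (@lebesgue_measure R D + (e / C)%:E).
  by rewrite ge0_muleDr ?lebesgue_ge0 ?lee_fin ?(ltW eC0)// -EFinM mulrCA mulfV ?mulr1// gt_eqF.
rewrite CE; apply: le_trans (lee_wpmul2l _ Fe); last by rewrite lee_fin ltW.
rewrite -nneseriesZl; last by move=> i _; exact: wlength_ge0.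
have sub : phi @` D `<=` \bigcup_k (phi @` (D `&` F k)).
  case: AF => _ DF _ [x Dx <-]; have [k _ Fk] := DF _ Dx.
  by exists k => //; exists x.
apply: (le_trans (lebesgue_le sub)).
apply: (le_trans (lebesgue_sigma_subadditive _)).
apply: lee_nneseries => [i _ _|i _]; first exact: lebesgue_ge0.
case: AF => /(_ i)[ep -> _]; move: ep.1 ep.2 => a b.
have [ab|ba] := leP a b; last first.
  rewrite set_itv_ge; last by rewrite bnd_simp -leNgt ltW.
  by rewrite setI0 image_set0 !measure0 mule0.
rewrite wlength_itv_bnd// -EFinM; apply: lebesgue_diam.
  by rewrite mulr_ge0 ?subr_ge0 ?(ltW C0).
move=> _ _ [x [Dx xab] <-] [y [Dy yab] <-].
apply: (le_trans (ler_norm _)); apply: (le_trans (hphi _ _ Dx Dy)).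
rewrite ler_pM2l//; move: xab yab; rewrite /= !in_itv /= => /andP[? ?] /andP[? ?].
by rewrite ler_norml; lra.
Qed.

Lemma negligible_lebesgue D :
  (@lebesgue_measure R).-negligible D <-> @lebesgue_measure R D = 0.
Proof. exact: negligible_outer_measure. Qed.

Lemma null_subset D S : D `<=` S ->
  (@lebesgue_measure R).-negligible S -> (@lebesgue_measure R).-negligible D.
Proof.
move=> DS /negligible_lebesgue S0; apply/negligible_lebesgue/eqP.
by rewrite eq_le lebesgue_ge0 andbT -S0 lebesgue_le.
Qed.

Lemma null_bigcup (D : nat -> set R) : (forall k, (@lebesgue_measure R).-negligible (D k)) ->
  (@lebesgue_measure R).-negligible (\bigcup_k D k).
Proof.
move=> D0; apply/negligible_lebesgue/eqP; rewrite eq_le lebesgue_ge0 andbT.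
apply: (le_trans (lebesgue_sigma_subadditive _)).
by rewrite eseries0// => k _ _; apply/negligible_lebesgue; exact: D0.
Qed.

Lemma null_setU D S : (@lebesgue_measure R).-negligible D ->
  (@lebesgue_measure R).-negligible S -> (@lebesgue_measure R).-negligible (D `|` S).
Proof.
move=> /negligible_lebesgue D0 /negligible_lebesgue S0; apply/negligible_lebesgue/eqP.
rewrite eq_le lebesgue_ge0 andbT -[leRHS]adde0 -{1}D0 -S0.
exact: (@outer_measureU2 _ _ ((@wlength R idfun)^*)%mu).
Qed.

Lemma negligible_lipschitz_image (C : R) (phi : R -> R) D : (0 < C)%R ->
  (forall x y, D x -> D y -> (`|phi x - phi y| <= C * `|x - y|)%R) ->
  (@lebesgue_measure R).-negligible D -> (@lebesgue_measure R).-negligible (phi @` D).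
Proof.
move=> C0 hphi /negligible_lebesgue D0; apply/negligible_lebesgue/eqP.
rewrite eq_le lebesgue_ge0 andbT.
by rewrite (le_trans (lebesgue_lipschitz_image C0 hphi))// D0 mule0.
Qed.

(** The Lipschitz bound with constant 1 is applied to [phi], then to its inverse on the image. *)
Lemma lebesgue_isometry_image (phi : R -> R) D :
  (forall x y, `|phi x - phi y| = `|x - y|)%R ->
  @lebesgue_measure R (phi @` D) = @lebesgue_measure R D.
Proof.
move=> hphi; apply/eqP; rewrite eq_le; apply/andP; split.
  rewrite -[leRHS]mul1e; apply: lebesgue_lipschitz_image => // x y _ _.
  by rewrite mul1r hphi.
have inj : injective phi.
  by move=> x y xy; have := hphi x y; rewrite xy subrr normr0 => /esym/normr0_eq0/subr0_eq.
have pK x : pinv setT phi (phi x) = x by rewrite pinvKV ?inE// => ? ? _ _; exact: inj.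
have {1}-> : D = (pinv setT phi) @` (phi @` D).
  apply/seteqP; split => [x Dx|_ [_ [x Dx <-] <-]]; last by rewrite pK.
  by exists (phi x); [exists x|exact: pK].
rewrite -[leRHS]mul1e; apply: lebesgue_lipschitz_image => // _ _ [x _ <-] [y _ <-].
by rewrite mul1r !pK hphi.
Qed.

End lipschitz_image.

(** * Riemannian volume of the two segments *)

Section volume.
Context {R : realType}.
Local Notation K := (@K R).
Local Notation KM := (@KM R).
Local Notation Kborel := (borelM KM).
Local Open Scope ereal_scope.

Definition K_R : set (measurableTypeR R) := [set x | in_K x].

Lemma measurable_K_R : measurable K_R.
Proof.
have -> : K_R = `[0%R, 1%R]%classic `|` `[2%R, 3%R]%classic.
  apply/seteqP; split => x /=; rewrite /K_R /= /in_K !in_itv /=.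
    by move=> /orP[]; [left|right].
  by move=> [] ->//; rewrite orbT.
exact: measurableU.
Qed.

Lemma measurable_pt : measurable_fun [set: measurableTypeR R] (pt : measurableTypeR R -> Kborel).
Proof.
apply: (@measurability _ _ _ Kborel setT pt (@open KM)) => // _ [_ [C oC <-] <-]; rewrite setTI.
have -> : pt @^-1` ((@Kval R) @^-1` C) = (K_R `&` C) `|` (~` K_R `&` [set x | C (0%R : R)]).
  apply/seteqP; split => x /=; rewrite -/(coord _) /K_R /=; have [hx|hx] := boolP (in_K x).
  - by rewrite ptK// => Cx; left.
  - by rewrite /coord /pt /Kval /insubd insubN//= => C0; right; split => //; exact/negP.
  - by rewrite ptK// => -[[]//|[]].
  - by rewrite /coord /pt /Kval /insubd insubN//= => -[[]|[]]//; rewrite (negbTE hx).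
apply: measurableU; apply: measurableI.
- exact: measurable_K_R.
- exact: open_measurable.
- by apply: measurableC; exact: measurable_K_R.
- have [C0|C0] := pselect (C 0%R).
    by rewrite (_ : [set _ | _] = setT)//; apply/seteqP; split.
  by rewrite (_ : [set _ | _] = set0)//; apply/seteqP; split.
Qed.

Lemma measurable_coord : measurable_fun [set: Kborel] (coord : Kborel -> measurableTypeR R).
Proof.
apply: (measurability _ (RGenOpens.measurableE R)) => // _ [_ [a [b ->] <-]]; rewrite setTI.
apply: sub_sigma_algebra; apply: open_comp; last exact: interval_open.
by move=> x _; exact: continuous_coord.
Qed.

(** Image of Lebesgue measure under [pt]; restricting to [K_R] first prevents [pt] from piling up
    the rest of the line on the point 0. *)
Definition Kvol (A : set Kborel) : \bar R :=
  mrestr (@lebesgue_measure R) measurable_K_R (pt @^-1` A).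

Let Kvol0 : Kvol set0 = 0.
Proof. by rewrite /Kvol preimage_set0 measure0. Qed.

Let Kvol_ge0 A : 0 <= Kvol A.
Proof. exact: measure_ge0. Qed.

Let Kvol_sigma_additive : semi_sigma_additive Kvol.
Proof.
move=> F mF tF mUF; rewrite /Kvol preimage_bigcup.
apply: measure_semi_sigma_additive.
- by move=> n; rewrite -[X in measurable X]setTI; exact: measurable_pt.
- apply/trivIsetP => /= i j _ _ ij; rewrite -preimage_setI.
  by move/trivIsetP : tF => /(_ i j) -> //; rewrite preimage_set0.
- by rewrite -preimage_bigcup -[X in measurable X]setTI; exact: measurable_pt.
Qed.

HB.instance Definition _ := isMeasure.Build _ Kborel R Kvol Kvol0 Kvol_ge0 Kvol_sigma_additive.

Lemma KvolE (A : set K) : Kvol A = @lebesgue_measure R (coord @` A).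
Proof.
rewrite /Kvol /mrestr; congr lebesgue_measure.
apply/seteqP; split => [x [Ax Kx]|_ [x Ax <-]]; first by exists (pt x); rewrite ?ptK.
by split; [rewrite /preimage /= coordK|exact: coordP].
Qed.

Lemma lebesgue_tuple1 (E : set (measurableTypeR R)) : measurable E ->
  @lebesgue_tuple R 1 [set t | E (tnth t ord0)] = @lebesgue_measure R E.
Proof.
move=> mE; rewrite /lebesgue_tuple /pushforward /product_measure1 /=.
rewrite (eq_integral (fun x => (\1_E x)%:E)) => [|x _]; first by rewrite integral_indic// setIT.
rewrite /= diracE indicE; congr (_%:R%:E); congr nat_of_bool.
rewrite (_ : xsection _ x = [set t | E x]).
  have [Ex|Ex] := pselect (E x); first by rewrite !mem_set.
  by rewrite !memNset.
apply/seteqP; split => t; rewrite /xsection /= inE /= (_ : tnth _ ord0 = x)//;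
  exact: tnth0.
Qed.

(** Stated for a bare pushforward, because [lebesgue_tuple] is a set function without measure
    structure; it becomes a measure once [f] is known to be measurable. *)
Lemma integral_pushforward1 d d' (T1 : measurableType d) (T2 : measurableType d')
    (m : {measure set T1 -> \bar R}) (f : T1 -> T2) (D : set T2) :
  measurable_fun [set: T1] f -> measurable D ->
  \int[pushforward m f]_(x in D) 1 = pushforward m f D.
Proof.
move=> mf mD.
pose m' : {measure set T2 -> \bar R} := measure_function_pushforward__canonical__measure_function_Measure m mf.
by rewrite -[RHS]mul1e -(@integral_cst _ _ _ m' D mD).
Qed.

Lemma integral_lebesgue_tuple1 (D : set (1.-tuple (measurableTypeR R))) : measurable D ->
  \int[@lebesgue_tuple R 1]_(x in D) 1 = @lebesgue_tuple R 1 D.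
Proof.
move=> mD; apply: (@integral_pushforward1 _ _ _ _ (@lebesgue_measure R \x \d_[tuple])) => //.
by apply: measurable_cons; [exact: measurable_fst|exact: measurable_snd].
Qed.

(** The volume density is 1, and the inverse of a chart, read on the line, is an isometry. *)
Lemma Kvol_riemannian : @is_riemannian_volume R 1 KM Kvol.
Proof.
move=> _ [oe h <-] A mA Adom.
rewrite /integral_rV /volume_density.
rewrite (eq_integral (cst 1)); last by move=> t _; rewrite det1 sqrtr1.
  by apply: measurable_cons; [exact: measurable_fst|exact: measurable_snd].
move=> mf.
pose E : set (measurableTypeR R) := `[0%R, 1%R[%classic `&` [set v | A (pt (oe.1 + oe.2 * v)%R)].
have mE : measurable E.
  apply: measurableI => //; rewrite -[X in measurable X]setTI.
  have mv : measurable_fun [set: measurableTypeR R] (fun v : measurableTypeR R => oe.1 + oe.2 * v : measurableTypeR R)%R.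
    by apply: measurable_funD => //; exact: measurable_funM.
  have := measurableT_comp measurable_pt mv; exact.
have DE : (@rV_of_tuple R 1) @^-1` (Kchart oe @` A) = [set t | E (tnth t ord0)].
  apply/seteqP; split => [t [x Ax] xt|t [t01 At]].
    have tE : tnth t ord0 = (oe.2 * (coord x - oe.1))%R.
      by have := congr1 (fun v : 'rV[R]_1 => v 0 0)%R xt; rewrite /= rv1E mxE => ->.
    split; rewrite /= tE.
      by rewrite in_itv /=; apply: Kchart_domP; [|exact: coordP|exact: Adom].
    by rewrite mulrA chart_par_sqr// mul1r addrC subrK coordK.
  exists (pt (oe.1 + oe.2 * tnth t ord0)%R) => //.
  have [Kt _] := Kchart_invP h t01.
  rewrite /= ptK// addrC addKr mulrA chart_par_sqr// mul1r.
  by apply/rowP => i; rewrite !mxE (ord1 i).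
transitivity (\int[@lebesgue_tuple R 1]_(x in [set t | E (tnth t ord0)]) 1); last by rewrite -DE.
rewrite integral_lebesgue_tuple1; last first.
  by rewrite -[X in measurable X]setTI; exact: (@measurable_tnth _ _ _ ord0).
rewrite lebesgue_tuple1// [LHS]KvolE.
have -> : coord @` A = (fun v => oe.1 + oe.2 * v)%R @` E.
  apply/seteqP; split => [_ [x Ax <-]|_ [v [v01 Av] <-]].
    exists (oe.2 * (coord x - oe.1))%R; last first.
      by rewrite mulrA chart_par_sqr// mul1r addrC subrK.
    split; rewrite /=.
      by rewrite in_itv /=; apply: Kchart_domP; [|exact: coordP|exact: Adom].
    by rewrite mulrA chart_par_sqr// mul1r addrC subrK coordK.
  have [Kv _] := Kchart_invP h v01.
  by exists (pt (oe.1 + oe.2 * v)%R) => //; rewrite ptK.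
apply: lebesgue_isometry_image => x y.
rewrite opprD addrACA subrr add0r -mulrBr normrM.
by case: h => -[->|->] /=; rewrite ?normrN normr1 mul1r.
Qed.

Lemma positive_volume (A : set K) (B : set (measurableTypeR R)) :
  measurable B -> (forall x, B x -> in_K x /\ A (pt x)) ->
  (@lebesgue_measure R).-negligible [set x | [/\ in_K x, A (pt x) & ~ B x]] ->
  0 < @lebesgue_measure R B -> @has_positive_volume R 1 KM A.
Proof.
move=> mB BA [N [mN N0 AN]] B0; exists Kvol; first exact: Kvol_riemannian.
exists (coord @^-1` B); split.
- by rewrite -[X in measurable X]setTI; exact: measurable_coord.
- by move=> x /BA[_]; rewrite coordK.
- exists (coord @^-1` N); split.
  + by rewrite -[X in measurable X]setTI; exact: measurable_coord.
  + rewrite [LHS]KvolE; apply/eqP; rewrite eq_le lebesgue_ge0 andbT -N0.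
    by apply: lebesgue_le => _ [x Nx <-].
  + by move=> x [Ax Bx]; apply: AN; split => //; [exact: coordP|rewrite coordK].
- rewrite [ltRHS]KvolE; apply: lt_le_trans B0 _; apply: lebesgue_le => x Bx.
  by have [Kx _] := BA _ Bx; exists (pt x); rewrite /preimage /= ?ptK.
Qed.

End volume.

(** * Statistical classes through coordinates *)

Section shift.
Implicit Types S T : set nat.
Local Open Scope nat_scope.

Lemma cnt_shift S T a k : (forall k, S k.+1 <-> T k) -> cnt S a.+1 k = cnt T a k.
Proof.
move=> ST; rewrite !cntE; apply: eq_bigr => i _; rewrite addSn.
by congr nat_of_bool; apply: asbool_equiv_eq; exact: ST.
Qed.

Lemma cnt_shift0 S T k : (forall k, S k.+1 <-> T k) -> cnt S 0 k.+1 = cnt S 0 1 + cnt T 0 k.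
Proof. by move=> ST; rewrite -add1n cntD add0n (cnt_shift _ _ ST). Qed.

(** Dropping time 0 changes a count by at most one, which doubling q absorbs in long windows. *)
Lemma lower_pos_shift S T : (forall k, S k.+1 <-> T k) -> lower_pos S <-> lower_pos T.
Proof.
move=> ST; split=> -[q [N h]].
  exists (q * 2), (N + q * 2) => k Nk.
  have := h k.+1; rewrite (cnt_shift0 _ ST) => /(_ ltac:(lia)).
  have := cnt_le S 0 1; set c := cnt S 0 1; set d := cnt T 0 k => c1 hk.
  have : q * (c + d) <= q + q * d by nia.
  nia.
exists (q * 2), N.+2 => -[//|k] Nk; rewrite (cnt_shift0 _ ST).
have := h k ltac:(lia); set c := cnt S 0 1; set d := cnt T 0 k; nia.
Qed.

Lemma upper_pos_shift S T : (forall k, S k.+1 <-> T k) -> upper_pos S <-> upper_pos T.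
Proof.
move=> ST; split=> -[q h].
  exists (q * 2) => N; have [k' [Nk k0]] := h (N + q * 2).+2.
  case: k' k0 Nk => [//|k] k0 Nk; rewrite (cnt_shift0 _ ST).
  have := cnt_le S 0 1; set c := cnt S 0 1; set d := cnt T 0 k => c1 hk.
  exists k; split; [lia|lia|].
  have : q * (c + d) <= q + q * d by nia.
  nia.
exists (q * 2) => N; have [k [Nk k0 kq]] := h N; exists k.+1; split; [lia|lia|].
rewrite (cnt_shift0 _ ST); nia.
Qed.

Lemma upper_banach_pos_shift S T : (forall k, S k.+1 <-> T k) ->
  upper_banach_pos S <-> upper_banach_pos T.
Proof.
move=> ST; split=> -[q h].
  exists (q * 2) => N; have [a' [k' [Nk k0]]] := h (N + q * 2).+2.
  case: k' k0 Nk => [//|k] k0 Nk; case: a' => [|a].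
    rewrite (cnt_shift0 _ ST).
    have := cnt_le S 0 1; set c := cnt S 0 1; set d := cnt T 0 k => c1 hk.
    exists 0, k; split; [lia|lia|].
    have : q * (c + d) <= q + q * d by nia.
    nia.
  by rewrite (cnt_shift _ _ ST) => kq; exists a, k.+1; split; nia.
exists q => N; have [a [k [Nk k0 kq]]] := h N; exists a.+1, k.
by rewrite (cnt_shift _ _ ST).
Qed.

Lemma lower_banach_pos_shift S T : (forall k, S k.+1 <-> T k) ->
  lower_banach_pos S <-> lower_banach_pos T.
Proof.
move=> ST; split=> -[q [N h]].
  by exists q, N => a k Nk; rewrite -(cnt_shift _ _ ST); exact: h.
exists (q * 2), N.+2 => -[|a] [//|k] Nk.
  rewrite (cnt_shift0 _ ST).
  have := h 0 k ltac:(lia); set c := cnt S 0 1; set d := cnt T 0 k; nia.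
rewrite (cnt_shift _ _ ST); have := h a k.+1 ltac:(lia); nia.
Qed.

Lemma infinitely_often_shift S T : (forall k, S k.+1 <-> T k) ->
  infinitely_often S <-> infinitely_often T.
Proof.
move=> ST; split=> h N.
  have [k' Nk] := h N.+1; case: k' Nk => [//|k] Nk Sk.
  by exists k => //; exact/ST.
by have [k Nk Tk] := h N; exists k.+1; [lia|exact/ST].
Qed.

End shift.

Section chain.
Context {R : realType}.
Implicit Types (u v : nat -> R) (y : R) (P : set nat -> Prop).

Definition near_times u y e : set nat := [set k | `|u k - y| < e].

Definition limit_points P u : set R := [set y | forall e, 0 < e -> P (near_times u y e)].

(** Listed in the order of [omega_chain], so that all its relations can be treated by index; the
    constant [False] yields the empty set. *)
Definition freq_preds : seq (set nat -> Prop) :=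
  [:: fun _ => False; lower_banach_pos; lower_pos; upper_pos; upper_banach_pos;
      infinitely_often; some_time].

Definition freq_pred (i : nat) : set nat -> Prop := nth (fun _ => False) freq_preds i.

Lemma freq_pred_incr i S : (i < 6)%N -> freq_pred i S -> freq_pred i.+1 S.
Proof.
case: i => [//|[|[|[|[|[|//]]]]]] _.
- exact: lower_banach_pos_lower.
- exact: lower_pos_upper.
- exact: upper_pos_banach.
- exact: upper_banach_pos_io.
- exact: infinitely_often_some.
Qed.

(** The bound on i excludes [some_time], which can hold because of time 0 alone. This is what makes
    the last relation strict for points of [2, 3]. *)
Lemma freq_pred_shift i S T : (i < 6)%N -> (forall k, S k.+1 <-> T k) ->
  freq_pred i S <-> freq_pred i T.
Proof.
case: i => [//|[|[|[|[|[|//]]]]]] _ ST.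
- exact: lower_banach_pos_shift.
- exact: lower_pos_shift.
- exact: upper_pos_shift.
- exact: upper_banach_pos_shift.
- exact: infinitely_often_shift.
Qed.

(* alpha records which inclusions of the chain are equalities *)
Definition pattern_at (alpha : 6.-tuple bool) u (i : 'I_6) :=
  let A := limit_points (freq_pred i) u in
  let B := limit_points (freq_pred i.+1) u in
  if tnth alpha i then forall y, in_K y -> B y -> A y
  else exists y, [/\ in_K y, B y & ~ A y].

Definition pattern alpha u := forall i, pattern_at alpha u i.

Lemma limit_points_incr i u : (i < 6)%N ->
  limit_points (freq_pred i) u `<=` limit_points (freq_pred i.+1) u.
Proof. by move=> i6 y h e e0; apply: freq_pred_incr => //; exact: h. Qed.

Lemma limit_points_mono i k u : (i + k < 7)%N ->
  limit_points (freq_pred i) u `<=` limit_points (freq_pred (i + k)) u.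
Proof.
elim: k => [|k ih] ik y; first by rewrite addn0.
by rewrite addnS => /ih h; apply: limit_points_incr; [lia|apply: h; lia].
Qed.

(** Serves to see that a class different from that of almost all of [0, 1] meets [0, 1] in a null
    set. *)
Lemma pattern_uniq alpha beta u : pattern alpha u -> pattern beta u -> alpha = beta.
Proof.
move=> ha hb; apply/eq_from_tnth => i; have := ha i; have := hb i; rewrite /pattern_at /=.
case: (tnth alpha i); case: (tnth beta i) => //.
- by move=> [y [yK yB yA]] h; have := h y yK yB.
- by move=> h [y [yK yB yA]]; have := h y yK yB.
Qed.

Lemma limit_points_shift i u v : (i < 6)%N -> (forall k, u k.+1 = v k) ->
  limit_points (freq_pred i) u = limit_points (freq_pred i) v.
Proof.
move=> i6 uv; apply/seteqP; split => y h e e0.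
  by apply/(@freq_pred_shift i (near_times u y e)) => //; [move=> k; rewrite /near_times /= uv|exact: h].
by apply/(@freq_pred_shift i _ (near_times v y e)) => //; [move=> k; rewrite /near_times /= uv|exact: h].
Qed.

End chain.

Section dynamics.
Context {R : realType}.
Local Notation K := (@K R).
Local Notation KM := (@KM R).
Variable f : KM -> KM.
Implicit Types x y : KM.

Definition coord_orbit x (k : nat) : R := coord (iter k f x).

Lemma omega_densityE (xi : set nat -> \bar R) P x y :
  (forall S, (0 < xi S)%E <-> P S) -> (forall S T, S `<=` T -> P S -> P T) ->
  omega_density f xi x y <-> limit_points P (coord_orbit x) (coord y).
Proof.
move=> xiP PS; split=> h e e0.
  have /xiP := h e e0; apply: PS => k; exact: riemannian_ball_sub.
have e0' : 0 < Num.min e (2^-1) by rewrite lt_min e0 invr_gt0 ltr0n.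
apply/xiP; apply: PS (h _ e0') => k; rewrite /near_times /= lt_min => /andP[h1 h2].
exact: riemannian_ball_sup.
Qed.

Lemma K_closureP (A : set K) (y : K) :
  closure A y <-> forall e, 0 < e -> exists2 z, A z & `|coord z - coord y| < e.
Proof.
split=> [h e e0|h B /nbhs_ballP[e e0 eB]].
  have [z [Az yz]] := h _ (nbhsx_ballx y e e0).
  by exists z => //; move/K_ballE: yz; rewrite distrC.
have [z Az zy] := h e e0; exists z; split => //.
by apply: eB; apply/K_ballE; rewrite distrC.
Qed.

Lemma omegaE x y : omega f x y <-> limit_points infinitely_often (coord_orbit x) (coord y).
Proof.
split=> [h e e0 N|h m _].
  have /K_closureP/(_ e e0)[_ [k /= Nk ->] hk] := h N.+1 isT.
  by exists k => //; exact: ltnW.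
apply/K_closureP => e e0; have [k mk hk] := h e e0 m.
by exists (iter k f x) => //; exists k.
Qed.

Lemma closure_orbE x y : closure (orb f x) y <-> limit_points some_time (coord_orbit x) (coord y).
Proof.
split=> [h e e0|h].
  by have /K_closureP/(_ e e0)[_ [k _ <-] hk] := h; exists k.
by apply/K_closureP => e e0; have [k hk] := h e e0; exists (iter k f x) => //; exists k.
Qed.

Lemma omega_chainE x y i : (i <= 6)%N ->
  nth set0 (omega_chain f x) i y <-> limit_points (freq_pred i) (coord_orbit x) (coord y).
Proof.
case: i => [|[|[|[|[|[|[|//]]]]]]] _ /=.
- by split => // /(_ 1 ltr01).
- apply: omega_densityE; [exact: lower_banach_density_gt0|exact: lower_banach_posS].
- apply: omega_densityE; [exact: lower_density_gt0|exact: lower_posS].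
- apply: omega_densityE; [exact: upper_density_gt0|exact: upper_posS].
- apply: omega_densityE; [exact: upper_banach_density_gt0|exact: upper_banach_posS].
- exact: omegaE.
- exact: closure_orbE.
Qed.

Lemma statistical_classE alpha x :
  statistical_class f alpha x <-> pattern alpha (coord_orbit x).
Proof.
split=> h i; have := h i; rewrite /pattern_at; cbv zeta; have i6 := ltn_ord i; case: ifP => _.
- move=> AB y yK; rewrite -(ptK yK) => By.
  apply/(omega_chainE _ _ (ltnW i6)); rewrite AB; exact/omega_chainE.
- move=> [_ /existsNP[y /not_implyP[By Ay]]]; exists (coord y); split.
  + exact: coordP.
  + exact/omega_chainE.
  + by move/omega_chainE => /(_ (ltnW i6)).
- move=> AB; apply/seteqP; split => y.
    move/omega_chainE => /(_ (ltnW i6)) Ay; apply/omega_chainE => //.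
    exact: limit_points_incr.
  move/omega_chainE => /(_ i6) By; apply/omega_chainE; first exact: ltnW.
  by apply: AB By; exact: coordP.
- move=> [y [yK By Ay]]; split.
    move=> z /omega_chainE => /(_ (ltnW i6)) Az; apply/omega_chainE => //.
    exact: limit_points_incr.
  move=> /(_ (pt y)) h'; apply: Ay.
  rewrite -(ptK yK); apply/omega_chainE; first exact: ltnW.
  by apply: h'; apply/omega_chainE => //; rewrite ptK.
Qed.

End dynamics.

Section realization.
Context {R : realType}.
Local Notation K := (@K R).
Local Notation KM := (@KM R).

Variables (F F' : R -> R) (p : R).
Hypothesis dF : forall x : R, is_derive x 1 F (F' x).
Hypothesis cF' : continuous F'.
Hypothesis F01 : forall x, 0 <= x <= 1 -> 0 <= F x <= 1.
Hypothesis p01 : 0 <= p <= 1.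

Definition two_piece (x : KM) : KM := if coord x <= 1 then pt (F (coord x)) else pt p.

Lemma in_K01 (x : R) : 0 <= x <= 1 -> in_K x.
Proof. by rewrite /in_K => ->. Qed.

Lemma in_K_le1 (x : R) : in_K x -> x <= 1 -> 0 <= x <= 1.
Proof. by rewrite /in_K => /orP[//|/andP[? ?] ?]; lra. Qed.

Lemma in_K_gt1 (x : R) : in_K x -> 1 < x -> 2 <= x <= 3.
Proof. by rewrite /in_K => /orP[/andP[? ?] ?|//]; lra. Qed.

Lemma coord_two_piece x : coord (two_piece x) = if coord x <= 1 then F (coord x) else p.
Proof.
rewrite /two_piece; case: ifPn => h; rewrite ptK//; last exact: in_K01.
by apply/in_K01/F01/in_K_le1 => //; exact: coordP.
Qed.

Lemma continuous_F : continuous F.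
Proof. by move=> x; apply: differentiable_continuous; apply/derivable1_diffP; have [] := dF x. Qed.

Lemma near_same_piece (x : K) : \forall y \near x, (coord y <= 1) = (coord x <= 1).
Proof.
apply/nbhs_ballP; exists 1 => //= y /K_ballE; rewrite ltr_norml => /andP[h1 h2].
have [hx|hx] := leP (coord x) 1; have [hy|hy] := leP (coord y) 1 => //.
  by have := in_K_le1 (coordP x) hx; have := in_K_gt1 (coordP y) hy; lra.
by have := in_K_le1 (coordP y) hy; have := in_K_gt1 (coordP x) hx; lra.
Qed.

Lemma continuous_two_piece : continuous two_piece.
Proof.
apply: (@continuous_comp_initial (pre_carrier : choiceType) KM R (@Kval R) two_piece) => x.
have -> : Kval \o two_piece = fun y : K => if coord y <= 1 then F (coord y) else p.
  by apply/funext => y /=; rewrite -/(coord _) coord_two_piece.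
rewrite /continuous_at; case: ifPn => hx.
  have E : \forall y \near x, F (coord y) = (if coord y <= 1 then F (coord y) else p).
    by apply: filterS (near_same_piece x) => y ->; rewrite hx.
  apply: cvg_trans (near_eq_cvg E) _.
  by apply: (@continuous_comp _ _ _ coord F); [exact: continuous_coord|exact: continuous_F].
have E : \forall y \near x, p = (if coord y <= 1 then F (coord y) else p).
  by apply: filterS (near_same_piece x) => y ->; rewrite (negbTE hx).
by apply: cvg_trans (near_eq_cvg E) _; exact: cvg_cst.
Qed.

(** A chart domain lies in a single segment, the one of its endpoint [oe.1]; in coordinates the map
    is thus given by one formula, which extends to the whole line as [G]. *)
Lemma two_piece_C1 : @C1_map R 1 KM two_piece.
Proof.
split; first exact: continuous_two_piece.
move=> _ _ [oe h <-] [oe' h' <-].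
have cdom (x : K) : `|coord x - oe.1| < 1 -> (coord x <= 1) = (oe.1 <= 1).
  case: h => -[->|->] /=; rewrite ltr_norml => /andP[h1 h2];
  have [hx|hx] := leP (coord x) 1; first [have := in_K_le1 (coordP x) hx|have := in_K_gt1 (coordP x) hx];
  by move=> /andP[? ?]; apply/esym; apply/idP; lra.
pose G (u : R) := if oe.1 <= 1 then oe'.2 * (F (oe.1 + oe.2 * u) - oe'.1) else oe'.2 * (p - oe'.1).
pose G' (u : R) := if oe.1 <= 1 then oe'.2 * (F' (oe.1 + oe.2 * u) * oe.2) else 0.
have dG (u : R) : is_derive u 1 G (G' u).
  rewrite /G /G'; case: ifP => _; last exact: is_derive_cst.
  have d1 : is_derive u (1 : R) (fun u => oe.1 + oe.2 * u) oe.2.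
    by apply: is_derive_eq; rewrite /GRing.scale /=; ring.
  have d2 : is_derive u (1 : R) (F \o (fun u => oe.1 + oe.2 * u)) (F' (oe.1 + oe.2 * u) * oe.2).
    exact: is_derive1_comp.
  by apply: is_derive_eq; rewrite /GRing.scale /=; ring.
have cG' : continuous G'.
  rewrite /G'; case: (oe.1 <= 1) => u; last exact: cvg_cst.
  apply: cvgM; first exact: cvg_cst.
  apply: cvgM; last exact: cvg_cst.
  apply: (@continuous_comp _ _ _ (fun u => oe.1 + oe.2 * u) F'); last exact: cF'.
  by apply: cvgD; [exact: cvg_cst|apply: cvgM; [exact: cvg_cst|exact: cvg_id]].
move=> v hv; exists setT, (lift1 G); split => //; first exact: openT.
  exact: C1_open_lift1 dG cG'.
move=> w; rewrite inE => -[_ [x [xd fxd] <-]].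
rewrite /lift1 /= rv1E mulrA chart_par_sqr// mul1r.
have -> : oe.1 + (coord x - oe.1) = coord x by rewrite addrC subrK.
rewrite coordK coord_two_piece cdom//; congr rv1.
by rewrite /G mulrA chart_par_sqr// mul1r (addrC oe.1) subrK; case: ifP.
Qed.

Lemma coord_orbit_low (x : KM) k : coord x <= 1 ->
  coord_orbit two_piece x k = iter k F (coord x) /\ 0 <= coord_orbit two_piece x k <= 1.
Proof.
move=> hx; elim: k => [|k [ih1 ih2]].
  by split => //; exact: in_K_le1 (coordP x) hx.
rewrite /coord_orbit /= coord_two_piece -/(coord_orbit _ _ _).
by case/andP: (ih2) => _ ->; rewrite -ih1; split => //; exact: F01.
Qed.

Lemma coord_orbit_high (x : KM) k : 1 < coord x ->
  coord_orbit two_piece x k.+1 = iter k F p.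
Proof.
move=> hx; have -> : iter k F p = iter k F (coord (two_piece x)).
  by rewrite coord_two_piece [coord x <= 1]leNgt hx.
have [|<- _] := @coord_orbit_low (two_piece x) k.
  by rewrite coord_two_piece [coord x <= 1]leNgt hx/=; case/andP: p01.
by rewrite /coord_orbit iterSr.
Qed.

Lemma iter01 x k : 0 <= x <= 1 -> 0 <= iter k F x <= 1.
Proof. by move=> x01; elim: k => //= k; exact: F01. Qed.

(** From time 1 on the orbit is that of p, and the first five relations do not see time 0. The sixth
    is strict: x is in the orbit closure, but at distance at least 1 from all later points. *)
Lemma pattern_high (x : KM) alpha : 1 < coord x ->
  (forall i : 'I_6, (i < 5)%N -> pattern_at alpha (fun k => iter k F p) i) -> tnth alpha ord_max = false ->
  pattern alpha (coord_orbit two_piece x).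
Proof.
move=> hx hp a5.
have xK : 2 <= coord x <= 3 by exact: in_K_gt1 (coordP x) hx.
have shift i : (i < 6)%N -> limit_points (freq_pred i) (coord_orbit two_piece x) =
    limit_points (freq_pred i) (fun k => iter k F p).
  by move=> i6; apply: limit_points_shift => // k; exact: coord_orbit_high.
move=> i; rewrite /pattern_at /=; have [i5|i5] := ltnP i 5.
  by rewrite !shift//; exact: hp.
have -> : i = ord_max by apply/val_inj => /=; apply/eqP; rewrite eqn_leq i5 -ltnS ltn_ord.
rewrite a5; exists (coord x); split; first exact: coordP.
  by move=> e e0; exists 0%N; rewrite /near_times /= /coord_orbit /= subrr normr0.
rewrite shift// => /(_ 1 ltr01 0%N)[k _].
by rewrite /near_times /= ltr_norml => /andP[? ?]; have := @iter01 p k p01; lra.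
Qed.

(** Hence a class with last bit 1 has no point in [2, 3]; the class of beta is then [0, 1] up to a
    null set, as the completed volume requires. *)
Lemma not_pattern_high (x : KM) alpha : 1 < coord x -> tnth alpha ord_max = true ->
  ~ pattern alpha (coord_orbit two_piece x).
Proof.
move=> hx a5 h; have := h ord_max; rewrite /pattern_at /= a5.
have xK : 2 <= coord x <= 3 by exact: in_K_gt1 (coordP x) hx.
move=> /(_ (coord x) (coordP x)).
have h0 : limit_points (freq_pred 6) (coord_orbit two_piece x) (coord x).
  by move=> e e0; exists 0%N; rewrite /near_times /= /coord_orbit /= subrr normr0.
move=> /(_ h0)/(_ 1 ltr01 1%N)[[//|k] _].
rewrite /near_times /= coord_orbit_high// ltr_norml => /andP[? ?].
by have := @iter01 p k p01; lra.
Qed.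

Variables (beta : 6.-tuple bool).
Hypothesis beta5 : tnth beta ord_max = true.
Hypothesis ae_pattern : (@lebesgue_measure R).-negligible
  [set x | 0 <= x <= 1 /\ ~ pattern beta (fun k => iter k F x)].

Lemma pattern_low alpha (x : KM) : coord x <= 1 ->
  pattern alpha (coord_orbit two_piece x) = pattern alpha (fun k => iter k F (coord x)).
Proof.
move=> hx; congr (pattern _ _); apply/funext => k.
by have [] := coord_orbit_low k hx.
Qed.

Lemma realize_ae : exists (n : nat) (M : riemannianManifold R n) (f : M -> M),
    [/\ (0 < n)%N, C1_map f & has_positive_volume (statistical_class f beta)].
Proof.
exists 1%N, KM, two_piece; split => //; first exact: two_piece_C1.
have [N [mN N0 hN]] := ae_pattern.
pose B : set (measurableTypeR R) := `[0, 1]%classic `\` N.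
have mB : measurable B by exact: measurableD.
apply: (@positive_volume _ _ B) => //.
- move=> x [x01 Nx]; rewrite /= in_itv /= in x01.
  have xK := in_K01 x01; split => //; apply/statistical_classE.
  rewrite pattern_low ptK//; last by case/andP: x01.
  by apply: contrapT => h; apply: Nx; apply: hN; split.
- exists N; split => // x [/= xK /statistical_classE h Bx].
  have [hx|hx] := leP x 1; last first.
    by exfalso; apply: (@not_pattern_high (pt x) beta) => //; rewrite ptK.
  by apply: contrapT => Nx; apply: Bx; split => //=; rewrite in_itv /=; exact: in_K_le1.
- rewrite measureD//=; last by rewrite lebesgue_measure_itv /= lte_fin ltr01 ltry.
  rewrite (_ : (_ `&` _) = N `&` `[0, 1]%classic); last by rewrite setIC.
  have -> : @lebesgue_measure R (N `&` `[0, 1]%classic) = 0%E.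
    by apply/eqP; rewrite eq_le lebesgue_ge0 andbT -N0; apply: lebesgue_le => ? [].
  by rewrite sube0 lebesgue_measure_itv /= lte_fin ltr01 -EFinB subr0 lte_fin.
Qed.

(** The class may also contain points of [0, 1], but almost all of these have pattern beta, whose
    last bit differs from that of alpha. *)
Lemma realize_wandering alpha :
  (forall i : 'I_6, (i < 5)%N -> pattern_at alpha (fun k => iter k F p) i) -> tnth alpha ord_max = false ->
  exists (n : nat) (M : riemannianManifold R n) (f : M -> M),
    [/\ (0 < n)%N, C1_map f & has_positive_volume (statistical_class f alpha)].
Proof.
move=> hp a5.
exists 1%N, KM, two_piece; split => //; first exact: two_piece_C1.
have [N [mN N0 hN]] := ae_pattern.
apply: (@positive_volume _ _ `[2, 3]%classic) => //.
- move=> x; rewrite /= in_itv /= => x23.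
  have xK : in_K x by rewrite /in_K x23 orbT.
  split => //; apply/statistical_classE; apply: (pattern_high _ hp) => //.
  by rewrite ptK//; lra.
- exists N; split => // x [/= xK /statistical_classE h Bx].
  have [hx|hx] := leP x 1; last first.
    by exfalso; apply: Bx; rewrite in_itv /=; exact: in_K_gt1.
  apply: hN; split; first exact: in_K_le1.
  move=> hb; move: h; rewrite pattern_low ptK// => /pattern_uniq/(_ hb) ab.
  by move: a5; rewrite ab beta5.
- by rewrite lebesgue_measure_itv /= lte_fin ltr_nat -EFinB lte_fin; lra.
Qed.

End realization.

(** * Colourings of the integers with prescribed frequencies *)

Section sparse.
Implicit Types S T X : set nat.
Local Open Scope nat_scope.

(** The gaps of T tend to infinity. *)
Definition sparse T :=
  forall g, exists N, forall x y, T x -> T y -> N <= x -> x < y -> x + g <= y.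

(** With T the set of changes of digit, these are the times at which the coming digits may fail to
    be constant. *)
Definition thicken m T : set nat := [set n | exists2 i, i < m & T (n + i)].

Lemma cnt_sparse_aux T g N a k : (forall x y, T x -> T y -> N <= x -> x < y -> x + g <= y) ->
  N <= a -> g * cnt T a k <= k + g.
Proof.
move=> h; elim/ltn_ind: k a => k ih a Na.
have [c0|/cnt_gt0[i ik Ti]] := posnP (cnt T a k); first by rewrite c0 muln0.
(* The first element of T in the window. The g - 1 places after it are free, and the induction
   resumes at a + (j + g). *)
pose j := [arg min_(j < Ordinal ik | `[< T (a + j) >]) (j : nat)].
have [Tj jmin] : T (a + j) /\ forall l : 'I_k, T (a + l) -> j <= l.
  rewrite /j; case: arg_minnP => [|l /asboolP Tl lmin]; first exact/asboolP.
  by split => // l' Tl'; apply: lmin; exact/asboolP.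
have jk := ltn_ord j.
have E1 : cnt T a j = 0.
  apply: cnt_none => l lj Tl; have := jmin (Ordinal (ltn_trans lj jk)) Tl.
  by rewrite /= leqNgt lj.
have [gk|gk] := leqP (j + g) k; last first.
  have : cnt T a k <= 1.
    have -> : k = j + (1 + (k - j.+1)) by lia.
    rewrite 2!cntD E1 [X in _ + (_ + X)]cnt_none ?addn0 ?cnt_le// => l lk Tl.
    have := h _ _ Tj Tl; lia.
  set c := cnt _ _ _; nia.
have [g0|g0] := posnP g; first by rewrite g0 mul0n.
have E2 : cnt T a k <= 1 + cnt T (a + (j + g)) (k - (j + g)).
  have {1}-> : k = j + (1 + (g.-1 + (k - (j + g)))) by lia.
  rewrite 3!cntD E1 add0n.
  rewrite [X in _ + (X + _)]cnt_none.
    rewrite add0n; apply: leq_add; first exact: cnt_le.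
    by rewrite (_ : a + j + 1 + g.-1 = a + (j + g))//; lia.
  move=> l lk Tl; have := h _ _ Tj Tl; lia.
have := ih (k - (j + g)) ltac:(lia) (a + (j + g)) ltac:(lia).
move: E2; set c := cnt T a k; set d := cnt T _ _; nia.
Qed.

Lemma cnt_sparse T g : sparse T -> exists N, forall a k, g * cnt T a k <= g * N + k + g.
Proof.
move=> /(_ g)[N h]; exists N => a k.
have [Na|aN] := leqP N a.
  by have := cnt_sparse_aux k h Na; set c := cnt _ _ _; lia.
have [kN|Nk] := leqP k (N - a).
  have := cnt_le T a k; set c := cnt _ _ _; nia.
have -> : k = (N - a) + (k - (N - a)) by lia.
rewrite cntD; have := cnt_sparse_aux (k - (N - a)) h (a := a + (N - a)) ltac:(lia).
have := cnt_le T a (N - a); set c := cnt _ _ _; set d := cnt _ _ _; nia.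
Qed.

Lemma cnt_thicken m T g : sparse T -> exists N, forall a k,
  g * cnt (thicken m T) a k <= m * (g * N + k + g).
Proof.
move=> /(@cnt_sparse T g)[N h]; exists N => a k.
elim: m => [|m ih].
  by rewrite cnt_none ?muln0// => i _ [].
have : cnt (thicken m.+1 T) a k <= cnt (thicken m T) a k + cnt T (a + m) k.
  rewrite !cntE -big_split /=; apply: leq_sum => i _.
  case: (asboolP (thicken m.+1 T (a + i))) => // -[l lm Tl].
  move: lm; rewrite ltnS leq_eqVlt => /orP[/eqP lm|lm]; last first.
    by rewrite (asboolT (P := thicken _ _ _)) ?leq_addr//; exists l.
  by rewrite (asboolT (P := T _)) ?leq_addl// addnAC -lm.
have := h (a + m) k.
by set c := cnt _ _ _; set d := cnt _ _ _; set e := cnt _ _ _; nia.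
Qed.

(** In long windows the frequency is at most about m / g, for every g; the choice g = 2 * (q * m +
    1) makes it smaller than 1 / q. *)
Lemma thicken_null m T : sparse T -> ~ upper_banach_pos (thicken m T).
Proof.
move=> sT [q h]; have [N hN] := cnt_thicken m (2 * (q * m).+1) sT.
have [a [k [Nk k0 kq]]] := h (2 * q * m * (2 * (q * m).+1 * N + 2 * (q * m).+1)).+1.
have := hN a k; move: kq; set c := cnt _ _ _ => kq hc.
have : 2 * (q * m).+1 * k <= q * (m * (2 * (q * m).+1 * N + k + 2 * (q * m).+1)).
  by rewrite (leq_trans _ (leq_mul (leqnn q) hc))// mulnCA leq_mul.
move: Nk; set A := (2 * (q * m).+1 * N + 2 * (q * m).+1) => Nk.
rewrite (_ : _ + k + _ = A + k); last by rewrite /A; lia.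
rewrite mulnA; move: Nk; rewrite -!mulnA; set B := q * m => Nk; nia.
Qed.

Lemma null_cnt X q : ~ upper_banach_pos X -> exists N, forall a k, N <= k -> q * cnt X a k <= k.
Proof.
move=> nX; apply: contrapT => h; apply: nX; exists q => N.
apply: contrapT => h2; apply: h; exists N.+1 => a k Nk.
rewrite leqNgt; apply/negP => lt; apply: h2; exists a, k.
by split; [exact: ltnW|lia|exact: ltnW].
Qed.

(** In long windows X takes at most a proportion 1 / (2 * q), which leaves to T at least half of the
    proportion 1 / q of S. *)
Lemma lower_pos_mod S T X : S `<=` T `|` X -> ~ upper_banach_pos X -> lower_pos S -> lower_pos T.
Proof.
move=> STX nX [q [N h]]; have [N' h'] := null_cnt (2 * q) nX.
exists (2 * q), (N + N') => k Nk.
have := h k ltac:(lia); have := h' 0 k ltac:(lia).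
have := leq_trans (cnt_mono 0 k STX) (cntU T X 0 k).
set c := cnt _ _ _; set d := cnt _ _ _; set e := cnt _ _ _; nia.
Qed.

Lemma upper_pos_mod S T X : S `<=` T `|` X -> ~ upper_banach_pos X -> upper_pos S -> upper_pos T.
Proof.
move=> STX nX [q h]; have [N' h'] := null_cnt (2 * q) nX.
exists (2 * q) => N; have [k [Nk k0 kq]] := h (N + N').
exists k; split => //; first by lia.
have := h' 0 k ltac:(lia).
have := leq_trans (cnt_mono 0 k STX) (cntU T X 0 k).
move: kq; set c := cnt _ _ _; set d := cnt _ _ _; set e := cnt _ _ _; nia.
Qed.

Lemma lower_banach_posC X : ~ upper_banach_pos X -> lower_banach_pos (~` X).
Proof.
move=> /(null_cnt 2)[N h]; exists 2, N => a k Nk.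
have := h a k Nk; have := cntC X a k; set c := cnt _ _ _; set d := cnt _ _ _; lia.
Qed.

End sparse.

Section blocks.
Variable r : nat -> nat.
Local Open Scope nat_scope.
Hypothesis r_ge2 : forall j, 2 <= r j.

(** Block boundaries, of successive ratios r j. Since the colours alternate, a bounded ratio keeps
    the other colour at positive lower density and unbounded ratios destroy it. *)
Fixpoint bdry j := if j is j'.+1 then r j' * bdry j' else 1.

Lemma bdryS j : bdry j.+1 = r j * bdry j. Proof. by []. Qed.

Arguments bdry : simpl never.

Lemma bdryS_ge j : bdry j + bdry j <= bdry j.+1.
Proof. by rewrite bdryS addnn -mul2n leq_mul2r r_ge2 orbT. Qed.

Lemma bdry_gt j : j < bdry j.
Proof. by elim: j => // j ih; have := bdryS_ge j; lia. Qed.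

Lemma bdry_mono i j : i <= j -> bdry i <= bdry j.
Proof.
move=> /subnKC <-; elim: (j - i) => [|d ih]; first by rewrite addn0.
by rewrite addnS; have := bdryS_ge (i + d); lia.
Qed.

Lemma bdry_block n : 0 < n -> exists j, bdry j <= n < bdry j.+1.
Proof.
elim: n => // n ih _; have [->|n0] := posnP n.
  by exists 0; have := r_ge2 0; rewrite bdryS muln1.
have [j /andP[h1 h2]] := ih n0; have [h3|h3] := ltnP n.+1 (bdry j.+1).
  by exists j; rewrite h3 andbT; lia.
by exists j.+1; rewrite h3 andTb; have := bdryS_ge j.+1; lia.
Qed.

(* the parity of j.+1 on the block [bdry j, bdry j.+1[ *)
Definition color n := odd (\sum_(i < n.+1) (bdry i <= n)).

Lemma colorE j n : bdry j <= n < bdry j.+1 -> color n = odd j.+1.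
Proof.
move=> /andP[h1 h2]; rewrite /color; congr odd.
have jn : j < n.+1 by have := bdry_gt j; lia.
rewrite -(subnKC jn) big_split_ord /= (eq_bigr (fun=> 1)) => [|i _].
  rewrite sum1_card card_ord big1 ?addn0// => i _.
  apply/eqP; rewrite eqb0 -ltnNge; apply: leq_trans (bdry_mono (leq_addr _ _)).
  exact: h2.
by apply/eqP; rewrite eqb1; apply: leq_trans h1; apply: bdry_mono; rewrite -ltnS.
Qed.

Definition switch : set nat := [set n | color n != color n.+1].

Lemma switch_bdry n : switch n -> exists j, n.+1 = bdry j.
Proof.
rewrite /switch /=; have [j /andP[h1 h2]] := @bdry_block n.+1 isT.
have [->|n1] := eqVneq n.+1 (bdry j); first by exists j.
have h : bdry j <= n < bdry j.+1 by move/eqP in n1; lia.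
by rewrite (colorE h) (@colorE j n.+1) ?h1// eqxx.
Qed.

(** Boundaries at least double, so the gap after an element exceeds the element itself. *)
Lemma sparse_bdry T : (forall n, T n -> exists j, n.+1 = bdry j) -> sparse T.
Proof.
move=> h g; exists g => x y /h[i xi] /h[j yj] gx xy.
have ij : i < j by rewrite ltnNge; apply/negP => /bdry_mono; lia.
have := bdry_mono ij; have := bdryS_ge i; lia.
Qed.

Lemma sparse_switch : sparse switch.
Proof. exact/sparse_bdry/switch_bdry. Qed.

Definition colored c : set nat := [set n | color n = c].

Lemma cnt_block c a b k n : odd k.+1 = c -> bdry k <= a -> a <= b -> b <= bdry k.+1 -> b <= n ->
  b - a <= cnt (colored c) 0 n - cnt (colored c) 0 a.
Proof.
move=> kc ka ab bk bn.
have -> : n = a + (b - a + (n - b)) by lia.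
rewrite !cntD add0n addKn [X in _ <= X + _]cnt_full ?leq_addr// => i ib.
by rewrite /colored /= (@colorE k)//; lia.
Qed.

(** At the end of a block of colour c, this block makes up at least half of the past. *)
Lemma upper_pos_colored c : upper_pos (colored c).
Proof.
exists 2 => N; pose j := N.*2 + ~~ c.
have jc : odd j.+1 = c by rewrite /j; move: (c) => b; rewrite /= oddD odd_double; case: b.
exists (bdry j.+1); split.
- by have := bdry_gt j.+1; rewrite /j; lia.
- exact: leq_ltn_trans (bdry_gt _).
- have := @cnt_block c (bdry j) (bdry j.+1) j (bdry j.+1) jc (leqnn _).
  have := bdryS_ge j; set d := cnt _ _ _; lia.
Qed.

(** The critical times are the ends of blocks of the other colour. Such a block only doubles the
    time, and the block before it, of colour c, fills at least half of what precedes: a quarter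
    remains. *)
Lemma lower_pos_colored c : (forall j, odd j.+1 != c -> r j = 2) -> lower_pos (colored c).
Proof.
move=> hr; exists 4, (bdry 2) => n n2.
have [|j /andP[h1 h2]] := @bdry_block n; first by have := bdry_gt 2; lia.
have j2 : 2 <= j.
  rewrite leqNgt; apply/negP => jl; have := @bdry_mono j.+1 2 ltac:(lia); lia.
case: j j2 h1 h2 => // -[//|j] _ h1 h2.
have b1 := bdryS_ge j.
have [jc|jc] := eqVneq (odd j.+3) c.
  have E : bdry j.+2 = 2 * bdry j.+1.
    by rewrite bdryS hr// -jc /=; case: (odd j).
  have c1 := @cnt_block c (bdry j) (bdry j.+1) j n ltac:(by rewrite -jc /= negbK) (leqnn _).
  have c2 := @cnt_block c (bdry j.+2) n j.+2 n jc (leqnn _) h1 (ltnW h2) (leqnn _).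
  have c3 := cnt_incr (colored c) 0 (ltac:(lia) : bdry j.+1 <= bdry j.+2).
  have c4 := @cnt_block c (bdry j) (bdry j.+1) j (bdry j.+1) ltac:(by rewrite -jc /= negbK) (leqnn _).
  move: c2 c3 c4; set d1 := cnt _ 0 n; set d2 := cnt _ 0 (bdry j.+2); set d3 := cnt _ 0 (bdry j.+1).
  set d4 := cnt _ 0 (bdry j); lia.
have E : bdry j.+3 = 2 * bdry j.+2 by rewrite bdryS hr.
have b2 := bdryS_ge j.+1.
have jc' : odd j.+2 = c by move: jc; rewrite /= negbK; clear; case: (odd j); case: c.
have c1 := @cnt_block c (bdry j.+1) (bdry j.+2) j.+1 n jc' (leqnn _) ltac:(lia) (leqnn _) h1.
by move: c1; set d := cnt _ 0 n; set e := cnt _ 0 _; lia.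
Qed.

(** At the end of block j, if it has the other colour, all occurrences are among the first [bdry j]
    of r j * [bdry j] times: a proportion at most 1 / r j. *)
Lemma not_lower_pos_colored c : (forall M, exists2 j, odd j.+1 != c & M <= r j /\ M <= j) ->
  ~ lower_pos (colored c).
Proof.
move=> hr [q [N h]]; have [j jc [rj Nj]] := hr (N + q).+1.
have := h (bdry j.+1); rewrite (_ : N <= _) => [/(_ isT)|]; last by have := bdry_gt j.+1; lia.
rewrite -{2}(subnKC (bdry_mono (leqnSn j))) cntD add0n [X in _ + X]cnt_none => [|i ib].
  have := cnt_le (colored c) 0 (bdry j); set d := cnt _ _ _ => hd.
  have := bdry_gt j; rewrite bdryS; nia.
rewrite /colored /= (@colorE j); first by move/eqP: jc.
by have := bdryS_ge j; lia.
Qed.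

End blocks.

Section calculus.
Context {R : realType}.
Implicit Types (f : R -> R) (a b x y : R).

Lemma mean_value_bound f f' a b (C : R) : (forall x, a <= x <= b -> is_derive x (1 : R) f (f' x)) ->
  (forall x, a <= x <= b -> `|f' x| <= C) ->
  forall x y, a <= x <= b -> a <= y <= b -> `|f x - f y| <= C * `|x - y|.
Proof.
move=> df hC x y.
wlog xy : x y / x <= y.
  move=> H hx hy; have [xy|/ltW yx] := leP x y; first exact: H.
  by rewrite distrC (distrC x); exact: H.
move=> /andP[ax _] /andP[_ yb].
have sub z : z \in `[x, y] -> a <= z <= b.
  by rewrite in_itv /= => /andP[? ?]; apply/andP; split; lra.
have [||z /sub hz E] := @MVT_segment R f f' x y xy.
- by move=> z /subset_itv_oo_cc/sub; exact: df.
- by apply: derivable_within_continuous => z /sub/df[].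
- by rewrite distrC E normrM (distrC x); apply: ler_wpM2r => //; exact: hC.
Qed.

End calculus.

(** * Shadowing of fixed and periodic points *)

Section shadowing.
Context {R : realType}.
Variable F : R -> R.
Hypothesis cF : continuous F.
Variable x : R.
Let u k := iter k F x.
Implicit Types (q y : R).

Lemma continuous_iter k : continuous (iter k F).
Proof.
elim: k => [|k ih] y; first exact: cvg_id.
by apply: (@continuous_comp _ _ _ (iter k F) F); [exact: ih|exact: cF].
Qed.

(** The first m iterates are continuous at q, so it is enough that the orbit comes once close enough
    to q. *)
Lemma shadow q : limit_points some_time u q ->
  forall e m, 0 < e -> exists n, forall i, (i < m)%N -> `|u (n + i)%N - iter i F q| < e.
Proof.
move=> hq e m e0.
have : \forall z \near q, forall i, (i < m)%N -> `|iter i F z - iter i F q| < e.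
  elim: m => [|m ih]; first by apply: (@filterE _ (nbhs q)) => z i; rewrite ltn0.
  have := @continuous_iter m q => /cvgrPdist_lt/(_ _ e0) hm.
  near=> z => i; rewrite ltnS leq_eqVlt => /orP[/eqP ->|im].
    by rewrite distrC; near: z; exact: hm.
  by move: i im; near: z; exact: ih.
move=> /nbhs_ballP[d /= d0 hd].
have [n hn] := hq d d0; exists n => i im.
rewrite /u addnC iterD; apply: hd => //.
by rewrite /ball /= distrC.
Unshelve. all: by end_near. Qed.

(* A window shadowing one fixed point misses a neighbourhood of every other point. *)
Lemma no_syndetic a b y : a != b -> F a = a -> F b = b ->
  limit_points some_time u a -> limit_points some_time u b ->
  ~ limit_points lower_banach_pos u y.
Proof.
move=> ab Fa Fb ha hb.
have key q : F q = q -> limit_points some_time u q -> y != q -> ~ limit_points lower_banach_pos u y.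
  move=> Fq hq yq; have e0 : 0 < `|y - q| / 2 by rewrite divr_gt0// normr_gt0 subr_eq0.
  move=> /(_ _ e0)[c [N h]].
  have [n hn] := shadow hq N.+1 e0.
  have iq i : iter i F q = q by elim: i => //= i ->.
  have := h n N.+1 (leqnSn _); rewrite cnt_none ?muln0// => i im.
  rewrite /near_times /= => h1; have := hn i im; rewrite iq => h2.
  have := ler_distD (u (n + i)%N) y q; rewrite (distrC y (u _)); lra.
have [ya|yb] := eqVneq y a; last exact: key Fa ha yb.
by apply: (key b Fb hb); rewrite ya.
Qed.

(** While the orbit shadows that of q, it returns near q every N steps; the shadowing can last
    arbitrarily long. *)
Lemma periodic_upper_banach q N : (0 < N)%N -> iter N F q = q ->
  limit_points some_time u q -> limit_points upper_banach_pos u q.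
Proof.
move=> N0 Nq hq e e0; exists N => M.
have [n hn] := shadow hq (N * M.+1) e0.
exists n, (N * M.+1)%N; split; [nia|nia|].
rewrite leq_mul2l; apply/orP; right.
have iq j : iter (N * j) F q = q.
  by elim: j => [|j ih]; rewrite ?muln0// mulnS addnC iterD Nq.
elim: M.+1 hn => [//|j ih] hn.
rewrite mulnS addnC cntD -addn1; apply: leq_add.
  by apply: ih => i hi; apply: hn; rewrite mulnS; lia.
apply: (@cntS_ge _ _ _ 0) => //.
by rewrite addn0 /near_times /= -[X in _ - X](iq j); apply: hn; rewrite mulnS; lia.
Qed.

Lemma upper_banach_closed y :
  (forall e, 0 < e -> exists2 q, `|q - y| < e & limit_points upper_banach_pos u q) ->
  limit_points upper_banach_pos u y.
Proof.
move=> h e e0; have e2 : 0 < e / 2 by rewrite divr_gt0.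
have [q qy hq] := h _ e2; apply: upper_banach_posS (hq _ e2) => k.
rewrite /near_times /= => h1.
by have := ler_distD q (u k) y; lra.
Qed.

End shadowing.

(** * The logistic map *)

Section logistic.
Context {R : realType}.
Implicit Types (t x y : R) (s : nat -> bool).

Definition logistic x : R := 4 * x * (1 - x).

Definition logistic2 x : R := logistic (logistic x).

Definition logistic2' x : R := (4 - 8 * logistic x) * (4 - 8 * x).

Lemma is_derive_logistic2 x : is_derive x (1 : R) logistic2 (logistic2' x).
Proof.
have dl z : is_derive z (1 : R) logistic (4 - 8 * z).
  by apply: is_derive_eq; rewrite /GRing.scale /=; ring.
exact: is_derive1_comp.
Qed.

Lemma continuous_logistic2' : continuous logistic2'.
Proof.
move=> x; apply: cvgM; apply: cvgB; (try exact: cvg_cst); apply: cvgM; (try exact: cvg_cst); last exact: cvg_id.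
apply: cvgM; first by apply: cvgM; [exact: cvg_cst|exact: cvg_id].
by apply: cvgB; [exact: cvg_cst|exact: cvg_id].
Qed.

Lemma continuous_logistic2 : continuous logistic2.
Proof.
by move=> x; apply: differentiable_continuous; apply/derivable1_diffP; have [] := is_derive_logistic2 x.
Qed.

Lemma logistic01 x : 0 <= x <= 1 -> 0 <= logistic x <= 1.
Proof. by move=> /andP[x0 x1]; have := sqr_ge0 (2 * x - 1); rewrite /logistic expr2 => h; apply/andP; split; nra. Qed.

Lemma logistic2_01 x : 0 <= x <= 1 -> 0 <= logistic2 x <= 1.
Proof. by move=> /logistic01/logistic01. Qed.

(* Conjugates logistic2 to t |-> 4 * t. *)
Definition hcos t : R := (1 - cos (2 * pi * t)) / 2.

Lemma logistic_hcos t : logistic (hcos t) = hcos (2 * t).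
Proof.
rewrite /logistic /hcos (_ : 2 * pi * (2 * t) = (2 * pi * t) *+ 2); last first.
  by rewrite mulr2n; ring.
by rewrite cos_mulr2n mulr2n; field.
Qed.

Lemma logistic2_hcos t : logistic2 (hcos t) = hcos (4 * t).
Proof. by rewrite /logistic2 !logistic_hcos; congr hcos; ring. Qed.

Lemma hcosDn n t : hcos (n%:R + t) = hcos t.
Proof.
rewrite /hcos; congr ((1 - _) / 2).
elim: n => [|n ih]; first by rewrite add0r.
rewrite -(natr1 n) -ih (_ : _ * (_ + 1 + t) = 2 * pi * (n%:R + t) + pi *+ 2); last by rewrite mulr2n; ring.
by rewrite cosD2pi.
Qed.

Lemma iter_logistic2_hcos k t : iter k logistic2 (hcos t) = hcos (4 ^+ k * t).
Proof.
elim: k => [|k ih] /=; first by rewrite mul1r.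
by rewrite ih logistic2_hcos exprS mulrA.
Qed.

Lemma hcos_lipschitz t t' : `|hcos t - hcos t'| <= pi * `|t - t'|.
Proof.
have df z : is_derive z (1 : R) hcos (pi * sin (2 * pi * z)).
  have d1 : is_derive z (1 : R) (fun z => 2 * pi * z) (2 * pi).
    by apply: is_derive_eq; rewrite /GRing.scale /=; ring.
  have d2 : is_derive z (1 : R) (cos \o (fun z => 2 * pi * z)) (- sin (2 * pi * z) * (2 * pi)).
    exact: is_derive1_comp.
  by apply: is_derive_eq; rewrite /GRing.scale /=; field.
apply: (@mean_value_bound R hcos (fun z => pi * sin (2 * pi * z)) (Num.min t t') (Num.max t t') pi) => //.
- move=> z _; rewrite normrM (ger0_norm (pi_ge0 R)) -[leRHS]mulr1 ler_wpM2l ?pi_ge0//.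
  exact: sin_max.
- by rewrite ge_min le_max lexx.
- by rewrite ge_min le_max lexx !orbT.
Qed.

Lemma hcos_inj t t' : 0 <= t <= 2^-1 -> 0 <= t' <= 2^-1 -> hcos t = hcos t' -> t = t'.
Proof.
move=> /andP[t0 t1] /andP[t0' t1'] /(congr1 (fun x => 1 - 2 * x)).
have p0 := pi_gt0 R.
rewrite /hcos (_ : 1 - 2 * _ = cos (2 * pi * t)); last by field.
rewrite (_ : 1 - 2 * _ = cos (2 * pi * t')); last by field.
have E (z : R) : 0 <= z -> z <= 2^-1 -> 2 * pi * z \in `[0, pi].
  move=> z0 z1; have h1 : 0 <= pi * z by apply: mulr_ge0 => //; exact: pi_ge0.
  have h2 : 0 <= pi * (2^-1 - z) by apply: mulr_ge0; [exact: pi_ge0|rewrite subr_ge0].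
  by rewrite in_itv /=; apply/andP; split; lra.
move=> /cos_inj => /(_ (E _ t0 t1) (E _ t0' t1')).
by apply: mulfI; rewrite mulf_neq0// gt_eqF.
Qed.

Lemma hcos01 t : 0 <= hcos t <= 1.
Proof. by have := cos_geN1 (2 * pi * t); have := cos_le1 (2 * pi * t); rewrite /hcos; lra. Qed.

Lemma hcos_onto x : 0 <= x <= 1 -> exists2 t, 0 <= t <= 2^-1 & hcos t = x.
Proof.
move=> /andP[x0 x1]; have p0 := pi_gt0 R.
have hx : -1 <= 1 - 2 * x <= 1 by apply/andP; split; lra.
exists (acos (1 - 2 * x) / (2 * pi)).
  rewrite divr_ge0 ?acos_ge0 ?mulr_ge0 ?pi_ge0//=.
  by rewrite ler_pdivrMr ?mulr_gt0// mulKf ?acos_lepi.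
rewrite /hcos (_ : 2 * pi * _ = acos (1 - 2 * x)); last first.
  by rewrite mulrC divfK// mulf_neq0 ?gt_eqF.
rewrite acosK ?in_itv//=.
by field.
Qed.

End logistic.

Section base4.
Context {R : realType}.
Variable s : nat -> bool.

Fixpoint base4_part m n : R := if m is m'.+1 then ((s n)%:R + base4_part m' n.+1) / 4 else 0.

(* \sum_k s (n + k) / 4 ^ k.+1; two steps of the logistic map, hence base 4, keep
   the codings of the digits 0 and 1 apart. *)
Definition base4 n : R := limn (fun m => base4_part m n).

Lemma base4_part_bounds m n : 0 <= base4_part m n <= 3^-1.
Proof.
elim: m n => [|m ih] n /=; first by rewrite lexx invr_ge0 ler0n.
have : 0 <= ((s n)%:R : R) <= 1 by rewrite ler0n lern1 leq_b1.
by have := ih n.+1 => /andP[? ?] /andP[? ?]; apply/andP; split; lra.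
Qed.

Lemma base4_cvg n : base4_part m n @[m --> \oo] --> base4 n.
Proof.
apply: nondecreasing_is_cvgn.
  apply/nondecreasing_seqP => m; elim: m n => [|m ih] n.
    by have /andP[] := base4_part_bounds 1 n.
  by rewrite /= ler_pM2r ?invr_gt0// lerD2l; exact: ih.
by exists 3^-1 => _ [m _ <-]; have /andP[] := base4_part_bounds m n.
Qed.

Lemma base4_bounds n : 0 <= base4 n <= 3^-1.
Proof.
apply/andP; split.
  by apply: limr_ge; [exact: base4_cvg|apply: nearW => m; have /andP[] := base4_part_bounds m n].
by apply: limr_le; [exact: base4_cvg|apply: nearW => m; have /andP[] := base4_part_bounds m n].
Qed.

Lemma base4_rec n : 4 * base4 n = (s n)%:R + base4 n.+1.
Proof.
have h1 : base4_part m.+1 n @[m --> \oo] --> base4 n.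
  by rewrite (cvg_shiftS (fun m => base4_part m n)); exact: base4_cvg.
have h2 : base4_part m.+1 n @[m --> \oo] --> ((s n)%:R + base4 n.+1) / 4.
  apply: cvgM; last exact: cvg_cst.
  by apply: cvgD; [exact: cvg_cst|exact: base4_cvg].
by rewrite (cvg_unique _ h1 h2)//; field.
Qed.

Lemma base4_zeros m n : (forall i, (i < m)%N -> s (n + i)%N = false) -> base4 n <= 3^-1 * 4^-1 ^+ m.
Proof.
elim: m n => [|m ih] n h; first by rewrite mulr1; have /andP[] := base4_bounds n.
have sn : s n = false by rewrite -(addn0 n) h.
have := ih n.+1 (fun i im => etrans (congr1 s (addSnnS n i)) (h _ (im : (i.+1 < m.+1)%N))).
by have := base4_rec n; rewrite sn add0r exprS mulrCA; lra.
Qed.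

Lemma base4_ones m n : (forall i, (i < m)%N -> s (n + i)%N = true) ->
  3^-1 - base4 n <= 3^-1 * 4^-1 ^+ m.
Proof.
elim: m n => [|m ih] n h; first by rewrite mulr1; have /andP[] := base4_bounds n; lra.
have := base4_rec n; have := ih n.+1 (fun i im => etrans (congr1 s (addSnnS n i)) (h _ (im : (i.+1 < m.+1)%N))).
have -> : (s n)%:R = 1 :> R by rewrite -(addn0 n) h.
by move=> H E; rewrite exprS mulrCA; lra.
Qed.

Definition coded_point : R := hcos (base4 0).

Lemma iter_coded_point n : iter n logistic2 coded_point = hcos (base4 n).
Proof.
elim: n => // n ih; rewrite iterS ih logistic2_hcos base4_rec.
by case: (s n); [exact: (hcosDn 1)|rewrite add0r].
Qed.

Definition const_block c m : set nat := [set n | forall i, (i < m)%N -> s (n + i)%N = c].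

(** The point with all digits c, as 0.111... in base 4 is 1/3. In base 2 the expansions 0.000... and
    0.111... would agree modulo 1. *)
Definition fixpt (c : bool) : R := hcos (if c then 3^-1 else 0).

Lemma fixpt_fixed c : logistic2 (fixpt c) = fixpt c.
Proof.
rewrite /fixpt logistic2_hcos; case: c; last by rewrite mulr0.
by rewrite (_ : 4 * 3^-1 = 1%:R + 3^-1); [rewrite hcosDn|field].
Qed.

Lemma fixpt_neq : fixpt false != fixpt true.
Proof.
apply/eqP => /hcos_inj; have h : 0 <= (3^-1 : R) <= 2^-1 by lra.
have h0 : 0 <= (0 : R) <= 2^-1 by lra.
by move=> /(_ h0 h)/eqP; rewrite eq_sym invr_eq0 pnatr_eq0.
Qed.

Lemma exp4_small (e : R) : 0 < e -> exists m, pi * (3^-1 * 4^-1 ^+ m) < e.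
Proof.
move=> e0.
have : pi * (3^-1 * 4^-1 ^+ m) @[m --> \oo] --> (pi * (3^-1 * 0) : R).
  apply: cvgM; first exact: cvg_cst.
  apply: cvgM; first exact: cvg_cst.
  by apply: cvg_expr; rewrite ger0_norm; lra.
rewrite !mulr0 => /cvgrPdist_lt/(_ e e0)[m _ hm].
exists m; have := hm m (leqnn _); rewrite /= sub0r normrN; apply: le_lt_trans; exact: ler_norm.
Qed.

Lemma near_fixpt c e : 0 < e -> exists m, forall n, const_block c m n ->
  `|hcos (base4 n) - fixpt c| < e.
Proof.
move=> e0; have [m hm] := exp4_small e0; exists m => n hn.
apply: le_lt_trans hm; apply: le_trans (hcos_lipschitz _ _) _.
rewrite ler_wpM2l ?pi_ge0//.
have /andP[b0 b3] := base4_bounds n.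
case: c hn => hn.
  by rewrite distrC ger0_norm ?subr_ge0//; exact: base4_ones.
by rewrite subr0 ger0_norm//; exact: base4_zeros.
Qed.

End base4.

Lemma neq_negb (a b : bool) : a <> b -> a = ~~ b.
Proof. by case: a; case: b. Qed.

Lemma fixpt_dist {R : realType} c :
  `|fixpt c - fixpt (~~ c) : R| = `|fixpt false - fixpt true|.
Proof. by case: c => //=; rewrite distrC. Qed.

(** * Orbits coded by long constant blocks of digits *)

Section coded_orbit.
Context {R : realType}.
Variable s : nat -> bool.
Let u n : R := iter n logistic2 (coded_point s).

Definition jumps : set nat := [set n | s n != s n.+1].
(* Away from the jumps the orbit shadows one of the two fixed points. *)
Hypothesis null_jumps : forall m, ~ upper_banach_pos (thicken m jumps).

Let uE n : u n = hcos (base4 s n). Proof. exact: iter_coded_point. Qed.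

Lemma const_block_thicken m n : ~ thicken m jumps n -> const_block s (s n) m n.
Proof.
move=> h i; elim: i => [|i ih] im; first by rewrite addn0.
rewrite -(ih (ltnW im)) addnS; apply/eqP; rewrite eq_sym; apply: contrapT => /negP ne.
by apply: h; exists i => //; exact: ltnW.
Qed.

Lemma near_coded e : 0 < e -> exists m, forall n, ~ thicken m jumps n -> `|u n - fixpt (s n)| < e.
Proof.
move=> e0; have [m1 h1] := near_fixpt s true e0; have [m2 h2] := near_fixpt s false e0.
exists (m1 + m2)%N => n /const_block_thicken h; rewrite uE.
case: (s n) h => h; [apply: h1|apply: h2] => i im; apply: h; lia.
Qed.

(** At a positive distance from both fixed points, the orbit is found only at times of
    [thicken m jumps], a set of zero upper Banach density. *)
Lemma coded_upper_banach y : limit_points upper_banach_pos u y -> exists c, y = fixpt c.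
Proof.
move=> hy; apply: contrapT => h.
have d0 c : 0 < `|y - fixpt c|.
  by rewrite normr_gt0 subr_eq0; apply/eqP => yc; apply: h; exists c.
pose e := Num.min `|y - fixpt true| `|y - fixpt false| / 2.
have e0 : 0 < e by rewrite divr_gt0// lt_min !d0.
have ec c : e <= `|y - fixpt c| / 2 by rewrite ler_pM2r ?invr_gt0// ge_min; case: c; rewrite lexx ?orbT.
have [m hm] := near_coded e0.
apply: (null_jumps (m := m)); apply: upper_banach_posS (hy _ e0) => n.
rewrite /near_times /= => h1; apply: contrapT => /hm h2.
have := ler_distD (u n) y (fixpt (s n)); rewrite (distrC y (u n)); have := ec (s n); lra.
Qed.

Definition stable_mod (P : set nat -> Prop) := forall S T X : set nat,
  S `<=` T `|` X -> ~ upper_banach_pos X -> P S -> P T.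

(** Being near [fixpt c] and reading the digit c are the same up to times of [thicken m jumps], to
    which a [stable_mod] property is blind. *)
Lemma coded_fixpt P c : stable_mod P ->
  limit_points P u (fixpt c) <-> P [set n | s n = c].
Proof.
move=> hP; split=> [h|h e e0].
  pose e : R := `|fixpt false - fixpt true| / 2.
  have e0 : 0 < e by rewrite divr_gt0// normr_gt0 subr_eq0 fixpt_neq.
  have [m hm] := near_coded e0.
  apply: hP (@null_jumps m) (h _ e0) => n h1.
  have [ht|/hm h2] := pselect (thicken m jumps n); first by right.
  left; apply: contrapT => sc.
  have sE : s n = ~~ c by exact: neq_negb.
  move: h1; rewrite /near_times /= => h1; move: h2; rewrite sE => h2.
  have := ler_distD (u n) (fixpt c) (fixpt (~~ c)); rewrite (distrC _ (u n)).
  have -> : `|fixpt c - fixpt (~~ c)| = 2 * e.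
    by rewrite mulrC /e divfK//; exact: fixpt_dist.
  by lra.
have [m hm] := near_coded e0.
apply: hP (@null_jumps m) h => n /= sn.
have [ht|/hm h2] := pselect (thicken m jumps n); first by right.
by left; rewrite /near_times /= -sn.
Qed.

Lemma coded_lower c : limit_points lower_pos u (fixpt c) <-> lower_pos [set n | s n = c].
Proof. apply: coded_fixpt => S T X; exact: lower_pos_mod. Qed.

Lemma coded_upper c : limit_points upper_pos u (fixpt c) <-> upper_pos [set n | s n = c].
Proof. apply: coded_fixpt => S T X; exact: upper_pos_mod. Qed.

(** A digit 1 followed by a long run of zeros gives an angle close to 0.1000... = 1/4. This limit
    point, away from both fixed points, makes the fifth inclusion strict. *)
Lemma coded_io : (forall m, infinitely_often [set n | s n /\ const_block s false m n.+1]) ->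
  limit_points infinitely_often u (hcos 4^-1).
Proof.
move=> h e e0 N; have [m hm] := @exp4_small R e e0.
have [n Nn [sn hn]] := h m N; exists n => //.
rewrite /near_times /= uE; apply: le_lt_trans hm; apply: le_trans (hcos_lipschitz _ _) _.
rewrite ler_wpM2l ?pi_ge0//.
have := @base4_rec R s n; have := @base4_zeros R s m n.+1 hn.
have := @base4_bounds R s n.+1; have -> : (s n)%:R = 1 :> R by rewrite sn.
by move=> /andP[? ?] ? ?; rewrite ler_norml; lra.
Qed.

Lemma hcos4V_fixpt c : hcos 4^-1 != fixpt c :> R.
Proof.
apply/eqP => /hcos_inj; have h4 : 0 <= (4^-1 : R) <= 2^-1 by lra.
have hc : 0 <= ((if c then 3^-1 else 0) : R) <= 2^-1 by case: c; lra.
by move=> /(_ h4 hc)/eqP; case: c {hc}; rewrite ?invr_eq0 ?pnatr_eq0// (inj_eq invr_inj) eqr_nat.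
Qed.

Lemma coded_io_strict : (forall m, infinitely_often [set n | s n /\ const_block s false m n.+1]) ->
  exists y, [/\ in_K y, limit_points infinitely_often u y & ~ limit_points upper_banach_pos u y].
Proof.
move=> h; exists (hcos 4^-1); split; last 1 first.
- by move=> /coded_upper_banach[c /eqP]; apply/negP; exact: hcos4V_fixpt.
- by rewrite /in_K hcos01.
- exact: coded_io.
Qed.

Lemma coded_no_syndetic y : upper_pos [set n | s n = true] -> upper_pos [set n | s n = false] ->
  ~ limit_points lower_banach_pos u y.
Proof.
move=> h1 h0.
have H c : upper_pos [set n | s n = c] -> limit_points some_time u (fixpt c).
  move=> /coded_upper h e /h/upper_pos_banach/upper_banach_pos_io; exact: infinitely_often_some.
apply: no_syndetic (H _ h0) (H _ h1); [exact: continuous_logistic2|exact: fixpt_neq|exact: fixpt_fixed..].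
Qed.

End coded_orbit.

Section block_io.
Variable r : nat -> nat.
Hypothesis r_ge2 : forall j, (2 <= r j)%N.
Local Open Scope nat_scope.

(** The last digit 1 of a block is followed by a whole block of zeros, longer than m. The index j is
    even so that block j has digit 1. *)
Lemma color_io m : infinitely_often [set n | color r n /\ const_block (color r) false m n.+1].
Proof.
move=> N; pose j := (N + m).*2; exists (bdry r j.+1).-1.
  by have := bdry_gt r_ge2 j.+1; rewrite /j; lia.
have b1 := bdryS_ge r_ge2 j; have b2 := bdryS_ge r_ge2 j.+1.
have g0 := bdry_gt r_ge2 j; have g1 := bdry_gt r_ge2 j.+1.
have oj : odd j = false by rewrite /j odd_double.
have mj : m <= j by rewrite /j; lia.
have hcol i k : bdry r i <= k < bdry r i.+1 -> color r k = odd i.+1 by exact: colorE.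
split; first by rewrite (hcol j) ?oddS ?oj//; apply/andP; split; clear -b1 b2 g0 g1; lia.
rewrite prednK; last by lia.
move=> i im; rewrite (hcol j.+1) ?oddS ?oj//.
by rewrite leq_addr andTb; clear -b1 b2 g0 g1 im mj; lia.
Qed.

End block_io.

Section wandering_patterns.
Context {R : realType}.

(** Only the first five relations: the sixth is provided by the segment that is collapsed onto p. *)
Definition realized_at (alpha : 6.-tuple bool) := exists2 p : R, 0 <= p <= 1 &
  forall i : 'I_6, (i < 5)%N -> pattern_at alpha (fun k => iter k logistic2 p) i.

Lemma in_K_fixpt c : in_K (fixpt c : R).
Proof. by rewrite /in_K hcos01. Qed.

Section blocks.
Variable r : nat -> nat.
Hypothesis r_ge2 : forall j, (2 <= r j)%N.
Let s := color r.
Let u n : R := iter n logistic2 (coded_point s).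

Let null_s m : ~ upper_banach_pos (thicken m (jumps s)).
Proof. by apply: thicken_null; exact: sparse_switch. Qed.

Let upper_s c : upper_pos [set n | s n = c]. Proof. exact: upper_pos_colored. Qed.

Let hUB y : limit_points upper_banach_pos u y -> exists c, y = fixpt c.
Proof. exact: coded_upper_banach. Qed.

Let hUD c : limit_points upper_pos u (fixpt c).
Proof. by apply/coded_upper => //; exact: upper_s. Qed.

Let hLB y : ~ limit_points lower_banach_pos u y.
Proof. by apply: coded_no_syndetic => //; exact: upper_s. Qed.

Let hLD c : lower_pos [set n | s n = c] <-> limit_points lower_pos u (fixpt c).
Proof. by rewrite coded_lower. Qed.

Let hUDc y : limit_points upper_pos u y -> exists c, y = fixpt c.
Proof. by move=> h; apply: hUB => e /h; exact: upper_pos_banach. Qed.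

Let hIO : exists y, [/\ in_K y, limit_points infinitely_often u y & ~ limit_points upper_banach_pos u y].
Proof. by apply: coded_io_strict => // m; exact: color_io. Qed.

Let pointed alpha : (forall i : 'I_6, (i < 5)%N -> pattern_at alpha u i) -> realized_at alpha.
Proof. by move=> h; exists (coded_point s) => //; exact: hcos01. Qed.

Lemma realized_both : (forall c, lower_pos (colored r c)) ->
  realized_at [tuple true; false; true; true; false; false].
Proof.
move=> h; apply: pointed => -[[|[|[|[|[|//]]]]] hi] _; rewrite /pattern_at (tnth_nth false) /=.
- by move=> y _ /hLB.
- by exists (fixpt true); split; [exact: in_K_fixpt|apply/hLD/h|exact: hLB].
- by move=> y _ /hUDc[c ->]; apply/hLD/h.
- by move=> y _ /hUB[c ->]; exact: hUD.
- exact: hIO.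
Qed.

Lemma realized_none : (forall c, ~ lower_pos (colored r c)) ->
  realized_at [tuple true; true; false; true; false; false].
Proof.
move=> h; have hLD0 y : ~ limit_points lower_pos u y.
  move=> hy; have [c yc] : exists c, y = fixpt c.
    by apply: hUDc => e /hy; exact: lower_pos_upper.
  by move: hy; rewrite yc => /hLD/h.
apply: pointed => -[[|[|[|[|[|//]]]]] hi] _; rewrite /pattern_at (tnth_nth false) /=.
- by move=> y _ /hLB.
- by move=> y _ /hLD0.
- by exists (fixpt true); split; [exact: in_K_fixpt|exact: hUD|exact: hLD0].
- by move=> y _ /hUB[c ->]; exact: hUD.
- exact: hIO.
Qed.

Lemma realized_one : lower_pos (colored r false) -> ~ lower_pos (colored r true) ->
  realized_at [tuple true; false; false; true; false; false].
Proof.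
move=> h0 h1.
apply: pointed => -[[|[|[|[|[|//]]]]] hi] _; rewrite /pattern_at (tnth_nth false) /=.
- by move=> y _ /hLB.
- by exists (fixpt false); split; [exact: in_K_fixpt|apply/hLD|exact: hLB].
- by exists (fixpt true); split; [exact: in_K_fixpt|exact: hUD|move/hLD].
- by move=> y _ /hUB[c ->]; exact: hUD.
- exact: hIO.
Qed.

End blocks.

Lemma realized_101100 : realized_at [tuple true; false; true; true; false; false].
Proof.
have r2 j : (2 <= (fun=> 2) (j : nat))%N by [].
by apply: (realized_both r2) => c; exact: lower_pos_colored.
Qed.

Lemma realized_110100 : realized_at [tuple true; true; false; true; false; false].
Proof.
have r2 j : (2 <= j.+2)%N by [].
apply: (realized_none r2) => c; apply: not_lower_pos_colored => // M.
exists (M.*2 + c)%N; last by lia.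
by rewrite /= oddD odd_double; case: c.
Qed.

(** Blocks of digit 1 only double the time, which keeps 0 at positive lower density; the ratios of
    the blocks of 0 are unbounded, which deprives 1 of it. *)
Lemma realized_100100 : realized_at [tuple true; false; false; true; false; false].
Proof.
pose r j := if odd j.+1 then 2 else j.+2.
have r2 j : (2 <= r j)%N by rewrite /r; case: ifP.
apply: (realized_one r2); first by apply: lower_pos_colored => // j; rewrite /r; case: odd.
apply: not_lower_pos_colored => // M; exists (M.*2.+1)%N; rewrite /r /= odd_double//=; lia.
Qed.

Section isolated.
Let r := (fun=> 2) : nat -> nat.
Let r2 j : (2 <= r j)%N. Proof. by []. Qed.
(** Isolated digits 1, at the times 2 ^ j - 1, with gaps tending to infinity. No density sees them,
    but they put [hcos 4^-1] in the omega-limit set. *)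
Let s n : bool := `[< exists j, n.+1 = bdry r j >].
Let u n : R := iter n logistic2 (coded_point s).

Let sparse_true : sparse [set n | s n].
Proof. by apply: (sparse_bdry r2) => n /asboolP. Qed.

Let null_true m : ~ upper_banach_pos (thicken m [set n | s n]).
Proof. exact: thicken_null. Qed.

Let null_s m : ~ upper_banach_pos (thicken m (jumps s)).
Proof.
move=> h; apply: (null_true (m := m.+1)); apply: upper_banach_posS h => n [i im ji].
have [sn|/negP sn] := boolP (s (n + i)%N); first by exists i => //; exact: ltnW.
exists i.+1 => //; move: ji; rewrite /jumps /= addnS.
by case: (s (n + i)%N) sn => // _; case: (s _).
Qed.

Let hz m : lower_banach_pos (const_block s false m).
Proof.
apply: lower_banach_posS (lower_banach_posC (null_true (m := m))) => n h i im.
by apply/negP => si; apply: h; exists i.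
Qed.

Let hLB : limit_points lower_banach_pos u (fixpt false).
Proof.
move=> e e0; have [m hm] := near_fixpt s false e0.
by apply: lower_banach_posS (hz m) => n /hm; rewrite /near_times /= /u iter_coded_point.
Qed.

Let hUB y : limit_points upper_banach_pos u y -> y = fixpt false.
Proof.
move=> hy; have [[] yc //] := coded_upper_banach null_s hy.
exfalso; have d0 : 0 < `|fixpt false - fixpt true : R| / 2.
  by rewrite divr_gt0// normr_gt0 subr_eq0 fixpt_neq.
have [m hm] := near_fixpt s false d0.
apply: (null_true (m := m)); move: hy; rewrite yc => /(_ _ d0); apply: upper_banach_posS => n.
rewrite /near_times /= /u iter_coded_point => h1; apply: contrapT => h2.
have : const_block s false m n by move=> i im; apply/negP => si; apply: h2; exists i.
move=> /hm h3.
have := ler_distD (hcos (base4 s n)) (fixpt false) (fixpt true : R).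
by rewrite (distrC (fixpt false) (hcos _)); lra.
Qed.

Let hIO m : infinitely_often [set n | s n /\ const_block s false m n.+1].
Proof.
move=> N; pose j := (N + m)%N; have g0 := bdry_gt r2 j; have b0 := bdryS_ge r2 j.
have mj : (m <= j)%N by rewrite /j leq_addl.
have Nj : (N <= j)%N by rewrite /j leq_addr.
clearbody j; exists (bdry r j).-1; first by lia.
split; first by apply/asboolP; exists j; rewrite prednK//; lia.
move=> i im; apply/negP => /asboolP[k]; rewrite prednK; last by lia.
have [kj|jk] := leqP k j; first by have := bdry_mono r2 kj; lia.
by have := bdry_mono r2 jk; lia.
Qed.

Lemma realized_011100 : realized_at [tuple false; true; true; true; false; false].
Proof.
have hLD : limit_points lower_pos u (fixpt false) by move=> e /hLB; exact: lower_banach_pos_lower.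
have hUD : limit_points upper_pos u (fixpt false) by move=> e /hLD; exact: lower_pos_upper.
have hUDc y : limit_points upper_pos u y -> y = fixpt false.
  by move=> h; apply: hUB => e /h; exact: upper_pos_banach.
have hLDc y : limit_points lower_pos u y -> y = fixpt false.
  by move=> h; apply: hUDc => e /h; exact: lower_pos_upper.
exists (coded_point s); first exact: hcos01.
move=> [[|[|[|[|[|//]]]]] hi] _; rewrite /pattern_at (tnth_nth false) /=.
- by exists (fixpt false); split => //; [exact: in_K_fixpt|move=> /(_ 1 ltr01)].
- by move=> y _ /hLDc ->.
- by move=> y _ /hUDc ->.
- by move=> y _ /hUB ->.
- exact: coded_io_strict.
Qed.

End isolated.

End wandering_patterns.

(** * Borel-Cantelli and the digits of almost every number *)

Section borel_cantelli.
Context {R : realType}.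
Local Open Scope ereal_scope.

Lemma borel_cantelli (F : nat -> set R) : \sum_(0 <= n <oo) @lebesgue_measure R (F n) < +oo ->
  (@lebesgue_measure R).-negligible (lim_sup_set F).
Proof.
move=> Foo; apply/negligible_lebesgue/eqP; rewrite eq_le lebesgue_ge0 andbT.
have tail := @nneseries_tail_cvg R (fun n => @lebesgue_measure R (F n)) xpredT Foo
  (fun k _ => lebesgue_ge0 (F k)).
apply: (cvge_ge _ tail).
apply: nearW => N.
apply: (@le_trans _ _ (@lebesgue_measure R (\bigcup_(n in ~` `I_N) F n))).
  by apply: lebesgue_le => x /(_ N I)[j /= Nj Fj]; exists j => //=; apply/negP; rewrite -leqNgt.
exact: (@outer_measure_sigma_subadditive_tail _ _ ((@wlength R idfun)^*)%mu).
Qed.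

Lemma borel_cantelli_geometric (F : nat -> set R) (C : R) :
  (forall n, @lebesgue_measure R (F n) <= (C * 2^-1 ^+ n)%:E) ->
  (@lebesgue_measure R).-negligible (lim_sup_set F).
Proof.
move=> hF; apply: borel_cantelli.
apply: (@le_lt_trans _ _ (\sum_(0 <= n <oo) (C * 2^-1 ^+ n)%:E)).
  by apply: lee_nneseries => [i _ _|i _]; [exact: lebesgue_ge0|exact: hF].
have C0 : (0 <= C)%R.
  by have := le_trans (lebesgue_ge0 _) (hF 0%N); rewrite mulr1 lee_fin.
have h : (series (geometric C 2^-1) n @[n --> \oo] --> C * (1 - 2^-1)^-1)%R.
  by apply: cvg_geometric_series; rewrite ger0_norm ?invr_ge0//; lra.
have -> : \sum_(0 <= n <oo) (C * 2^-1 ^+ n)%:E = (C * (1 - 2^-1)^-1)%:E.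
  apply/cvg_lim => //.
  rewrite (_ : (fun n => _) = EFin \o series (geometric C 2^-1%R)).
    by apply: cvg_EFin; [exact: nearW|exact: h].
  by apply/funext => n /=; rewrite -sumEFin.
by rewrite ltry.
Qed.

End borel_cantelli.

Section digit_count.
Variables (B d : nat).
Hypothesis dB : (d < B)%N.
Local Open Scope nat_scope.

Fixpoint digit_count n i := if n is n'.+1 then (i %% B == d) + digit_count n' (i %/ B) else 0.

Let B0 : 0 < B. Proof. exact: leq_ltn_trans dB. Qed.

(* Chernoff's exponential weight 2 ^ (n - digit_count n i), whose sum factorizes over
   the digits. *)
Fixpoint digit_weight n i :=
  if n is n'.+1 then (if i %% B == d then 1 else 2) * digit_weight n' (i %/ B) else 1.

Lemma digit_weightE n i : digit_weight n i * 2 ^ digit_count n i = 2 ^ n.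
Proof.
elim: n i => //= n ih i; rewrite expnS -(ih (i %/ B)); case: eqP => _.
  by rewrite add1n expnS mul1n mulnCA.
by rewrite add0n mulnA.
Qed.

Lemma sum_nat_mul q (F : nat -> nat) :
  \sum_(0 <= i < q * B) F i = \sum_(0 <= a < q) \sum_(0 <= b < B) F (a * B + b).
Proof.
elim: q => [|q ih]; first by rewrite mul0n !big_geq.
rewrite big_nat_recr//= -ih (@big_cat_nat _ _ _ (q * B))//=; last by rewrite leq_mul2r leqnSn orbT.
congr (_ + _); rewrite -{1}[q * B]add0n big_addn mulSn addnK.
by apply: eq_bigr => i _; rewrite addnC.
Qed.

(** Each place contributes the factor 1 + 2 * (B - 1) = 2 * B - 1: the digit d has weight 1 and the
    B - 1 others have weight 2. *)
Lemma sum_digit_weight n : \sum_(0 <= i < B ^ n) digit_weight n i = (2 * B).-1 ^ n.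
Proof.
elim: n => [|n ih]; first by rewrite big_nat1.
rewrite expnSr sum_nat_mul /=.
rewrite (eq_bigr (fun a => (2 * B).-1 * digit_weight n a)) => [|a _].
  by rewrite -big_distrr /= ih expnS.
rewrite (eq_big_nat _ _ (F2 := fun b => (if b == d then 1 else 2) * digit_weight n a)) => [|b /andP[_ bB]].
  rewrite -big_distrl /=; congr (_ * _).
  rewrite big_mkord (bigD1 (Ordinal dB))//= eqxx.
  rewrite (eq_bigr (fun=> 2)) => [|i]; last by rewrite -val_eqE /= => /negbTE ->.
  by rewrite sum_nat_const cardC1 card_ord; lia.
by rewrite modnMDl modn_small// divnMDl// divn_small// addn0.
Qed.

(** Markov's inequality for the weight: at most l digits d means a weight at least 2 ^ (n - l). *)
Lemma few_digits n l : \sum_(0 <= i < B ^ n | digit_count n i <= l) 2 ^ n <= 2 ^ l * (2 * B).-1 ^ n.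
Proof.
rewrite -sum_digit_weight big_distrr /= big_mkcond /=; apply: leq_sum => i _.
by case: ifP => // h; rewrite -(digit_weightE n i) mulnC leq_mul2r leq_exp2l// h orbT.
Qed.

End digit_count.

Section digits.
Context {R : realType}.
Variables (B d : nat).
Hypothesis dB : (d < B)%N.
Implicit Types t : R.

Let B0 : (0 < B)%N. Proof. exact: leq_ltn_trans dB. Qed.

Definition digit_at t : set nat := [set j | Num.trunc (B%:R ^+ j.+1 * t) %% B = d]%N.

Lemma truncn_div (x : R) : 0 <= x -> (Num.trunc (B%:R * x) %/ B = Num.trunc x)%N.
Proof.
move=> x0; apply/esym/truncn_def.
have Br : 0 < B%:R :> R by rewrite ltr0n.
have Bx0 : 0 <= B%:R * x by rewrite mulr_ge0 ?ler0n.
have := truncn_itv Bx0; set m := Num.trunc _ => /andP[h1 h2]; apply/andP; split.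
  rewrite -(ler_pM2l Br) (le_trans _ h1)// -natrM ler_nat mulnC; exact: leq_divM.
rewrite -(ltr_pM2l Br) (lt_le_trans h2)// -natrM ler_nat mulnC; exact: ltn_ceil.
Qed.

Lemma cnt_digit n t : 0 <= t ->
  cnt (digit_at t) 0 n = digit_count B d n (Num.trunc (B%:R ^+ n * t)).
Proof.
move=> t0; elim: n => [|n ih]; first by rewrite cnt0.
rewrite -addn1 cntD ih addn1 /= exprS -mulrA truncn_div; last first.
  by rewrite mulr_ge0// exprn_ge0// ler0n.
rewrite addnC; congr (_ + _)%N; rewrite cntE big_ord1 addn0 add0n.
rewrite /digit_at /= exprS -mulrA.
by congr nat_of_bool; apply/asboolP/eqP.
Qed.

Definition few_digits_set n l : set R := [set t | 0 <= t < 1 /\ (cnt (digit_at t) 0 n <= l)%N].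

(** Covering by the intervals of length 1 / B ^ n that the first n digits determine, whose number
    [few_digits] bounds. *)
Lemma few_digits_setP n l : (@lebesgue_measure R (few_digits_set n l) <=
  ((2 ^+ l) * ((2 * B).-1%:R / (2 * B)%:R) ^+ n)%:E)%E.
Proof.
pose N := (B ^ n)%N; have N0 : (0 < N)%N by rewrite expn_gt0 B0.
have Nr : 0 < N%:R :> R by rewrite ltr0n.
pose F i : set R := if (i < N)%N && (digit_count B d n i <= l)%N then `[i%:R / N%:R, i.+1%:R / N%:R]%classic else set0.
have sub : few_digits_set n l `<=` \bigcup_i F i.
  move=> t [/andP[t0 t1]]; rewrite cnt_digit// -natrX -/N => h.
  have Nt0 : 0 <= N%:R * t by rewrite mulr_ge0 ?ler0n.
  exists (Num.trunc (N%:R * t)) => //; rewrite /F h andbT ifT.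
    have /andP[h1 h2] := truncn_itv Nt0.
    by rewrite /= in_itv /= ler_pdivrMr// ler_pdivlMr// (mulrC t) h1/= ltW.
  by rewrite truncn_lt_nat// -[ltRHS]mulr1 ltr_pM2l.
apply: (le_trans (lebesgue_le sub)); apply: (le_trans (lebesgue_sigma_subadditive _)).
apply: (@le_trans _ _ (\sum_(0 <= i < N | (digit_count B d n i <= l)%N) (N%:R^-1)%:E)%E).
  rewrite (nneseries_split 0 N); last by move=> *; exact: lebesgue_ge0.
  rewrite add0n [X in (_ + X)%E]eseries0 ?adde0; last first.
    by move=> i Ni _; rewrite /F ltnNge Ni/= measure0.
  rewrite [leRHS]big_mkcond /= big_nat [leRHS]big_nat; apply: lee_sum => i /andP[_ iN].
  rewrite /F iN /=; case: ifP => _; last by rewrite measure0.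
  rewrite lebesgue_measure_itv /= lte_fin ltr_pM2r ?invr_gt0// ltr_nat ltnSn.
  by rewrite -EFinB lee_fin -mulrBl -natrB// subSnn mul1r.
rewrite sumEFin lee_fin.
have := @few_digits B d dB n l; rewrite -(ler_nat R) natr_sum.
rewrite (eq_bigr (fun=> 2 ^+ n * N%:R * N%:R^-1)) => [|i _]; last by rewrite mulfK ?gt_eqF// natrX.
rewrite -mulr_sumr => h.
rewrite expr_div_n mulrA ler_pdivlMr ?exprn_gt0 ?ltr0n ?muln_gt0//.
rewrite natrM exprMn mulrC -[B%:R ^+ n]natrX -/N.
by apply: le_trans h _; rewrite natrM !natrX.
Qed.

End digits.

Section ae_digits.
Context {R : realType}.

Lemma ae_digit_lower_pos B d : (d < B)%N -> (@lebesgue_measure R).-negligible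
  [set t : R | 0 <= t < 1 /\ ~ lower_pos (digit_at B d t)].
Proof.
move=> dB; have B0 : (0 < B)%N by exact: leq_ltn_trans dB.
pose rho : R := (2 * B).-1%:R / (2 * B)%:R.
have Br : 0 < (2 * B)%:R :> R by rewrite ltr0n muln_gt0.
have rho0 : 0 <= rho by rewrite divr_ge0 ?ler0n.
have rho1 : rho < 1 by rewrite ltr_pdivrMr// mul1r ltr_nat ltn_predL muln_gt0.
(* Among m * l digits, at most l occurrences of d have measure at most 2 ^ l * rho ^ (m * l) <= 2 ^
   (- l), which is summable. The final proportion is 1 / m. *)
have [m [m0 hm]] : exists m, (0 < m)%N /\ 2 * rho ^+ m <= 2^-1.
  have : rho ^+ m @[m --> \oo] --> (0 : R) by apply: cvg_expr; rewrite ger0_norm.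
  have e0 : 0 < 4^-1 :> R by [].
  move=> /cvgrPdist_lt/(_ _ e0)[m _ hm]; exists m.+1; split => //.
  have := hm m.+1 (leqnSn m); rewrite /= sub0r normrN ger0_norm ?exprn_ge0//.
  lra.
have := @borel_cantelli_geometric R (fun l => few_digits_set B d (m * l) l) 1.
move=> /(_ _)/null_subset; apply.
  move=> t [t01 h] N _; apply: contrapT => hN; apply: h.
  exists m, (m * N.+1)%N => k Nk.
  have ml : (m * (k %/ m) <= k)%N by rewrite mulnC leq_divM.
  have kl : (k < m * (k %/ m).+1)%N by rewrite mulnC ltn_ceil.
  have Nl : (N <= k %/ m)%N by rewrite leq_divRL// mulnC; lia.
  have : (k %/ m < cnt (digit_at B d t) 0 (m * (k %/ m)))%N.
    by rewrite ltnNge; apply/negP => h; apply: hN; exists (k %/ m)%N.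
  have := cnt_incr (digit_at B d t) 0 ml.
  move: ml kl Nl; move: (k %/ m)%N => l ml kl Nl h1 h2.
  by apply: leq_trans (ltnW kl) _; rewrite leq_mul2l (leq_trans h2 h1) orbT.
move=> l; apply: (le_trans (few_digits_setP dB (m * l) l)).
rewrite lee_fin -/rho exprM -exprMn mul1r.
by rewrite lerXn2r ?nnegrE ?mulr_ge0 ?exprn_ge0 ?invr_ge0.
Qed.

(** Weaker than normality in base 4: each block of k digits has positive lower density among the
    positions that are multiples of k. *)
Definition digit_normal (t : R) := forall k d, (d < 4 ^ k)%N -> lower_pos (digit_at (4 ^ k) d t).

Lemma ae_digit_normal : (@lebesgue_measure R).-negligible
  [set t : R | 0 <= t < 1 /\ ~ digit_normal t].
Proof.
have sub : [set t : R | 0 <= t < 1 /\ ~ digit_normal t] `<=` \bigcup_k \bigcup_d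
    [set t : R | [/\ 0 <= t < 1, (d < 4 ^ k)%N & ~ lower_pos (digit_at (4 ^ k) d t)]].
  move=> t [t01 h]; apply: contrapT => h2; apply: h => k d dk; apply: contrapT => h3.
  by apply: h2; exists k => //; exists d.
apply: (null_subset sub).
apply: null_bigcup => k; apply: null_bigcup => d.
have [dk|dk] := ltnP d (4 ^ k)%N.
  by apply: null_subset (ae_digit_lower_pos dk) => t [].
apply: (@null_subset R _ set0); first by move=> t [].
exact: negligible_set0.
Qed.

End ae_digits.

Section logistic_ae.
Context {R : realType}.

Lemma digit_at_hcos k d (t y : R) j : 0 <= t -> digit_at (4 ^ k) d t j ->
  d%:R / (4 ^ k)%:R <= y <= d.+1%:R / (4 ^ k)%:R ->
  `|hcos (4 ^+ (k * j) * t) - hcos y| <= pi * (4 ^ k)%:R^-1.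
Proof.
move=> t0; rewrite /digit_at /= natrX exprM; set b : R := 4 ^+ k => hd.
have b0 : 0 < b by rewrite exprn_gt0.
have B0 : (0 < 4 ^ k)%N by rewrite expn_gt0.
have bE : (4 ^ k)%:R = b by rewrite natrX.
have x0 : 0 <= b ^+ j.+1 * t by rewrite mulr_ge0// exprn_ge0// ltW.
have := truncn_itv x0; move: hd; set T := Num.trunc _ => hd.
rewrite -natr1 (divn_eq T (4 ^ k)) hd natrD natrM bE; set a := (T %/ _)%N => /andP[h1 h2].
rewrite -natr1 => /andP[y1 y2].
pose z := b ^+ j * t - a%:R.
have zE : b ^+ j * t = a%:R + z by rewrite /z; ring.
have bz : b * z = b ^+ j.+1 * t - a%:R * b by rewrite /z exprS; ring.
rewrite zE hcosDn; apply: le_trans (hcos_lipschitz _ _) _.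
rewrite ler_wpM2l ?pi_ge0// -(ler_pM2l b0) divff ?gt_eqF// -[b in X in X <= _]gtr0_norm// -normrM.
have y1' : d%:R <= b * y by rewrite mulrC -ler_pdivrMr.
have y2' : b * y <= d%:R + 1 by rewrite mulrC -ler_pdivlMr.
by rewrite mulrBr ler_norml bz; apply/andP; split; lra.
Qed.

Lemma cnt_multiples S k n : (0 < k)%N ->
  (cnt [set j | S (k * j)%N] 0 n <= cnt S 0 (k * n))%N.
Proof.
move=> k0; elim: n => [|n ih]; first by rewrite cnt0.
rewrite -addn1 cntD mulnDr cntD; apply: leq_add => //.
rewrite !add0n muln1 [in leqLHS]cntE big_ord1 addn0.
by case: asboolP => //= h; apply: (@cntS_ge _ _ _ 0); rewrite ?addn0.
Qed.

(** A digit in base 4 ^ k stands for k iterations, so [digit_at] only gives visits at multiples of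
    k. *)
Lemma lower_pos_multiples S k : (0 < k)%N -> lower_pos [set j | S (k * j)%N] -> lower_pos S.
Proof.
move=> k0 [q [N h]]; exists (2 * k * q)%N, (k * N.+1)%N => n Nn.
have ml : (k * (n %/ k) <= n)%N by rewrite mulnC leq_divM.
have kl : (n < k * (n %/ k).+1)%N by rewrite mulnC ltn_ceil.
have Nl : (N.+1 <= n %/ k)%N by rewrite leq_divRL// mulnC.
have := h (n %/ k)%N (ltnW Nl); have := cnt_multiples S (n %/ k) k0.
have := cnt_incr S 0 ml; move: ml kl Nl; move: (n %/ k)%N => l ml kl Nl.
set c1 := cnt _ 0 (k * l); set c2 := cnt _ 0 n; set c3 := cnt _ 0 l => h1 h2 h3.
have h4 : (l <= q * c2)%N by rewrite (leq_trans h3)// leq_mul2l (leq_trans h2 h1) orbT.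
have h5 : (k * l.+1 <= 2 * k * l)%N by nia.
by rewrite (leq_trans (ltnW kl))// (leq_trans h5)// -(mulnA _ q) leq_mul2l h4 orbT.
Qed.

Lemma normal_lower (t y : R) : 0 <= t -> digit_normal t -> 0 <= y <= 1 ->
  limit_points lower_pos (fun n => iter n logistic2 (hcos t)) y.
Proof.
move=> t0 nt /hcos_onto[tau /andP[tau0 tau1] <-] e e0.
(* [exp4_small] bounds pi / 3 * 4 ^ (- k); one more digit replaces 1/3 by 1/4 and makes k'
   positive. *)
have [k hk] := exp4_small e0; pose k' := k.+1.
have hk' : pi * (4 ^ k')%:R^-1 < e.
  apply: le_lt_trans hk; rewrite natrX exprVn exprS invfM.
  by rewrite ler_wpM2l ?pi_ge0// ler_wpM2r ?invr_ge0 ?exprn_ge0// lef_pV2 ?posrE//; lra.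
have b0 : 0 < (4 ^ k')%:R :> R by rewrite ltr0n expn_gt0.
have x0 : 0 <= (4 ^ k')%:R * tau by rewrite mulr_ge0.
have hd : (Num.trunc ((4 ^ k')%:R * tau) < 4 ^ k')%N.
  by rewrite truncn_lt_nat// -[ltRHS]mulr1 ltr_pM2l//; lra.
apply: (@lower_pos_multiples _ k') => //.
apply: lower_posS (nt _ _ hd) => j hj; rewrite /near_times /=.
rewrite iter_logistic2_hcos; apply: le_lt_trans hk'.
apply: digit_at_hcos hj _ => //.
have /andP[h1 h2] := truncn_itv x0.
by rewrite ler_pdivrMr// ler_pdivlMr// (mulrC tau) h1 ltW.
Qed.

(** Patterns quantify over all of K; this discards the points of [2, 3], at distance at least 1 from
    an orbit in [0, 1]. *)
Lemma in_K_orbit (u : nat -> R) y : (forall n, 0 <= u n <= 1) -> in_K y ->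
  limit_points some_time u y -> 0 <= y <= 1.
Proof.
rewrite /in_K => u01 /orP[//|/andP[y2 y3]] /(_ 1 ltr01)[n].
by rewrite /near_times /= ltr_norml => /andP[? ?]; have /andP[? ?] := u01 n; lra.
Qed.

Lemma pattern_101111 (x : R) : 0 <= x <= 1 ->
  (forall y, 0 <= y <= 1 -> limit_points lower_pos (fun n => iter n logistic2 x) y) ->
  pattern [tuple true; false; true; true; true; true] (fun n => iter n logistic2 x).
Proof.
move=> x01; set u := (fun n => iter n logistic2 x) => h.
have u01 n : 0 <= u n <= 1.
  by elim: n => //= n; exact: logistic2_01.
have hc c : limit_points lower_pos u (fixpt c) by apply: h; exact: hcos01.
have hcs c : limit_points some_time u (fixpt c).
  exact: (@limit_points_mono R 2 4).
have hLB y : ~ limit_points lower_banach_pos u y.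
  by apply: (no_syndetic _ fixpt_neq) => //; [exact: continuous_logistic2|exact: fixpt_fixed..].
have sub i := @limit_points_mono R i.
move=> [[|[|[|[|[|[|//]]]]]] hi]; rewrite /pattern_at (tnth_nth false) /=.
- by move=> y _ /hLB.
- by exists (fixpt true); split; [exact: in_K_fixpt|exact: hc|exact: hLB].
- by move=> y yK /(sub 3 3%N _ isT) hy; apply: (sub 2 0%N _ isT); apply: h; exact: in_K_orbit hy.
- by move=> y yK /(sub 4 2%N _ isT) hy; apply: (sub 2 1%N _ isT); apply: h; exact: in_K_orbit hy.
- by move=> y yK /(sub 5 1%N _ isT) hy; apply: (sub 2 2%N _ isT); apply: h; exact: in_K_orbit hy.
- by move=> y yK hy; apply: (sub 2 3%N _ isT); apply: h; exact: in_K_orbit hy.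
Qed.

(** The bad points are images of bad angles under the Lipschitz map [hcos], which preserves null
    sets. *)
Lemma logistic_ae_pattern : (@lebesgue_measure R).-negligible
  [set x | 0 <= x <= 1 /\ ~ pattern [tuple true; false; true; true; true; true] (fun n => iter n logistic2 x)].
Proof.
have sub : [set x : R | 0 <= x <= 1 /\ ~ pattern [tuple true; false; true; true; true; true] (fun n => iter n logistic2 x)]
    `<=` hcos @` [set t : R | 0 <= t < 1 /\ ~ digit_normal t].
  move=> x [x01 hx]; have [t /andP[t0 t1] tx] := hcos_onto x01.
  exists t => //; split; first by lra.
  move=> nt; apply: hx; apply: pattern_101111 => // y y01; rewrite -tx; exact: normal_lower.
apply: (null_subset sub); apply: (negligible_lipschitz_image (pi_gt0 R)); last exact: ae_digit_normal.
by move=> t t' _ _; exact: hcos_lipschitz.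
Qed.

Lemma negligible_not_full (A : set R) : (@lebesgue_measure R).-negligible A ->
  exists2 x, 0 <= x <= 1 & ~ A x.
Proof.
move=> nA; apply: contrapT => h.
have sub : `[0, 1]%classic `<=` A.
  by move=> x /=; rewrite in_itv /= => x01; apply: contrapT => nx; apply: h; exists x.
have := null_subset sub nA => /negligible_lebesgue.
by rewrite lebesgue_measure_itv /= lte_fin ltr01 -EFinB subr0 => /eqP; rewrite eqe oner_eq0.
Qed.

Lemma realized_101110 : @realized_at R [tuple true; false; true; true; true; false].
Proof.
have [x x01 hx] := negligible_not_full logistic_ae_pattern.
exists x => //; have {}hx : pattern [tuple true; false; true; true; true; true] (fun n => iter n logistic2 x).
  by apply: contrapT => h; apply: hx.
by move=> [[|[|[|[|[|//]]]]] hi] _; have := hx (Ordinal hi); rewrite /pattern_at !(tnth_nth false).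
Qed.

End logistic_ae.

(** * The Boole map *)

Section boole.
Context {R : realType}.
Implicit Types (v w a b c d z : R).

(** For v = 1 / (1 + x ^ 2) this is (x ^ 4 - x ^ 2 + 1) / (1 + x ^ 2) ^ 2; dividing v * (1 - v) = x
    ^ 2 / (1 + x ^ 2) ^ 2 by it gives 1 / (1 + (x - 1/x) ^ 2). *)
Definition booleD v : R := 1 - 3 * (v * (1 - v)).

(* The Boole map x |-> x - 1/x in the coordinate v = 1 / (1 + x ^ 2). *)
Definition boole v : R := v * (1 - v) / booleD v.

Definition boole' v : R := (1 - 2 * v) / booleD v ^+ 2.

Lemma booleD_ge v : 4^-1 <= booleD v.
Proof. by have := sqr_ge0 (2 * v - 1); rewrite /booleD !expr2 => h; nra. Qed.

Lemma booleD_gt0 v : 0 < booleD v.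
Proof. by apply: lt_le_trans (booleD_ge v). Qed.

Lemma booleD_neq0 v : booleD v != 0.
Proof. by rewrite gt_eqF// booleD_gt0. Qed.

Lemma is_derive_boole v : is_derive v (1 : R) boole (boole' v).
Proof.
have D0 := booleD_neq0 v.
have dD : is_derive v (1 : R) booleD (6 * v - 3).
  by apply: is_derive_eq; rewrite /GRing.scale /=; ring.
have dV : is_derive v (1 : R) (fun x => (booleD x)^-1) (- (6 * v - 3) / booleD v ^+ 2).
  apply: is_derive_eq; rewrite /GRing.scale /=; field.
  exact: D0.
apply: is_derive_eq; rewrite /GRing.scale /=.
rewrite /boole' /booleD in D0 *.
by field.
Qed.

Lemma continuous_boole : continuous boole.
Proof.
by move=> x; apply: differentiable_continuous; apply/derivable1_diffP; have [] := is_derive_boole x.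
Qed.

Lemma continuous_boole' : continuous boole'.
Proof.
have cD : continuous booleD.
  move=> v; apply: cvgB; first exact: cvg_cst.
  apply: cvgM; first exact: cvg_cst.
  by apply: cvgM; [exact: cvg_id|apply: cvgB; [exact: cvg_cst|exact: cvg_id]].
move=> v; apply: cvgM.
  by apply: cvgB; [exact: cvg_cst|apply: cvgM; [exact: cvg_cst|exact: cvg_id]].
apply: cvgV; first by rewrite expf_neq0// booleD_neq0.
apply: (@continuous_comp _ _ _ booleD (fun x => x ^+ 2)); first exact: cD.
exact: exprn_continuous.
Qed.

Lemma boole01 v : 0 <= v <= 1 -> 0 <= boole v <= 1.
Proof.
move=> /andP[v0 v1]; have D0 := booleD_gt0 v; apply/andP; split.
  by apply: divr_ge0; [apply: mulr_ge0 => //; rewrite subr_ge0|exact: ltW].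
rewrite ler_pdivrMr// mul1r /booleD; have := sqr_ge0 (2 * v - 1); rewrite !expr2 => h; nra.
Qed.

Lemma iter_boole01 n v : 0 <= v <= 1 -> 0 <= iter n boole v <= 1.
Proof. by move=> v01; elim: n => //= n; exact: boole01. Qed.

Lemma boole0 : boole 0 = 0. Proof. by rewrite /boole !mul0r. Qed.

Lemma boole1 : boole 1 = 0. Proof. by rewrite /boole subrr mulr0 mul0r. Qed.

Lemma boole_half : boole 2^-1 = 1. Proof. by rewrite /boole /booleD; field. Qed.

Lemma boole_fix : boole (2 / 3) = 2 / 3. Proof. by rewrite /boole /booleD; field. Qed.

Lemma iter_boole0 n : iter n boole 0 = 0.
Proof. by elim: n => //= n ->; exact: boole0. Qed.

Lemma boole_gt0 v : 0 < v < 1 -> 0 < boole v.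
Proof. by move=> /andP[v0 v1]; rewrite divr_gt0 ?booleD_gt0// mulr_gt0// subr_gt0. Qed.

Lemma boole_lt1 v : v != 2^-1 -> boole v < 1.
Proof.
move=> v2; rewrite ltr_pdivrMr ?booleD_gt0// mul1r /booleD.
have : 0 < (2 * v - 1) ^+ 2.
  by rewrite exprn_even_gt0//= subr_eq0; apply: contra v2 => /eqP h; apply/eqP; lra.
by rewrite !expr2 => h; nra.
Qed.

Lemma boole_growth v : 0 <= v <= 2^-1 -> v + v ^+ 2 / 2 <= boole v.
Proof.
move=> /andP[v0 v1]; rewrite ler_pdivlMr ?booleD_gt0// /booleD.
rewrite -subr_ge0.
have -> : v * (1 - v) - (v + v ^+ 2 / 2) * (1 - 3 * (v * (1 - v))) = v ^+ 2 * (3 / 2 * (1 - v - v ^+ 2)) by field.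
by rewrite mulr_ge0 ?sqr_ge0// mulr_ge0 ?divr_ge0// expr2; nra.
Qed.

(** As long as the orbit stays below 1/2, it gains at least v ^ 2 / 2 at each step, with v the
    starting point: 0 repels although its multiplier is 1. *)
Lemma boole_reaches_half v : 0 < v <= 1 -> exists n, 2^-1 <= iter n boole v.
Proof.
move=> /andP[v0 v1]; apply: contrapT => h.
have lt n : iter n boole v < 2^-1 by rewrite ltNge; apply/negP => h2; apply: h; exists n.
have inc n : v + n%:R * (v ^+ 2 / 2) <= iter n boole v.
  elim: n => [|n ih]; first by rewrite mul0r addr0.
  have vn : v <= iter n boole v.
    by apply: le_trans ih; rewrite lerDl mulr_ge0// divr_ge0// sqr_ge0.
  rewrite -natr1 mulrDl mul1r addrA /= (le_trans _ (boole_growth _))//; last first.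
    by rewrite (le_trans (ltW v0) vn) ltW.
  by rewrite lerD// ler_pM2r ?invr_gt0// lerXn2r ?nnegrE// ?(ltW v0)// (le_trans (ltW v0) vn).
have p0 : 0 < v ^+ 2 / 2 by rewrite divr_gt0// exprn_gt0.
pose n := (Num.trunc (2^-1 / (v ^+ 2 / 2))).+1.
have : 2^-1 < n%:R * (v ^+ 2 / 2) by rewrite -ltr_pdivrMr// truncnS_gt.
by have := inc n; have := lt n; lra.
Qed.

Lemma boole_recurrent v : 0 <= v <= 1 -> (forall n, iter n boole v != 0) ->
  forall N, exists2 n, (N <= n)%N & 2^-1 <= iter n boole v.
Proof.
move=> v01 vn N; have /andP[h0 h1] := iter_boole01 N v01.
have [|n hn] := @boole_reaches_half (iter N boole v); first by rewrite lt_def vn h0 h1.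
by exists (n + N)%N; rewrite ?leq_addl// iterD.
Qed.

Lemma boole_lipschitz a b : 0 <= a <= 1 -> 0 <= b <= 1 -> `|boole a - boole b| <= 16 * `|a - b|.
Proof.
apply: (@mean_value_bound R boole boole' 0 1 16); first by move=> x _; exact: is_derive_boole.
move=> x /andP[x0 x1]; rewrite normrM normfV.
have h1 : `|1 - 2 * x| <= 1 by rewrite ler_norml; lra.
have D1 := booleD_ge x; have D0 := booleD_gt0 x.
have h2 : 16^-1 <= `|booleD x ^+ 2|.
  rewrite ger0_norm ?sqr_ge0//.
  have -> : 16^-1 = 4^-1 ^+ 2 :> R by rewrite expr2; lra.
  by rewrite lerXn2r ?nnegrE// ltW.
have h3 : `|booleD x ^+ 2|^-1 <= 16.
  rewrite -[leRHS]invrK lef_pV2 ?posrE ?invr_gt0//; first by rewrite (lt_le_trans _ h2) ?invr_gt0.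
by rewrite -[leRHS]mul1r ler_pM// invr_ge0.
Qed.

Lemma iter_boole_lipschitz n a b : 0 <= a <= 1 -> 0 <= b <= 1 ->
  `|iter n boole a - iter n boole b| <= 16 ^+ n * `|a - b|.
Proof.
move=> a01 b01; elim: n => [|n ih]; first by rewrite mul1r.
rewrite !iterS (le_trans (boole_lipschitz _ _)) ?iter_boole01//.
by rewrite exprS -mulrA ler_pM2l.
Qed.

End boole.

(** * Every interval eventually covers [0, 1] *)

Section locally_eventually_onto.
Context {R : realType}.
Implicit Types (v w a b c d z : R).

Definition covers n a b c d := forall z, c <= z <= d -> exists2 x, a <= x <= b & iter n boole x = z :> R.

Lemma continuous_iter_boole n : continuous (iter n boole : R -> R).
Proof. by apply: continuous_iter; exact: continuous_boole. Qed.

Lemma covers_trans n m a b c d e f : covers n a b c d -> covers m c d e f -> covers (m + n) a b e f.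
Proof.
move=> h1 h2 z /h2[y cyd yz]; have [x axb xy] := h1 y cyd.
by exists x => //; rewrite iterD xy.
Qed.

Lemma covers_sub n a b a' b' c d c' d' : a' <= a -> b <= b' -> c <= c' -> d' <= d ->
  covers n a b c d -> covers n a' b' c' d'.
Proof.
move=> a'a bb' cc' d'd h z /andP[cz zd]; have [|x /andP[ax xb] xz] := h z.
  by rewrite (le_trans cc' cz) (le_trans zd d'd).
by exists x => //; rewrite (le_trans a'a ax) (le_trans xb bb').
Qed.

Lemma covers_ivt n a b : a <= b ->
  covers n a b (Num.min (iter n boole a) (iter n boole b)) (Num.max (iter n boole a) (iter n boole b)).
Proof.
move=> ab z hz.
have [|x xab xz] := IVT ab _ hz; first by apply: continuous_subspaceT; exact: continuous_iter_boole.
by exists x.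
Qed.

(** Since 0 is fixed, the images of [0, d] contain everything up to the iterate of d; once this
    passes 1/2, one more step reaches [boole] 1/2 = 1. *)
Lemma covers_from0 d : 0 < d <= 1 -> exists n, covers n 0 d 0 1.
Proof.
move=> d01; have [n hn] := boole_reaches_half d01; exists n.+1.
have d0 : 0 <= d by case/andP: d01 => /ltW.
have c1 := @covers_ivt n 0 d d0; rewrite iter_boole0 in c1.
have dn : 0 <= iter n boole d by apply: le_trans hn.
rewrite min_l// max_r// in c1.
have c2 : covers 1 0 (2^-1) 0 1.
  have := @covers_ivt 1 0 (2^-1); rewrite /= boole0 boole_half min_l// max_r//.
  by apply.
exact: covers_trans (covers_sub _ _ _ hn c1) c2.
Qed.

(* |x|, for the Boole map x |-> x - 1/x *)
Definition Wc v : R := Num.sqrt ((1 - v) / v).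

Lemma Wc_gt0 v : 0 < v < 1 -> 0 < Wc v.
Proof. by move=> /andP[v0 v1]; rewrite sqrtr_gt0 divr_gt0// subr_gt0. Qed.

Lemma Wc_sqr v : 0 < v < 1 -> Wc v ^+ 2 = (1 - v) / v.
Proof. by move=> /andP[/ltW v0 /ltW v1]; rewrite sqr_sqrtr// divr_ge0// subr_ge0. Qed.

Lemma Wc_boole v : 0 < v < 1 -> v != 2^-1 -> Wc (boole v) = `|Wc v - (Wc v)^-1|.
Proof.
move=> v01 v2; rewrite -sqrtr_sqr; congr Num.sqrt.
have /andP[v0 v1] := v01; have w0 := Wc_gt0 v01.
have n1 : v != 0 by rewrite gt_eqF.
have n2 : 1 - v != 0 by rewrite subr_eq0 eq_sym lt_eqF.
have -> : (Wc v - (Wc v)^-1) ^+ 2 = Wc v ^+ 2 - 2 + (Wc v ^+ 2)^-1.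
  by field; rewrite gt_eqF.
rewrite Wc_sqr// /boole; have := booleD_neq0 v; rewrite /booleD => D0.
by field; rewrite n1 n2 D0.
Qed.

Lemma Wc_lt1 v : 0 < v < 1 -> (Wc v < 1) = (2^-1 < v).
Proof.
move=> v01; have /andP[v0 v1] := v01; have w0 := Wc_gt0 v01.
rewrite -[RHS](_ : ((1 - v) / v < 1) = _); last first.
  by rewrite ltr_pdivrMr// mul1r; apply/idP/idP; lra.
by rewrite -Wc_sqr// expr_lt1 ?ltW.
Qed.

Lemma Wc_gt1 v : 0 < v < 1 -> (1 < Wc v) = (v < 2^-1).
Proof.
move=> v01; have /andP[v0 v1] := v01; have w0 := Wc_gt0 v01.
rewrite -[RHS](_ : (1 < (1 - v) / v) = _); last first.
  by rewrite ltr_pdivlMr// mul1r; apply/idP/idP; lra.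
by rewrite -Wc_sqr// expr_gt1 ?ltW.
Qed.

Lemma Wc_inj a b : 0 < a < 1 -> 0 < b < 1 -> a != b -> Wc a != Wc b.
Proof.
move=> ha hb; apply: contra => /eqP h; have := Wc_sqr ha; rewrite h Wc_sqr// => E.
have /andP[a0 _] := ha; have /andP[b0 _] := hb.
apply/eqP/invr_inj/(addIr (-1)).
have X (x : R) : 0 < x -> (1 - x) / x = x^-1 - 1 by move=> x0; field; rewrite gt_eqF.
by rewrite -!X.
Qed.

(* Away from the critical point the distance in the coordinate Wc expands by 1 + 1 / (ww'). *)
Lemma Wc_expand a b : 0 < a < 1 -> 0 < b < 1 -> (a < 2^-1 /\ b < 2^-1) \/ (2^-1 < a /\ 2^-1 < b) ->
  `|Wc (boole a) - Wc (boole b)| = `|Wc a - Wc b| * (1 + (Wc a * Wc b)^-1).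
Proof.
move=> ha hb side; have wa := Wc_gt0 ha; have wb := Wc_gt0 hb.
have [a2 b2] : a != 2^-1 /\ b != 2^-1 by case: side => -[h1 h2]; rewrite ?(lt_eqF h1) ?(lt_eqF h2) ?(gt_eqF h1) ?(gt_eqF h2).
rewrite !Wc_boole//.
have E : (Wc a - (Wc a)^-1) - (Wc b - (Wc b)^-1) = (Wc a - Wc b) * (1 + (Wc a * Wc b)^-1).
  by field; rewrite !gt_eqF.
have p : 0 <= 1 + (Wc a * Wc b)^-1 by rewrite addr_ge0// invr_ge0 mulr_ge0 ?ltW.
have S (x : R) : 0 < x -> x < 1 -> `|x - x^-1| = - (x - x^-1).
  move=> x0 x1; rewrite ler0_norm// subr_le0 (le_trans (ltW x1))// -invr1 lef_pV2 ?posrE// ltW//.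
have T (x : R) : 1 < x -> `|x - x^-1| = x - x^-1.
  move=> x1; rewrite ger0_norm// subr_ge0 (le_trans _ (ltW x1))// -invr1 lef_pV2 ?posrE// ?ltW//.
  exact: lt_trans x1.
case: side => -[h1 h2].
  by rewrite !T ?Wc_gt1// E normrM (ger0_norm p).
rewrite !S ?Wc_lt1// -opprD normrN.
by rewrite -[`|Wc a - Wc b| * _]/(_) -(ger0_norm p) -normrM -E.
Qed.

Section pair.
Variables a b : R.
Hypotheses (ha : 0 < a < 1) (hb : 0 < b < 1) (ab : a != b).
Let an n := iter n boole a.
Let bn n := iter n boole b.
Let dn n := `|Wc (an n) - Wc (bn n)|.
Let straddles n := Num.min (an n) (bn n) <= 2^-1 <= Num.max (an n) (bn n).

Let sideP n : ~~ straddles n -> (an n < 2^-1 /\ bn n < 2^-1) \/ (2^-1 < an n /\ 2^-1 < bn n).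
Proof.
rewrite /straddles ge_min le_max.
by have [] := leP (an n) 2^-1; have [] := leP (bn n) 2^-1; have [] := leP 2^-1 (an n);
  have [] := leP 2^-1 (bn n); auto; lra.
Qed.

Let step n : 0 < an n < 1 -> 0 < bn n < 1 -> ~~ straddles n ->
  [/\ 0 < an n.+1 < 1, 0 < bn n.+1 < 1 & dn n.+1 = dn n * (1 + (Wc (an n) * Wc (bn n))^-1)].
Proof.
move=> han hbn /sideP hs; rewrite /dn /an /bn !iterS -/(an n) -/(bn n).
have [a2 b2] : an n != 2^-1 /\ bn n != 2^-1.
  by case: hs => -[h1 h2]; rewrite ?(lt_eqF h1) ?(lt_eqF h2) ?(gt_eqF h1) ?(gt_eqF h2).
by rewrite !boole_gt0// !boole_lt1//; split => //; exact: Wc_expand.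
Qed.

Let before n : (forall m, (m < n)%N -> ~~ straddles m) ->
  [/\ 0 < an n < 1, 0 < bn n < 1 & forall m, (m <= n)%N -> dn m <= dn n].
Proof.
elim: n => [|n ih] h; first by split => // m; rewrite leqn0 => /eqP ->.
have [han hbn hd] := ih (fun m mn => h m (ltnW mn)).
have [ha' hb' hd'] := step han hbn (h n (ltnSn n)); split => // m.
rewrite leq_eqVlt => /orP[/eqP ->//|]; rewrite ltnS => /hd mn.
apply: (le_trans mn); rewrite hd' -[leLHS]mulr1 ler_wpM2l ?normr_ge0//.
by rewrite lerDl invr_ge0; apply: mulr_ge0; apply: ltW; exact: Wc_gt0.
Qed.

Let d0 : 0 < dn 0. Proof. by rewrite normr_gt0 subr_eq0; exact: Wc_inj. Qed.

(** As long as the pair stays on one side of the critical point 1/2, its distance in [Wc] does not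
    decrease, and at each visit above 1/2 it at least doubles, since there both [Wc] are below 1.
    But this also bounds the distance by 1 at such visits, and there are infinitely many of them. *)
Let straddles_ex : exists n, straddles n.
Proof.
apply: contrapT => h; have ns n : ~~ straddles n by apply/negP => hn; apply: h; exists n.
have B n := @before n (fun m _ => ns m).
have visit N : exists2 n, (N <= n)%N & 2^-1 < an n /\ 2^-1 < bn n.
  have [||n Nn hn] := @boole_recurrent R a _ _ N; first by case/andP: ha => /ltW -> /ltW.
    by move=> n; have [/andP[h1 _] _ _] := B n; rewrite gt_eqF.
  by exists n => //; case: (sideP (ns n)) => // -[]; rewrite ltNge hn.
have small n : 2^-1 < an n -> 2^-1 < bn n -> dn n < 1.
  have [h1 h2 _] := B n => h3 h4.
  have := Wc_gt0 h1; have := Wc_gt0 h2; rewrite -Wc_lt1// in h3; rewrite -Wc_lt1// in h4.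
  by move=> ? ?; rewrite ltr_norml; lra.
have grow k : exists n, [/\ 2^-1 < an n, 2^-1 < bn n & 2 ^+ k * dn 0 <= dn n].
  elim: k => [|k [n [h1 h2 h3]]].
    have [n _ [h1 h2]] := visit 0%N; exists n; split => //; rewrite mul1r.
    by have [_ _] := B n; apply.
  have [n' nn' [h1' h2']] := visit n.+1; exists n'; split => //.
  have [_ _ hd] := B n'; apply: le_trans (hd _ nn').
  have [e1 e2 _] := B n; have [_ _ ->] := step e1 e2 (ns n).
  rewrite exprS -mulrA mulrC ler_pM//; first by rewrite mulr_ge0 ?exprn_ge0// ltW.
  have w1 := Wc_gt0 e1; have w2 := Wc_gt0 e2.
  rewrite -Wc_lt1// in h1; rewrite -Wc_lt1// in h2.
  suff : 1 <= (Wc (an n) * Wc (bn n))^-1 by lra.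
  by rewrite invf_ge1 ?mulr_gt0// mulr_ile1 ?ltW.
have [k hk] : exists k, 1 <= 2 ^+ k * dn 0.
  exists (Num.trunc (dn 0)^-1).+1; rewrite -ler_pdivrMr// div1r.
  have := truncnS_gt (dn 0)^-1 => /ltW/le_trans; apply.
  by rewrite -natrX ler_nat ltnW// ltn_expl.
have [n [h1 h2 h3]] := grow k.
by have := small n h1 h2; lra.
Qed.

Lemma boole_straddles : exists n, [/\ 0 < an n < 1, 0 < bn n < 1, an n != bn n & straddles n].
Proof.
pose n := ex_minn straddles_ex; exists n.
have [hn hmin] : straddles n /\ forall m, straddles m -> (n <= m)%N by rewrite /n; case: ex_minnP.
have [|h1 h2 h3] := @before n.
  by move=> m mn; apply/negP => /hmin; rewrite leqNgt mn.
split => //; apply/eqP => E; have := h3 0%N isT; have := d0.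
by rewrite {3}/dn E subrr normr0; lra.
Qed.

End pair.

(** Some image contains an interval ending at the critical point 1/2; the next one contains an
    interval ending at 1, and the next one an interval starting at 0, to which [covers_from0]
    applies. *)
Lemma boole_onto a b : 0 <= a -> a < b -> b <= 1 -> exists n, covers n a b 0 1.
Proof.
move=> a0 ab b1.
(* The middle third keeps the endpoints inside ]0, 1[, where [Wc] is positive. *)
pose a' := (2 * a + b) / 3; pose b' := (a + 2 * b) / 3.
have [aa' [a'b' b'b]] : a < a' /\ a' < b' /\ b' < b by rewrite /a' /b'; lra.
have ha' : 0 < a' < 1 by apply/andP; split; lra.
have hb' : 0 < b' < 1 by apply/andP; split; lra.
have ne : a' != b' by rewrite lt_eqF.
have [n [h1 h2 h3 h4]] := boole_straddles ha' hb' ne.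
have c1 := @covers_ivt n a' b' (ltW a'b').
move: h1 h2 h3 h4 c1; set x := iter n boole a'; set y := iter n boole b' => h1 h2 h3 h4 c1.
(* One of the two endpoints may be 1/2 itself; z is the other one. *)
have [z [z01 z2 cz]] : exists z, [/\ 0 < z < 1, z != 2^-1 &
    covers n a' b' (Num.min z 2^-1) (Num.max z 2^-1)].
  move: h4; rewrite ge_min le_max => h4.
  have [x2|x2] := eqVneq x 2^-1.
    exists y; split => //; first by rewrite -x2 eq_sym.
    by apply: covers_sub c1 => //; rewrite x2 ?(minC y) ?(maxC y).
  exists x; split => //; apply: covers_sub c1 => //.
    rewrite le_min ge_min lexx /=; move: h4; rewrite ge_min.
    by case: (leP x y); lra.
  rewrite ge_max le_max lexx /=; move: h4; rewrite le_max.
  by case: (leP x y); lra.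
have c0 : 0 < boole z by exact: boole_gt0.
have c1' : boole z < 1 by exact: boole_lt1.
have cc : 0 < boole z < 1 by rewrite c0.
have cov1 : covers 1 (Num.min z 2^-1) (Num.max z 2^-1) (boole z) 1.
  have := @covers_ivt 1 (Num.min z 2^-1) (Num.max z 2^-1); rewrite /=.
  have [zh|hz] := leP z 2^-1.
    by move=> /(_ zh); rewrite boole_half min_l ?max_r// ltW.
  by move=> /(_ (ltW hz)); rewrite boole_half min_r ?max_l// ltW.
have cov2 : covers 1 (boole z) 1 0 (boole (boole z)).
  have := @covers_ivt 1 (boole z) 1 (ltW c1'); rewrite /= boole1.
  by rewrite min_r ?max_l// ltW// boole_gt0.
have [|m hm] := @covers_from0 (boole (boole z)).
  by rewrite boole_gt0//=; have /andP[] := @boole01 R (boole z) ltac:(by rewrite !ltW).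
exists (m + (1 + (1 + n)))%N.
apply: (@covers_sub _ a' b' a b 0 1) => //; [exact: ltW|exact: ltW|].
exact: covers_trans (covers_trans (covers_trans cz cov1) cov2) hm.
Qed.

End locally_eventually_onto.

(** * Cauchy laws under the Boole map *)

Section law.
Context {R : realType}.
Implicit Types (a t y K w : R) (B : set R).

Definition quadrant : set R := `[0, pi / 2[%classic.

(* For a uniform on the quadrant, y * tan a is half-Cauchy of scale y, and this is
   its coordinate 1 / (1 + x ^ 2). *)
Definition cauchy y a : R := cos a ^+ 2 / (cos a ^+ 2 + y ^+ 2 * sin a ^+ 2).

Lemma quadrant_itv a : quadrant a -> a \in `](- (pi / 2)), (pi / 2)[.
Proof.
rewrite /quadrant /= !in_itv /= => /andP[a0 ->]; rewrite andbT (lt_le_trans _ a0)//.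
by rewrite oppr_lt0 divr_gt0// pi_gt0.
Qed.

Lemma cos_quadrant a : quadrant a -> 0 < cos a.
Proof. by move=> /quadrant_itv; rewrite in_itv /=; exact: cos_gt0_pihalf. Qed.

Lemma tan_quadrant a : quadrant a -> 0 <= tan a.
Proof.
move=> qa; have c0 := cos_quadrant qa; rewrite /tan divr_ge0 ?(ltW c0)// sin_ge0_pi//.
move: qa; rewrite /quadrant /= in_itv /= => /andP[-> h] /=.
by rewrite (le_trans (ltW h))// ler_pdivrMr// ler_peMr ?pi_ge0// ler1n.
Qed.

Lemma cauchy_den_gt0 y a : 0 < y -> 0 < cos a ^+ 2 + y ^+ 2 * sin a ^+ 2.
Proof.
move=> y0; have := cos2Dsin2 a; have y2 : 0 < y ^+ 2 by rewrite exprn_gt0.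
have [-> |c0 _] := eqVneq (cos a) 0.
  by rewrite expr0n /= !add0r => ->; rewrite mulr1.
have c2 : 0 < cos a ^+ 2 by rewrite exprn_even_gt0.
by rewrite (lt_le_trans c2)// lerDl mulr_ge0 ?sqr_ge0.
Qed.

Lemma continuous_cauchy y : 0 < y -> continuous (cauchy y).
Proof.
move=> y0 a.
have csq (f : R -> R) : continuous f -> continuous (fun x => f x ^+ 2).
  move=> cf x; apply: (@continuous_comp _ _ _ f (fun z : R => z ^+ 2)); first exact: cf.
  exact: exprn_continuous.
apply: cvgM; first exact: (csq cos (@continuous_cos R)).
apply: cvgV; first by rewrite gt_eqF// cauchy_den_gt0.
apply: cvgD; first exact: (csq cos (@continuous_cos R)).
by apply: cvgM; [exact: cvg_cst|exact: (csq sin (@continuous_sin R))].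
Qed.

Lemma cauchyE y a : quadrant a -> cauchy y a = (1 + (y * tan a) ^+ 2)^-1.
Proof.
move=> qa; have c0 := cos_quadrant qa; rewrite /cauchy /tan.
have h : 0 < cos a ^+ 2 + y ^+ 2 * sin a ^+ 2.
  by rewrite ltr_pwDl ?exprn_gt0// mulr_ge0 ?sqr_ge0.
have h2 : 0 < 1 + (y * (sin a / cos a)) ^+ 2 by rewrite ltr_pwDl// sqr_ge0.
by field; rewrite !gt_eqF//= (_ : _ + _ = cos a ^+ 2 + y ^+ 2 * sin a ^+ 2)//; ring.
Qed.

Lemma cauchy_gt0 y a : quadrant a -> 0 < cauchy y a.
Proof. by move=> qa; rewrite cauchyE// invr_gt0 ltr_pwDl// sqr_ge0. Qed.

Lemma cauchy_le1 y a : quadrant a -> cauchy y a <= 1.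
Proof. by move=> qa; rewrite cauchyE// invf_le1 ?ltr_pwDl ?sqr_ge0// lerDl sqr_ge0. Qed.

Lemma tan_le_atan a w : quadrant a -> (tan a <= w) = (a <= atan w).
Proof. by move=> /quadrant_itv qa; rewrite -{2}(tanK qa) (le_mono (@lt_atan R)). Qed.

Lemma tan_ge_atan a w : quadrant a -> (w <= tan a) = (atan w <= a).
Proof. by move=> /quadrant_itv qa; rewrite -{2}(tanK qa) (le_mono (@lt_atan R)). Qed.

(** The x >= 0 with 1 / (1 + x ^ 2) = t: the ray of values at least t is |x| <= [radius t]. *)
Definition radius t : R := Num.sqrt (t^-1 - 1).

Lemma radius_ge0 t : 0 <= radius t. Proof. exact: sqrtr_ge0. Qed.

Lemma radius_sqr t : 0 < t <= 1 -> radius t ^+ 2 = t^-1 - 1.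
Proof. by move=> /andP[t0 t1]; rewrite sqr_sqrtr// subr_ge0 invf_ge1. Qed.

Lemma le_cauchy t y a : 0 < t <= 1 -> 0 < y -> quadrant a ->
  (t <= cauchy y a) = (a <= atan (radius t / y)).
Proof.
move=> ht y0 qa; have /andP[t0 t1] := ht.
rewrite -tan_le_atan// [in RHS]ler_pdivlMr// cauchyE//.
rewrite -[t in LHS]invrK lef_pV2 ?posrE ?invr_gt0 ?ltr_pwDl ?sqr_ge0//.
have w0 : 0 <= y * tan a by apply: mulr_ge0; [exact: ltW|exact: tan_quadrant].
by rewrite -lerBrDl -radius_sqr// ler_sqr ?nnegrE ?radius_ge0// mulrC.
Qed.

(* For e = 1, -1 the solutions w > 0 of |w - 1/w| = K. *)
Definition branch (e : R) K : R := (e * K + Num.sqrt (K ^+ 2 + 4)) / 2.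

Lemma branch_gt0 e K : e * e = 1 -> 0 <= K -> 0 < branch e K.
Proof.
move=> ee K0; rewrite divr_gt0//.
have h : `|K| < Num.sqrt (K ^+ 2 + 4).
  by rewrite -sqrtr_sqr ltr_sqrt ?ltrDl// ltr_wpDl// sqr_ge0.
have : `|e * K| = `|K|.
  by rewrite -[LHS]sqrtr_sqr exprMn expr2 ee mul1r sqrtr_sqr.
move: h; set S := Num.sqrt _ => h E; move: h; rewrite -E ltr_norml; lra.
Qed.

Lemma branchM K : branch 1 K * branch (-1) K = 1.
Proof.
have h : Num.sqrt (K ^+ 2 + 4) ^+ 2 = K ^+ 2 + 4 by rewrite sqr_sqrtr// addr_ge0// sqr_ge0.
rewrite /branch; move: h; set S := Num.sqrt _ => h.
have -> : (1 * K + S) / 2 * ((-1 * K + S) / 2) = (S ^+ 2 - K ^+ 2) / 4 by field.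
by rewrite h; field.
Qed.

Lemma branchB K : branch 1 K - branch (-1) K = K.
Proof. by rewrite /branch; field. Qed.

(** With w = y * tan a, the condition is |w - 1/w| <= [radius t], that is, w lies between the two
    branches. *)
Lemma le_boole_cauchy t y a : 0 < t <= 1 -> 0 < y -> quadrant a ->
  (t <= boole (cauchy y a)) =
  (atan (branch (-1) (radius t) / y) <= a <= atan (branch 1 (radius t) / y)).
Proof.
move=> ht y0 qa; have /andP[t0 t1] := ht.
have -> : (atan (branch (-1) (radius t) / y) <= a <= atan (branch 1 (radius t) / y)) =
    (branch (-1) (radius t) <= y * tan a <= branch 1 (radius t)).
  congr (_ && _); first by rewrite -tan_ge_atan// [LHS]ler_pdivrMr// mulrC.
  by rewrite -tan_le_atan// [LHS]ler_pdivlMr// mulrC.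
have w0 : 0 <= y * tan a by apply: mulr_ge0; [exact: ltW|exact: tan_quadrant].
rewrite cauchyE//; move: (y * tan a) w0 => w w0.
have p0 := @branch_gt0 1 (radius t) (mulr1 1) (radius_ge0 t).
have q0 := @branch_gt0 (-1) (radius t) (etrans (mulrNN 1 1) (mulr1 1)) (radius_ge0 t).
have pq := branchM (radius t); have pmq := branchB (radius t).
move: p0 q0 pq pmq; set p := branch 1 _; set q := branch (-1) _ => p0 q0 pq pmq.
have K2 := radius_sqr ht.
have gE : boole (1 + w ^+ 2)^-1 = w ^+ 2 / (w ^+ 2 + (w ^+ 2 - 1) ^+ 2).
  have n1 : 1 + w ^+ 2 != 0 by rewrite gt_eqF// ltr_pwDl// sqr_ge0.
  have := booleD_neq0 (1 + w ^+ 2)^-1; rewrite /boole /booleD.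
  set u := w ^+ 2 in n1 *.
  have -> : 1 - 3 * ((1 + u)^-1 * (1 - (1 + u)^-1)) = (u + (u - 1) ^+ 2) / (1 + u) ^+ 2 by field.
  move=> n2; have n3 : u + (u - 1) ^+ 2 != 0 by apply: contra n2 => /eqP ->; rewrite mul0r.
  by field; rewrite n1 n3.
have den0 : 0 < w ^+ 2 + (w ^+ 2 - 1) ^+ 2.
  have [->|w2] := eqVneq w 0; first by rewrite expr0n /= add0r sub0r sqrrN expr1n.
  by rewrite ltr_pwDl ?exprn_even_gt0// sqr_ge0.
(* The sign is that of (p - w) * (w - q), the other factors being positive; p * q = 1 and p - q =
   [radius t] give the coefficients. *)
have factor : w ^+ 2 - t * (w ^+ 2 + (w ^+ 2 - 1) ^+ 2) = t * (((p - w) * (w + q)) * ((w - q) * (w + p))).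
  have -> : (p - w) * (w + q) = 1 + radius t * w - w ^+ 2.
    by rewrite -pmq -pq; ring.
  have -> : (w - q) * (w + p) = w ^+ 2 + radius t * w - 1.
    by rewrite -pmq; move: pq => /= pq; nra.
  have -> : (1 + radius t * w - w ^+ 2) * (w ^+ 2 + radius t * w - 1) =
      radius t ^+ 2 * w ^+ 2 - (w ^+ 2 - 1) ^+ 2 by ring.
  by rewrite K2; field; rewrite gt_eqF.
rewrite gE ler_pdivlMr// -subr_ge0 factor pmulr_rge0//.
have wq : 0 < w + q by rewrite ltr_wpDl.
have wp : 0 < w + p by rewrite ltr_wpDl.
have -> : (p - w) * (w + q) * ((w - q) * (w + p)) = ((w + q) * (w + p)) * ((p - w) * (w - q)) by ring.
rewrite pmulr_rge0 ?mulr_gt0//.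
have qp : q <= p by rewrite -subr_ge0 pmq radius_ge0.
apply/idP/andP => [h|[h1 h2]]; last by rewrite mulr_ge0 ?subr_ge0.
have [h1|h1] := leP q w; have [h2|h2] := leP w p => //; nra.
Qed.

(** The scale y + 1/y comes from here: by the addition formula, with p * q = 1 and p - q =
    [radius t], the tangent of the difference is ([radius t] / y) / (1 + 1 / y ^ 2). *)
Lemma atan_branches y t : 0 < y ->
  atan (branch 1 (radius t) / y) - atan (branch (-1) (radius t) / y) = atan (radius t / (y + y^-1)).
Proof.
move=> y0.
have p0 := @branch_gt0 1 (radius t) (mulr1 1) (radius_ge0 t).
have q0 := @branch_gt0 (-1) (radius t) (etrans (mulrNN 1 1) (mulr1 1)) (radius_ge0 t).
have pq := branchM (radius t); have pmq := branchB (radius t).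
move: p0 q0 pq pmq; set p := branch 1 _; set q := branch (-1) _ => p0 q0 pq pmq.
have range (z : R) : 0 < z -> quadrant (atan z).
  by move=> z0; rewrite /quadrant /= in_itv /= atan_ltpi2 andbT -(atan0 R) le_atan// ltW.
have pr := range _ (divr_gt0 p0 y0); have qr := range _ (divr_gt0 q0 y0).
have cp := cos_quadrant pr; have cq := cos_quadrant qr.
rewrite -[LHS]tanK.
  congr atan; rewrite tanD ?cosN ?gt_eqF// tanN !atanK.
  have -> : 1 - p / y * - (q / y) = 1 + 1 / y ^+ 2 by rewrite -pq; field; rewrite gt_eqF.
  have -> : p / y + - (q / y) = radius t / y by rewrite -pmq; field; rewrite gt_eqF.
  have y2 : 0 < y ^+ 2 + 1 by rewrite ltr_pwDl ?exprn_gt0.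
  by field; rewrite !gt_eqF.
move: pr qr; rewrite /quadrant /= !in_itv /= => /andP[? ?] /andP[? ?].
by apply/andP; split; lra.
Qed.

End law.

Section law.
Context {R : realType}.
Implicit Types (a t w y z : R) (B : set R).

Lemma measurable_quadrant : measurable (quadrant : set R).
Proof. exact: measurable_itv. Qed.

Lemma eq_measure_rays (m1 m2 : {measure set (measurableTypeR R) -> \bar R}) :
  (m1 setT < +oo)%E -> (forall t, m1 `[t, +oo[%classic = m2 `[t, +oo[%classic) ->
  forall B : set (measurableTypeR R), measurable B -> m1 B = m2 B.
Proof.
move=> m1oo m12 B.
refine (@measure_unique _ R (measurableTypeR R) (@RGenCInfty.G R) (fun k => `[- k%:R, +oo[%classic : set R) _ _ _ _ m1 m2 _ _ _).
- exact: RGenCInfty.measurableE.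
- move=> _ _ [s ->] [t ->]; exists (Num.max s t); apply/seteqP; split => x /=.
    by rewrite !in_itv /= !andbT ge_max => -[-> ->].
  by rewrite !in_itv /= !andbT ge_max => /andP.
- by move=> k; exists (- k%:R).
- apply/seteqP; split => // x _; exists (Num.bound `|x|) => //=.
  rewrite in_itv /= andbT lerNl ltW// (le_lt_trans (ler_norm _))// normrN.
  exact: archi_boundP.
- by move=> _ [t ->].
- move=> k; apply: le_lt_trans m1oo; apply: le_measure; rewrite ?inE//.
Qed.

(** Half-Cauchy law of scale y, unnormalised: its total mass is pi / 2. *)
Definition law y B := @lebesgue_measure R (quadrant `&` cauchy y @^-1` B).

Lemma law_comp (phi psi : R -> R) : continuous phi -> continuous psi ->
  (forall t, lebesgue_measure (quadrant `&` [set a | t <= phi a]) =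
             lebesgue_measure (quadrant `&` [set a | t <= psi a])) ->
  forall B, measurable B ->
  lebesgue_measure (quadrant `&` phi @^-1` B) = lebesgue_measure (quadrant `&` psi @^-1` B).
Proof.
move=> cphi cpsi h B mB.
have mphi : measurable_fun (setT : set (measurableTypeR R)) (phi : _ -> measurableTypeR R).
  exact: continuous_measurable_fun.
have mpsi : measurable_fun (setT : set (measurableTypeR R)) (psi : _ -> measurableTypeR R).
  exact: continuous_measurable_fun.
pose mu := mrestr (@lebesgue_measure R) measurable_quadrant.
have E (f : R -> R) A : lebesgue_measure (quadrant `&` f @^-1` A) = pushforward mu f A.
  by rewrite /pushforward /= /mrestr setIC.
rewrite !E; apply: (@eq_measure_rays (measure_function_pushforward__canonical__measure_function_Measure mu mphi)
  (measure_function_pushforward__canonical__measure_function_Measure mu mpsi)) mB => /=.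
  rewrite /pushforward /mu /mrestr; apply: (@le_lt_trans _ _ (lebesgue_measure quadrant)).
    by apply: lebesgue_le; exact: subIsetr.
  by rewrite lebesgue_measure_itv /=; case: ifP => _; rewrite ?ltry// -EFinD ltry.
have ray (f : R -> R) t : f @^-1` `[t, +oo[%classic = [set a | t <= f a].
  by apply/seteqP; split => x /=; rewrite in_itv /= andbT.
by move=> t; have := h t; rewrite -!ray !E.
Qed.

Lemma quadrant_atan w : 0 <= w -> quadrant (atan w).
Proof.
by move=> w0; rewrite /quadrant /= in_itv /= atan_ltpi2 andbT -(atan0 R) (le_mono (@lt_atan R)).
Qed.

Lemma law_ray y t : 0 < y -> 0 < t <= 1 ->
  law y `[t, +oo[%classic = (atan (radius t / y))%:E.
Proof.
move=> y0 ht; have r0 : 0 <= radius t / y by rewrite divr_ge0 ?radius_ge0// ltW.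
have := quadrant_atan r0; rewrite /quadrant /= in_itv /= => /andP[h1 h2].
have -> : law y `[t, +oo[%classic = lebesgue_measure `[0, atan (radius t / y)]%classic.
  congr lebesgue_measure; apply/seteqP; split => [a [qa] /=|a /=].
    rewrite !in_itv /= andbT le_cauchy// => ->; rewrite andbT.
    by move: qa; rewrite /quadrant /= in_itv => /andP[].
  rewrite in_itv /= => /andP[a0 ar]; have qa : quadrant a.
    by rewrite /quadrant /= in_itv /= a0 (le_lt_trans ar).
  by split => //=; rewrite in_itv /= andbT le_cauchy.
rewrite lebesgue_measure_itv /= lte_fin; case: ltP => h3; first by rewrite sube0.
by congr EFin; apply/eqP; rewrite eq_le h1 h3.
Qed.

Lemma law_boole_ray y t : 0 < y -> 0 < t <= 1 ->
  law y (boole @^-1` `[t, +oo[%classic) = (atan (radius t / (y + y^-1)))%:E.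
Proof.
move=> y0 ht; rewrite -atan_branches//.
have q0 : 0 < branch (-1) (radius t) / y.
  by rewrite divr_gt0// branch_gt0 ?radius_ge0// mulrNN mulr1.
have p0 : 0 < branch 1 (radius t) / y by rewrite divr_gt0// branch_gt0 ?radius_ge0// mulr1.
have := quadrant_atan (ltW p0); rewrite /quadrant /= in_itv /= => /andP[_ p1].
have := quadrant_atan (ltW q0); rewrite /quadrant /= in_itv /= => /andP[q1 _].
set p := atan _ in p1 *; set q := atan _ in q1 *.
have -> : law y (boole @^-1` `[t, +oo[%classic) = lebesgue_measure `[q, p]%classic.
  congr lebesgue_measure; apply/seteqP; split => [a [qa] /=|a /=].
    by rewrite !in_itv /= andbT le_boole_cauchy.
  rewrite in_itv /= => /andP[aq ap]; have qa : quadrant a.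
    by rewrite /quadrant /= in_itv /= (le_trans q1)//= (le_lt_trans ap).
  by split => //=; rewrite in_itv /= andbT le_boole_cauchy// aq.
have qp : q <= p.
  rewrite (le_mono (@lt_atan R)) ler_pM2r ?invr_gt0// -subr_ge0 branchB; exact: radius_ge0.
rewrite lebesgue_measure_itv /= lte_fin; case: ltP => h3; first by rewrite -EFinB.
by congr EFin; apply/esym/eqP; rewrite subr_eq0 eq_le qp h3.
Qed.

Lemma law_boole y B : 0 < y -> measurable B -> law y (boole @^-1` B) = law (y + y^-1) B.
Proof.
move=> y0 mB; have y1 : 0 < y + y^-1 by rewrite addr_gt0 ?invr_gt0.
have ray z t : quadrant `&` [set a | t <= cauchy z a] = quadrant `&` cauchy z @^-1` `[t, +oo[%classic.
  by congr (_ `&` _); apply/seteqP; split => a /=; rewrite in_itv /= andbT.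
apply: (@law_comp (boole \o cauchy y)) => //.
- by move=> a; apply: continuous_comp; [exact: continuous_cauchy|exact: continuous_boole].
- exact: continuous_cauchy.
(* On the quadrant both maps take values in [0, 1], so rays with t <= 0 are full and those with t >
   1 empty; the others are treated by [law_boole_ray]. *)
move=> t; have [t0|t0] := leP t 0.
  have pos z : 0 < z -> forall a, 0 <= cauchy z a <= 1.
    move=> z0 a; have h := cauchy_den_gt0 a z0; apply/andP; split.
      by rewrite divr_ge0 ?sqr_ge0// ltW.
    by rewrite ler_pdivrMr// mul1r lerDl mulr_ge0 ?sqr_ge0.
  congr (lebesgue_measure (_ `&` _)); apply/seteqP; split => a _ /=.
    by have /andP[h _] := pos _ y1 a; exact: le_trans h.
  by have /andP[h _] := boole01 (pos _ y0 a); exact: le_trans h.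
have [t1|t1] := ltP 1 t; last first.
  have ht : 0 < t <= 1 by rewrite t0.
  rewrite ray -/(law _ _) law_ray// -law_boole_ray//.
  by congr (lebesgue_measure (_ `&` _)); apply/seteqP; split => a /=; rewrite in_itv /= andbT.
congr lebesgue_measure; apply/seteqP; split => a [qa] /=.
  have /andP[_ h] : 0 <= boole (cauchy y a) <= 1.
    by apply: boole01; rewrite (ltW (cauchy_gt0 _ qa)) cauchy_le1.
  by move=> /(lt_le_trans t1); rewrite ltNge h.
by move=> /(lt_le_trans t1); rewrite ltNge cauchy_le1.
Qed.

Definition drift y : R := y + y^-1.

Lemma drift_gt0 n y : 0 < y -> 0 < iter n drift y.
Proof. by move=> y0; elim: n => //= n ih; rewrite addr_gt0 ?invr_gt0. Qed.

Lemma measurable_boole_preimage n B : measurable B -> measurable (iter n boole @^-1` B).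
Proof.
move=> mB; rewrite -[X in measurable X]setTI.
have mf : measurable_fun (setT : set (measurableTypeR R)) (iter n boole : _ -> measurableTypeR R).
  by have c := @continuous_iter_boole R n; exact: continuous_measurable_fun.
exact: mf.
Qed.

Lemma law_iter_boole n y B : 0 < y -> measurable B ->
  law y (iter n boole @^-1` B) = law (iter n drift y) B.
Proof.
move=> y0; elim: n B => // n ih B mB.
transitivity (law (iter n drift y) (boole @^-1` B)); last by rewrite law_boole ?drift_gt0.
by apply: ih; exact: (@measurable_boole_preimage 1).
Qed.

Lemma atan_le w : 0 <= w -> atan w <= w.
Proof.
move=> w0; have := @mean_value_bound R atan (fun x => (1 + x ^+ 2)^-1) 0 w 1.
move=> /(_ _ _ w 0); rewrite atan0 !subr0 mul1r !lexx w0 /= => h.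
rewrite (le_trans (ler_norm _))// -[leRHS]ger0_norm//; apply: h => // x _.
by rewrite ger0_norm ?invr_ge0 ?addr_ge0 ?sqr_ge0// invf_le1 ?ltr_pwDl ?sqr_ge0// lerDl sqr_ge0.
Qed.

Lemma law_ray_le y t : 0 < y -> 0 < t <= 1 ->
  (law y `[t, +oo[%classic <= (radius t / y)%:E)%E.
Proof.
by move=> y0 ht; rewrite law_ray// lee_fin atan_le// divr_ge0 ?radius_ge0// ltW.
Qed.

(** The map a |-> atan (y * tan a) carries the set of angles for scale y onto the one for scale 1,
    and its derivative y / (cos a ^ 2 + y ^ 2 * sin a ^ 2) is at most y because y >= 1. *)
Lemma law1_le y B : 1 <= y -> (law 1 B <= y%:E * law y B)%E.
Proof.
move=> y1; have y0 : 0 < y by apply: lt_le_trans y1.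
pose phi a := atan (y * tan a).
have sub : quadrant `&` cauchy 1 @^-1` B `<=` phi @` (quadrant `&` cauchy y @^-1` B).
  move=> a [qa Ba]; exists (atan (tan a / y)).
    have q : quadrant (atan (tan a / y)) by apply: quadrant_atan; rewrite divr_ge0 ?(tan_quadrant qa)// ltW.
    split => //=; rewrite cauchyE// atanK mulrC divfK ?gt_eqF// -[tan a]mul1r -cauchyE//.
  by rewrite /phi atanK mulrC divfK ?gt_eqF// tanK// quadrant_itv.
apply: (le_trans (lebesgue_le sub)); apply: lebesgue_lipschitz_image => // a b [qa _] [qb _].
have qm : quadrant (Num.max a b) by case: (leP a b).
apply: (@mean_value_bound R phi (fun a => y / (cos a ^+ 2 + y ^+ 2 * sin a ^+ 2)) 0 (Num.max a b)) => //.
- move=> x /andP[x0 xm]; have qx : quadrant x.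
    move: qm; rewrite /quadrant /= !in_itv /= x0 => /andP[_]; exact: le_lt_trans.
  have c0 := cos_quadrant qx; have d0 := cauchy_den_gt0 x y0.
  have dt : is_derive x (1 : R) tan (cos x ^- 2) by apply: is_derive_tan; rewrite gt_eqF.
  have dm : is_derive x (1 : R) (fun a => y * tan a) (y * cos x ^- 2).
    by apply: is_derive_eq; rewrite /GRing.scale /=; ring.
  have da : is_derive (y * tan x) (1 : R) atan (1 + (y * tan x) ^+ 2)^-1 by apply: is_derive1_atan.
  have dc := @is_derive1_comp _ _ (fun a => y * tan a) _ _ _ da dm.
  apply: (is_derive_eq dc).
  have := @cauchyE R y x qx; have := cauchy_gt0 y qx; rewrite /cauchy => cy0 <-.
  by rewrite /GRing.scale /=; field; rewrite exprMn !gt_eqF.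
- move=> x _; have d0 := cauchy_den_gt0 x y0; rewrite ger0_norm ?divr_ge0 ?(ltW y0) ?(ltW d0)//.
  rewrite ler_pdivrMr// ler_peMr ?(ltW y0)// -(cos2Dsin2 x) lerD2l ler_peMl ?sqr_ge0//.
  by rewrite expr_ge1// ltW.
- by rewrite le_max lexx /=; move: qa; rewrite /quadrant /= in_itv /= => /andP[->].
- by rewrite le_max lexx orbT andbT; move: qb; rewrite /quadrant /= in_itv /= => /andP[->].
Qed.

Definition scale n : R := iter n drift 1.

Lemma scale_gt0 n : 0 < scale n. Proof. exact: drift_gt0. Qed.

Lemma scaleS n : scale n.+1 = scale n + (scale n)^-1. Proof. by []. Qed.

Lemma scale_mono m n : (m <= n)%N -> scale m <= scale n.
Proof.
move=> /subnK <-; elim: (n - m)%N => // k ih; rewrite addSn scaleS (le_trans ih)// lerDl.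
by rewrite invr_ge0 ltW// scale_gt0.
Qed.

Lemma scale_ge1 n : 1 <= scale n. Proof. exact: (@scale_mono 0). Qed.

(** Telescoping: the inverse of a scale is the increment to the next one. *)
Lemma sum_invr_scale n : \sum_(j < n) (scale j)^-1 = scale n - 1.
Proof.
elim: n => [|n ih]; first by rewrite big_ord0 subrr.
by rewrite big_ord_recr ih scaleS /=; ring.
Qed.

(** The square grows by 2 plus the inverse square, hence by at most 3. *)
Lemma scale_sqr n : scale n ^+ 2 <= 3 * n%:R + 1.
Proof.
elim: n => [|n ih]; first by rewrite expr1n mulr0 add0r.
have h0 := scale_gt0 n; have -> : scale n.+1 ^+ 2 = scale n ^+ 2 + 2 + (scale n)^-1 ^+ 2.
  by rewrite scaleS; field; rewrite gt_eqF.
have : (scale n)^-1 ^+ 2 <= 1 by rewrite expr_le1 ?invr_ge0 ?invf_le1 ?scale_ge1 ?ltW.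
by rewrite -natr1; lra.
Qed.

End law.

(** * Frequency of visits away from 0 *)

Section count_markov.
Context d (T : measurableType d) (R : realType) (mu : {measure set T -> \bar R}).
Variables (A : nat -> set T).
Hypothesis mA : forall n, measurable (A n).
Local Open Scope ereal_scope.

Lemma count_markov N c :
  c%:R%:E * mu [set a | (c <= cnt [set n | A n a] 0 N)%N] <= \sum_(n < N) mu (A n).
Proof.
have [->|c0] := posnP c; first by rewrite mul0e sume_ge0.
pose g (a : T) : R := (\sum_(n < N) \1_(A n) a)%R.
have gE a : g a = (cnt [set n | A n a] 0 N)%:R.
  rewrite cntE natr_sum /g; apply: eq_bigr => i _; rewrite indicE add0n.
  by congr (nat_of_bool _)%:R; apply/idP/asboolP; rewrite inE.
have mg : measurable_fun setT (EFin \o g).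
  by apply/measurable_EFinP/measurable_sum => n; exact: measurable_indic.
have c1 : (0 < c%:R :> R)%R by rewrite ltr0n.
have h := @le_integral_comp_abse _ _ _ mu _ measurableT (EFin \o g) c%:R id (@measurable_id _ _ _)
  (fun _ => id) (fun _ _ _ _ => id) mg c1.
have gN a : `|(EFin \o g) a| = (g a)%:E by rewrite /= gE normr_nat.
have setE : [set a | (c <= cnt [set n | A n a] 0 N)%N] = [set x | c%:R%:E <= `|(EFin \o g) x|].
  by apply/seteqP; split => a /=; rewrite gE normr_nat lee_fin ler_nat.
rewrite setE; move: h; rewrite setTI.
move=> /le_trans; apply; under eq_integral => a _ do rewrite gN -sumEFin.
rewrite ge0_integral_sum//.
by apply: lee_sum => n _; rewrite integral_indic// setIT.
by move=> n; apply/measurable_EFinP; exact: measurable_indic.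
Qed.

Lemma count_markov_frac N k q :
  k%:R%:E * mu [set a | (k <= q * cnt [set n | A n a] 0 N)%N] <= q%:R%:E * \sum_(n < N) mu (A n).
Proof.
have [->|k0] := posnP k; first by rewrite mul0e mule_ge0// sume_ge0.
have [->|q0] := posnP q.
  rewrite (_ : [set a | _] = set0) ?measure0 ?mule0 ?mul0e//.
  by apply/seteqP; split => a //=; rewrite mul0n leqNgt k0.
(* The quotient k / q rounded up. *)
pose c := ((k + q.-1) %/ q)%N.
have ck : (k <= q * c)%N by have := ltn_ceil (k + q.-1) q0; rewrite -/c; lia.
apply: (le_trans _ (@lee_wpmul2l R q%:R%:E _ _ _ (count_markov N c))); last by rewrite lee_fin.
rewrite muleA -EFinM -natrM (_ : [set a | (k <= _)%N] = [set a | (c <= cnt [set n | A n a] 0 N)%N]).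
  by apply: lee_wpmul2r => //; rewrite lee_fin ler_nat.
apply/seteqP; split => a /=; set m := cnt _ _ _ => h.
  by rewrite -ltnS ltn_divLR//; lia.
by rewrite (leq_trans ck)// leq_mul2l h orbT.
Qed.

End count_markov.

Section zero_frequency.
Context {R : realType}.
Implicit Types (v y t : R) (B W : set R).

Lemma measurable_law_set n B : measurable B ->
  measurable (quadrant `&` cauchy 1 @^-1` (iter n boole @^-1` B)).
Proof.
move=> mB; apply: measurableI; first exact: measurable_quadrant.
rewrite -[X in measurable X]setTI.
have mf : measurable_fun (setT : set (measurableTypeR R)) (cauchy 1 : _ -> measurableTypeR R).
  by have c := @continuous_cauchy R 1 ltr01; exact: continuous_measurable_fun.
by apply: mf => //; exact: measurable_boole_preimage.
Qed.

Lemma cauchy_onto v : 0 < v <= 1 -> exists2 a, quadrant a & cauchy 1 a = v.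
Proof.
move=> v01; exists (atan (radius v)); first exact/quadrant_atan/radius_ge0.
by rewrite cauchyE ?mul1r ?atanK ?radius_sqr ?subrKC ?invrK//; exact/quadrant_atan/radius_ge0.
Qed.

Lemma cauchy1_lipschitz a b : `|cauchy 1 a - cauchy 1 b| <= 2 * `|a - b| :> R.
Proof.
have E c : cauchy 1 c = cos c ^+ 2 :> R by rewrite /cauchy expr1n mul1r cos2Dsin2 divr1.
rewrite !E subr_sqr normrM mulrC ler_pM//.
  have h x : `|cos x| <= 1 :> R by rewrite ler_norml cos_geN1 cos_le1.
  by rewrite (le_trans (ler_normD _ _))// (_ : 2 = 1 + 1)// lerD.
rewrite -[leRHS]mul1r; apply: (@mean_value_bound R cos (fun x => - sin x) (Num.min a b) (Num.max a b)).
- by move=> x _; rewrite normrN ler_norml sin_geN1 sin_le1.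
- by rewrite ge_min lexx le_max lexx.
- by rewrite ge_min le_max !lexx !orbT.
Qed.

(** [cauchy 1] is cos ^ 2, a Lipschitz map of the quadrant onto ]0, 1]; only the point 0 has to be
    added. *)
Lemma law_null B : law 1 B = 0%E ->
  (@lebesgue_measure R).-negligible (B `&` [set v | 0 <= v <= 1]).
Proof.
move=> B0; apply: (@null_subset _ _ ([set 0] `|` cauchy 1 @` (quadrant `&` cauchy 1 @^-1` B))).
  move=> v [Bv /andP[v0 v1]]; have [->|vn] := eqVneq v 0; [by left|right].
  have [|a qa va] := @cauchy_onto v; first by rewrite lt_def vn v0 v1.
  by exists a; rewrite //= va.
apply: null_setU; first by apply/negligible_lebesgue; rewrite lebesgue_measure_set1.
apply: (@negligible_lipschitz_image _ 2) => //; last by apply/negligible_lebesgue.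
by move=> a b _ _; exact: cauchy1_lipschitz.
Qed.

Lemma law_iter n B : measurable B ->
  lebesgue_measure (quadrant `&` cauchy 1 @^-1` (iter n boole @^-1` B)) = law (scale n) B.
Proof. by move=> mB; exact: law_iter_boole. Qed.

Definition often t l q : set R := [set v | (4 ^ l <= q * cnt [set n | t <= iter n boole v]%R 0 (4 ^ l))%N].

(** The integral of the number of visits above t before time N is at most [radius t] times the sum
    of the inverse scales, so of order sqrt N. At N = 4 ^ l, Markov's inequality gives a bound of
    order 2 ^ (- l), summable over l. *)
Lemma law_often t l q : 0 < t <= 1 ->
  (law 1 (often t l q) <= (2 * radius t * q%:R * 2^-1 ^+ l)%:E)%E.
Proof.
move=> ht.
pose A n := quadrant `&` cauchy 1 @^-1` (iter n boole @^-1` `[t, +oo[%classic).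
have mA n : measurable (A n) by apply: measurable_law_set; exact: measurable_itv.
have lA n : (lebesgue_measure (A n) <= (radius t / scale n)%:E)%E.
  by rewrite /A law_iter; [exact: law_ray_le (scale_gt0 _) ht|exact: measurable_itv].
have h := @count_markov_frac _ _ R (@lebesgue_measure R) A mA (4 ^ l) (4 ^ l) q.
have p0 : (0 < (4 ^ l)%:R :> R)%R by rewrite ltr0n expn_gt0.
have sub : quadrant `&` cauchy 1 @^-1` often t l q `<=`
    [set a | (4 ^ l <= q * cnt [set n | A n a] 0 (4 ^ l))%N].
  move=> a [qa /= ha]; apply: (leq_trans ha); rewrite leq_mul2l cnt_mono ?orbT// => n /= tn.
  by split => //=; rewrite in_itv /= andbT.
apply: (le_trans (lebesgue_le sub)).
rewrite -(@lee_pmul2l R (4 ^ l)%:R%:E) ?lte_fin//; apply: (le_trans h).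
apply: (@le_trans _ _ (q%:R%:E * (radius t * scale (4 ^ l))%:E)%E).
  apply: lee_wpmul2l; first by rewrite lee_fin.
  apply: (@le_trans _ _ (\sum_(n < 4 ^ l) (radius t / scale n)%:E)%E).
    by apply: lee_sum => n _; exact: lA.
  rewrite sumEFin lee_fin -big_distrr /= sum_invr_scale ler_wpM2l ?radius_ge0//; lra.
have s2 : scale (4 ^ l) <= 2 * 2 ^+ l :> R.
  rewrite -(ler_pXn2r (ltn0Sn 1)) ?nnegrE ?mulr_ge0 ?exprn_ge0 ?(ltW (scale_gt0 _))//.
  rewrite (le_trans (scale_sqr _))// exprMn -exprM mulnC exprM (_ : 2 ^+ 2 = 4%:R)//; last by rewrite expr2; lra.
  have : (1 <= (4 ^ l)%:R :> R) by rewrite ler1n expn_gt0.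
  rewrite -natrX. by move: ((4 ^ l)%:R : R) => X; lra.
rewrite -!EFinM lee_fin natrX (_ : 4%:R = 2 * 2); last by lra.
rewrite exprMn exprVn.
have z0 : 2 ^+ l != 0 :> R by rewrite expf_neq0.
rewrite [leRHS](_ : _ = q%:R * (radius t * (2 * 2 ^+ l))); last by field.
by rewrite ler_wpM2l// ler_wpM2l ?radius_ge0.
Qed.

Lemma ae_zero_frequency : (@lebesgue_measure R).-negligible
  [set v : R | 0 <= v <= 1 /\ exists2 t, 0 < t <= 1 & upper_pos [set n | t <= iter n boole v]].
Proof.
pose B := [set v : R | exists2 t, 0 < t <= 1 & upper_pos [set n | t <= iter n boole v]].
suff B0 : law 1 B = 0%E by apply: (null_subset _ (law_null B0)) => v [? ?].
apply/negligible_lebesgue.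
pose D m q := lim_sup_set (fun l => quadrant `&` cauchy 1 @^-1` often m.+1%:R^-1 l q) : set R.
apply: (@null_subset _ _ (\bigcup_m \bigcup_q D m q)); last first.
  apply: null_bigcup => m; apply: null_bigcup => q; apply: borel_cantelli_geometric => l.
  by apply: law_often; rewrite invr_gt0 ltr0n /= invf_le1 ?ltr0n// ler1n.
(* Passing from k to the next power of 4 loses a factor at most 4, hence 4 * q. *)
move=> a [qa [t /andP[t0 t1] [q hq]]]; exists (Num.trunc t^-1) => //; exists (4 * q)%N => // N _.
have [k [Nk k0 kq]] := hq (4 ^ N)%N.
have /andP[l1 l2] := @trunc_log_bounds 4 k isT k0.
set l := trunc_log 4 k in l1 l2.
have Nl : (N < l.+1)%N by rewrite -(@ltn_exp2l 4)// (leq_ltn_trans Nk).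
exists l.+1 => /=; first exact: ltnW.
split => //=; apply: (@leq_trans (4 * k)); first by rewrite expnS leq_mul2l l1.
rewrite -mulnA leq_mul2l /= (leq_trans kq)// leq_mul2l; apply/orP; right.
apply: (leq_trans (cnt_incr _ _ (ltnW l2))); apply: cnt_mono => n /=; apply: le_trans.
rewrite -[leRHS]invrK lef_pV2 ?posrE ?invr_gt0// ltW//.
have ti : 0 <= t^-1 by rewrite invr_ge0 ltW.
by have /andP[_] := truncn_itv ti.
Qed.

End zero_frequency.

(** * Conservativity and dense orbits *)

Section wandering.
Context {R : realType}.
Implicit Types (v y t : R) (B W : set R).
Local Open Scope ereal_scope.

(* The pullbacks under n - k iterates of the sets on the left are disjoint and lie in
   the n-th preimage of `[1/2, +oo[, of measure at most 1 / scale n; the law at scale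
   n - k <= n dominates law 1 up to the same factor. *)
Lemma law_wandering_le W n : measurable W ->
  (forall v k l, W (iter k boole v) -> W (iter l boole v) -> k = l) ->
  \sum_(k < n.+1) law 1 (W `&` iter k boole @^-1` `[2^-1%R, +oo[%classic) <= 1.
Proof.
move=> mW wW; set A := `[2^-1%R, +oo[%classic.
have mA : measurable (A : set R) by exact: measurable_itv.
pose C (k : nat) := W `&` iter k boole @^-1` A.
have mC k : measurable (C k) by apply: measurableI => //; exact: measurable_boole_preimage.
pose D (k : 'I_n.+1) := quadrant `&` cauchy 1 @^-1` (iter (n - k) boole @^-1` C k).
have mD k : measurable (D k) by exact: measurable_law_set.
have tD : trivIset setT D.
  move=> k l _ _ [a [[_ [h1 _]] [_ [h2 _]]]]; apply: ord_inj.
  have := wW _ _ _ h1 h2; have := ltn_ord k; have := ltn_ord l; lia.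
have s0 := @scale_gt0 R n.
have : \sum_(k < n.+1) lebesgue_measure (D k) <= (scale n)^-1%:E.
  have mU : measurable (\big[setU/set0]_(k < n.+1) D k) by apply: bigsetU_measurable => k _.
  have E := measure_semi_additive_ord (@lebesgue_measure R) mD tD mU.
  rewrite -(_ : lebesgue_measure (\big[setU/set0]_(k < n.+1) D k) = \sum_(k < n.+1) lebesgue_measure (D k))//.
  apply: (@le_trans _ _ (law 1 (iter n boole @^-1` A))).
    apply: lebesgue_le => a; rewrite -bigcup_mkord_ord => -[k /= kn [qa [_ h]]].
    split => //=; move: h => /=; rewrite -iterD subnKC//; exact: ltnSE.
  rewrite /law law_iter// (le_trans (law_ray_le s0 _))//; first by lra.
  rewrite /radius invrK (_ : (2 - 1 = 1)%R) ?sqrtr1 ?mul1r//; lra.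
move=> h; rewrite -(@lee_pmul2l R (scale n)^-1%:E) ?lte_fin ?invr_gt0// mule1.
apply: le_trans h; rewrite ge0_sume_distrr; last by move=> k _; exact: lebesgue_ge0.
apply: lee_sum => k _; rewrite /D law_iter//.
apply: (@le_trans _ _ ((scale (n - k))^-1%:E * law 1 (C k))).
  apply: lee_wpmul2r; first exact: lebesgue_ge0.
  by rewrite lee_fin lef_pV2 ?posrE ?scale_gt0// scale_mono// leq_subr.
rewrite -(@lee_pmul2l R (scale (n - k))%:E) ?lte_fin ?scale_gt0// muleA -EFinM.
by rewrite divff ?gt_eqF ?scale_gt0// mul1e law1_le// scale_ge1.
Qed.

(** By [law_wandering_le] and Borel-Cantelli, almost every point of W visits [1/2, +oo[ finitely
    often; but by [boole_recurrent] every orbit that avoids 0 does so infinitely often, and the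
    preimages of 0 are null. *)
Lemma wandering_null W : measurable W ->
  (forall v k l, W (iter k boole v) -> W (iter l boole v) -> k = l) -> law 1 W = 0.
Proof.
move=> mW wW; apply/negligible_lebesgue.
set A := `[2^-1%R, +oo[%classic : set R.
pose F (k : nat) := quadrant `&` cauchy 1 @^-1` (W `&` iter k boole @^-1` A).
apply: (@null_subset _ _ (lim_sup_set F `|` \bigcup_k (quadrant `&` cauchy 1 @^-1` (iter k boole @^-1` [set 0%R])))).
  move=> a [qa Wa]; have [[k h]|h] := pselect (exists k, iter k boole (cauchy 1 a) = 0%R); first by right; exists k.
  left => N _; have v01 : (0 <= cauchy 1 a <= 1)%R by rewrite (ltW (cauchy_gt0 _ qa)) cauchy_le1.
  have [|n Nn hn] := boole_recurrent v01 _ N; first by move=> n; apply/eqP => hn; apply: h; exists n.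
  by exists n => //; split => //; split => //=; rewrite /A /= in_itv /= hn.
apply: null_setU.
  apply: borel_cantelli; apply: (@le_lt_trans _ _ 1); last by rewrite ltry.
  apply: lime_le.
    by apply: is_cvg_nneseries => k _ _; exact: lebesgue_ge0.
  apply: nearW => n; rewrite big_mkord.
  apply: le_trans (@law_wandering_le W n mW wW).
  rewrite big_ord_recr /= -[leLHS]adde0; apply: leeD => //; exact: lebesgue_ge0.
apply: null_bigcup => k; apply/negligible_lebesgue; rewrite law_iter; last exact: measurable_set1.
rewrite /law (_ : _ `&` _ = set0) ?measure0//.
by apply/seteqP; split => // a [qa /= h]; have := cauchy_gt0 (scale k) qa; rewrite h ltxx.
Qed.

End wandering.

Section dense_orbits.
Context {R : realType}.
Implicit Types (v x y t c d : R).

(* Points of [c, d] that eventually stop visiting it are in a preimage of the wandering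
   set W of last visits, and boole^n maps them onto the set of points that never visit. *)
Lemma ae_visits c d : 0 <= c -> c < d -> d <= 1 -> (@lebesgue_measure R).-negligible
  [set v | 0 <= v <= 1 /\ forall n, ~ (c <= iter n boole v <= d)].
Proof.
move=> c0 cd d1; set N := [set v | _].
have [n hn] := boole_onto c0 cd d1.
pose J : set R := `[c, d]%classic.
have JE x : J x = (c <= x <= d) :> Prop by rewrite /J /= in_itv.
have mJ : measurable J by exact: measurable_itv.
pose W := J `&` \bigcap_m (iter m.+1 boole @^-1` (~` J)).
have mW : measurable W.
  apply: measurableI => //; apply: bigcapT_measurable => m.
  by apply: measurable_boole_preimage; exact: measurableC.
have wW v k l : W (iter k boole v) -> W (iter l boole v) -> k = l.
  wlog kl : k l / (k < l)%N.
    by move=> H hk hl; have [h|h|//] := ltngtP k l; [exact: H|apply/esym; exact: H].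
  move=> [_ /(_ (l - k).-1 I) /= h] [hl _]; exfalso; apply: h.
  by rewrite -iterS prednK ?subn_gt0// -iterD subnK// ltnW.
have W0 k : (@lebesgue_measure R).-negligible ((iter k boole @^-1` W) `&` [set v | 0 <= v <= 1]).
  apply/law_null/wandering_null; first exact: measurable_boole_preimage.
  move=> v i j /= hi hj; apply: (@addnI k); apply: (wW v); by rewrite iterD.
pose E := [set x | c <= x <= d /\ N (iter n boole x)].
have EW : E `<=` \bigcup_k ((iter k boole @^-1` W) `&` [set v | 0 <= v <= 1]).
  move=> x [cxd [_ hx]].
  have x01 : 0 <= x <= 1 by case/andP: cxd => h1 h2; rewrite (le_trans c0)//= (le_trans h2).
  have ex : exists k, (k <= n)%N && `[< J (iter k boole x) >] by exists 0%N; apply/asboolP; rewrite JE.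
  have bd k : (k <= n)%N && `[< J (iter k boole x) >] -> (k <= n)%N by case/andP.
  (* The last visit up to time n. None follows, because the n-th iterate of x is in N; so the k-th
     iterate is in W. *)
  have [k /andP[kn /asboolP Jk] kmax] := ex_maxnP ex bd.
  exists k => //; split => //; split => //= m _ /= Jm.
  have [mn|mn] := leqP (m.+1 + k) n.
    have Jm' : J (iter (m.+1 + k)%N boole x) by rewrite iterD.
    by have := kmax (m.+1 + k)%N; rewrite mn asboolT//= => /(_ isT); rewrite addSn ltnNge leq_addl.
  apply: (hx (m.+1 + k - n)%N); rewrite -JE -iterD subnK ?(ltnW mn)//.
  by rewrite iterD.
have NE : N `<=` iter n boole @` E.
  move=> z Nz; have [z01 _] := Nz; have [x cxd xz] := hn z z01.
  by exists x => //; split => //; rewrite xz.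
apply: (null_subset NE); apply: (@negligible_lipschitz_image _ (16 ^+ n)); first exact: exprn_gt0.
  have E01 x : E x -> 0 <= x <= 1.
    by move=> [/andP[h1 h2] _]; rewrite (le_trans c0)//= (le_trans h2).
  by move=> x y /E01 ? /E01 ?; exact: iter_boole_lipschitz.
by apply: (null_subset EW); exact: null_bigcup.
Qed.

Lemma ae_dense : (@lebesgue_measure R).-negligible
  [set v | 0 <= v <= 1 /\ ~ forall y, 0 <= y <= 1 -> limit_points some_time (fun n => iter n boole v) y].
Proof.
pose D k i := [set v : R | 0 <= v <= 1 /\ forall n, ~ (i%:R / k.+1%:R <= iter n boole v <= i.+1%:R / k.+1%:R)].
have k0 k : 0 < k.+1%:R :> R by rewrite ltr0n.
have D0 k i : (i < k.+1)%N -> (@lebesgue_measure R).-negligible (D k i).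
  move=> ik; apply: ae_visits; first by rewrite divr_ge0.
    by rewrite ltr_pM2r ?invr_gt0// ltr_nat.
  by rewrite ler_pdivrMr// mul1r ler_nat.
apply: (@null_subset _ _ (\bigcup_k \bigcup_i if (i < k.+1)%N then D k i else set0)); last first.
  apply: null_bigcup => k; apply: null_bigcup => i; case: ifP => [/D0//|_]; exact: negligible_set0.
move=> v [v01 h]; apply: contrapT => h2; apply: h => y /andP[y0 y1] e e0.
apply: contrapT => h3; apply: h2.
pose k := Num.trunc e^-1; exists k => //.
have ke : k.+1%:R^-1 < e.
  have ei : 0 <= e^-1 by rewrite invr_ge0 ltW.
  rewrite -[ltRHS]invrK ltf_pV2 ?posrE ?invr_gt0//.
  by have /andP[_] := truncn_itv ei.
have [i ik /andP[iy yi]] : exists2 i, (i < k.+1)%N & i%:R <= k.+1%:R * y <= i.+1%:R.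
  have ky0 : 0 <= k.+1%:R * y by rewrite mulr_ge0.
  have /andP[j1 j2] := truncn_itv ky0.
  have [jk|jk] := ltnP (Num.trunc (k.+1%:R * y)) k.+1; first by exists (Num.trunc (k.+1%:R * y)); rewrite ?j1 ?ltW.
  exists k => //; have := ler_nat R k.+1 (Num.trunc (k.+1%:R * y)); rewrite jk => h4.
  have h5 : k.+1%:R * y <= k.+1%:R by rewrite ler_piMr.
  by rewrite h5 andbT (le_trans _ j1)// ler_nat ltnW.
exists i => //; rewrite ik; split => // n /andP[n1 n2]; apply: h3; exists n.
rewrite /near_times /=; apply: le_lt_trans ke.
have y1' : i%:R / k.+1%:R <= y by rewrite ler_pdivrMr// mulrC.
have y2' : y <= i.+1%:R / k.+1%:R by rewrite ler_pdivlMr// mulrC.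
have ik1 : i.+1%:R / k.+1%:R = i%:R / k.+1%:R + k.+1%:R^-1 :> R by rewrite -natr1 mulrDl mul1r.
move: n1 n2 y1' y2'; rewrite ik1; move: (i%:R / k.+1%:R : R) (k.+1%:R^-1 : R) (iter n boole v) => p q z *.
by rewrite ler_norml; apply/andP; split; lra.
Qed.

End dense_orbits.

Section boole_ae.
Context {R : realType}.
Implicit Types (a b q v x y t : R).

Lemma lower_pos_setC S : ~ upper_pos (~` S) -> lower_pos S.
Proof.
move=> h; apply: contrapT => h2; apply: h; exists 2%N => N; apply: contrapT => h3.
apply: h2; exists 2%N, N.+1 => k Nk; rewrite leqNgt; apply/negP => h4; apply: h3.
by exists k; have := cntC S 0 k; split; lia.
Qed.

(** The image of [a, b] under some iterate covers [0, 1], so this iterate minus the identity takes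
    both signs on [a, b]. *)
Lemma boole_periodic a b : 0 <= a -> a < b -> b <= 1 ->
  exists2 q, a <= q <= b & exists2 n, (0 < n)%N & iter n boole q = q.
Proof.
(* With zero iterates, the covering says that [a, b] contains 0, which is a fixed point. *)
move=> a0 ab b1; have [[|n] hn] := boole_onto a0 ab b1.
  have [|x /andP[ax xb] /= x0] := hn 0; first by rewrite lexx ler01.
  by exists x; [rewrite ax xb|exists 1%N; rewrite //= x0 boole0].
have [|x1 /andP[a1 b1'] e1] := hn 0; first by rewrite lexx ler01.
have [|x2 /andP[a2 b2] e2] := hn 1; first by rewrite lexx ler01.
pose g x := iter n.+1 boole x - x.
have cg : continuous g.
  by move=> x; apply: cvgB; [exact: (@continuous_iter_boole R n.+1)|exact: cvg_id].
have g1 : g x1 <= 0 by rewrite /g e1; lra.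
have g2 : 0 <= g x2 by rewrite /g e2; lra.
have [x x12 gx] : exists2 x, Num.min x1 x2 <= x <= Num.max x1 x2 & g x = 0.
  have h0 : Num.min (g x1) (g x2) <= 0 <= Num.max (g x1) (g x2) by rewrite ge_min g1 le_max g2 orbT.
  have [h|/ltW h] := leP x1 x2.
    by have [|c hc gc] := IVT h _ h0; [exact: continuous_subspaceT|exists c].
  rewrite minC maxC in h0.
  by have [|c hc gc] := IVT h _ h0; [exact: continuous_subspaceT|exists c].
exists x; last by exists n.+1 => //; apply/eqP; rewrite -subr_eq0; apply/eqP.
move: x12; rewrite ge_min le_max => /andP[/orP h3 /orP h4].
by apply/andP; split; [case: h3|case: h4]; lra.
Qed.

Lemma pattern_101011 x : 0 <= x <= 1 ->
  (forall y, 0 <= y <= 1 -> limit_points some_time (fun n => iter n boole x) y) ->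
  (forall t, 0 < t <= 1 -> ~ upper_pos [set n | t <= iter n boole x]) ->
  pattern [tuple true; false; true; false; true; true] (fun n => iter n boole x).
Proof.
move=> x01; set u := (fun n => iter n boole x) => dense zero.
have u01 n : 0 <= u n <= 1 by exact: iter_boole01.
have hLB y : ~ limit_points lower_banach_pos u y.
  apply: (@no_syndetic R boole (@continuous_boole R) x 0 (2 / 3)).
  - by rewrite eq_sym gt_eqF// divr_gt0.
  - exact: boole0.
  - exact: boole_fix.
  - by apply: dense; rewrite lexx ler01.
  - by apply: dense; apply/andP; split; lra.
have hLD : limit_points lower_pos u 0.
  move=> e e0; apply: lower_pos_setC => h.
  apply: (zero (Num.min e 1)); first by rewrite lt_min e0 ltr01 ge_min lexx orbT.
  apply: upper_posS h => n; rewrite /near_times /= subr0 => /negP; rewrite -leNgt ge_min.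
  by rewrite ger0_norm; [move=> ->|have /andP[] := u01 n].
have hUD y : 0 < y <= 1 -> ~ limit_points upper_pos u y.
  move=> /andP[y0 y1] h; apply: (zero (y / 2)); first by apply/andP; split; lra.
  apply: upper_posS (h (y / 2) _); last by lra.
  by move=> n; rewrite /near_times /= ltr_norml => /andP[h1 h2]; rewrite -/(u n); lra.
have hUB y : 0 <= y <= 1 -> limit_points upper_banach_pos u y.
  move=> /andP[y0 y1]; apply: (@upper_banach_closed R boole x) => e e0.
  have [a [b [a0 ab b1 hab]]] : exists a b, [/\ 0 <= a, a < b, b <= 1 & forall q, a <= q <= b -> `|q - y| < e].
    pose d := Num.min (e / 2) 1; have d0 : 0 < d by rewrite lt_min divr_gt0 ?ltr01.
    have de : d <= e / 2 by rewrite ge_min lexx.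
    have d1 : d <= 1 by rewrite ge_min lexx orbT.
    (* A one-sided interval, on the side where [0, 1] leaves more room. *)
    have [y2|y2] := leP y (2^-1).
      by exists y, (y + d / 2); split; try lra; move=> q /andP[? ?]; rewrite ltr_norml; apply/andP; split; lra.
    by exists (y - d / 2), y; split; try lra; move=> q /andP[? ?]; rewrite ltr_norml; apply/andP; split; lra.
  have [q qab [n n0 qn]] := boole_periodic a0 ab b1.
  exists q; first exact: hab.
  apply: (periodic_upper_banach (@continuous_boole R) n0 qn); apply: dense.
  by case/andP: qab => ? ?; apply/andP; split; lra.
have sub i := @limit_points_mono R i.
move=> [[|[|[|[|[|[|//]]]]]] hi]; rewrite /pattern_at (tnth_nth false) /=.
- by move=> y _ /hLB.
- by exists 0; split; [rewrite /in_K lexx ler01|exact: hLD|exact: hLB].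
- move=> y yK hy; have /andP[y0 y1] := in_K_orbit u01 yK (sub 3 3%N _ isT _ hy).
  have [->//|yn] := eqVneq y 0; exfalso; apply: (hUD y) => //; by rewrite lt_def yn y0.
- exists 1; split; [by rewrite /in_K lexx ler01|by apply: hUB; rewrite lexx ler01|].
  by apply: hUD; rewrite lexx ltr01.
- by move=> y yK /(sub 5 1%N _ isT) hy; apply: hUB; exact: in_K_orbit hy.
- by move=> y yK hy; apply: (sub 4 1%N _ isT); apply: hUB; exact: in_K_orbit hy.
Qed.

Lemma boole_ae_pattern : (@lebesgue_measure R).-negligible
  [set x | 0 <= x <= 1 /\ ~ pattern [tuple true; false; true; false; true; true] (fun n => iter n boole x)].
Proof.
apply: (null_subset _ (null_setU (@ae_zero_frequency R) (@ae_dense R))) => x [x01 hx].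
apply: contrapT => h; apply: hx; apply: pattern_101011 => //.
  by apply: contrapT => h2; apply: h; right.
by move=> t t01 ht; apply: h; left; split => //; exists t.
Qed.

End boole_ae.

Section identity.
Context {R : realType}.
Implicit Types x : R.

Lemma identity_iter x k : iter k id x = x.
Proof. by elim: k. Qed.

Lemma identity_pattern x : in_K x ->
  pattern [tuple false; true; true; true; true; true] (fun k => iter k (@id R) x).
Proof.
move=> xK; have h : limit_points lower_banach_pos (fun k => iter k id x) x.
  move=> e e0; exists 1%N, 0%N => a k _; rewrite mul1n cnt_full// => i _.
  by rewrite /near_times /= identity_iter subrr normr0.
have sub i := @limit_points_mono R i.
have one y : limit_points some_time (fun k => iter k id x) y -> y = x.
  move=> hy; apply/eqP; rewrite -subr_eq0 -normr_le0 leNgt; apply/negP => yx.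
  by have [k] := hy _ yx; rewrite /near_times /= identity_iter distrC ltxx.
move=> [[|[|[|[|[|[|//]]]]]] hi]; rewrite /pattern_at (tnth_nth false) /=.
- by exists x; split => // /(_ 1 ltr01).
- by move=> y _ /(sub 2 4%N _ isT)/one ->.
- by move=> y _ /(sub 3 3%N _ isT)/one ->; exact: (sub 1 1%N _ isT).
- by move=> y _ /(sub 4 2%N _ isT)/one ->; exact: (sub 1 2%N _ isT).
- by move=> y _ /(sub 5 1%N _ isT)/one ->; exact: (sub 1 3%N _ isT).
- by move=> y _ /one ->; exact: (sub 1 4%N _ isT).
Qed.

End identity.

Theorem theorem4 (R : realType) (alpha : 6.-tuple bool)
    (halpha : alpha \in frakA_L) :
  exists (n : nat) (M : riemannianManifold R n) (f : M -> M),
    [/\ (0 < n)%N, C1_map f & has_positive_volume (statistical_class f alpha)].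
Proof.
have last_bit (a : 6.-tuple bool) b : nth false a 5 = b -> tnth a ord_max = b.
  by rewrite (tnth_nth false).
have p01 : 0 <= (0 : R) <= 1 by rewrite lexx ler01.
have cst1 : continuous ((fun=> 1) : R -> R) by move=> x; exact: cvg_cst.
have id_derive (x : R) : is_derive x (1 : R) id 1 by exact: is_derive_id.
have id_ae : (@lebesgue_measure R).-negligible [set x | 0 <= x <= 1 /\
    ~ pattern [tuple false; true; true; true; true; true] (fun k => iter k id x)].
  rewrite (_ : [set x | _] = set0); first exact: negligible_set0.
  by apply/seteqP; split => // x [x01 []]; apply: identity_pattern; rewrite /in_K x01.
have wandering a : @realized_at R a -> tnth a ord_max = false ->
    exists (n : nat) (M : riemannianManifold R n) (f : M -> M),
    [/\ (0 < n)%N, C1_map f & has_positive_volume (statistical_class f a)].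
  move=> [p pp hp] a5; exact: (@realize_wandering R _ _ p (@is_derive_logistic2 R)
    (@continuous_logistic2' R) (@logistic2_01 R) pp [tuple true; false; true; true; true; true]
    (last_bit _ _ erefl) (@logistic_ae_pattern R) a hp a5).
move: halpha; rewrite !inE => /or4P[||| /or4P[||| /or3P[]]] /eqP ->.
- exact: (@realize_ae R id (fun=> 1) 0 id_derive cst1 (fun _ h => h) p01 [tuple false; true; true; true; true; true]
    (last_bit _ _ erefl) id_ae).
- apply: (@realize_wandering R id (fun=> 1) 0 id_derive cst1 (fun _ h => h) p01 [tuple false; true; true; true; true; true]
    (last_bit _ _ erefl) id_ae).
  + move=> [[|[|[|[|[|//]]]]] hi] _; have := @identity_pattern R 0 _ (Ordinal hi);
      by rewrite /pattern_at !(tnth_nth false); apply; rewrite /in_K p01.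
  + exact: last_bit.
- exact: wandering (@realized_101100 R) (last_bit _ _ erefl).
- exact: wandering (@realized_011100 R) (last_bit _ _ erefl).
- exact: (@realize_ae R _ _ 0 (@is_derive_logistic2 R) (@continuous_logistic2' R)
    (@logistic2_01 R) p01 [tuple true; false; true; true; true; true]
    (last_bit _ _ erefl) (@logistic_ae_pattern R)).
- exact: wandering (@realized_101110 R) (last_bit _ _ erefl).
- exact: (@realize_ae R _ _ 0 (@is_derive_boole R) (@continuous_boole' R)
    (@boole01 R) p01 [tuple true; false; true; false; true; true]
    (last_bit _ _ erefl) (@boole_ae_pattern R)).
- exact: wandering (@realized_100100 R) (last_bit _ _ erefl).
- exact: wandering (@realized_110100 R) (last_bit _ _ erefl).
Qed.
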